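(* Assume $f\in C^5(S^1,S^1)$ and $h\in C^5(S^1\times S^1,\mathbb{R})$, where $f$ is uniformly expanding with expansion constant $\omega>1$ and degree $N$ satisfying $N\left(\frac{\max|f''|}{\omega^3}+\frac{1}{\omega^2}\right)<1$. Let $\epsilon_0>0$ and, for $t\in[-\epsilon_0,\epsilon_0]$, the fixed density $\rho(t)\in\mathrm{Lip}(S^1,\mathbb{R}^+)$ of the self-consistent transfer operator $\mathcal L_t$ be as described in the context. Then: (i) there is $\epsilon_1>0$, $\epsilon_1\le\epsilon_0$, such that $\rho(t)\in C^3(S^1,\mathbb{R})$ for all $t\in[-\epsilon_1,\epsilon_1]$; (ii) there is $\epsilon_2>0$, $\epsilon_2\le\epsilon_1$, such that $t\mapsto\rho(t)$ belongs to $C^1([-\epsilon_2,\epsilon_2],C^1(S^1,\mathbb{R}))$; (iii) there is $\epsilon_3>0$, $\epsilon_3\le\epsilon_2$, such that the following linear response formula holds for $|\hat t|<\epsilon_3$: $$\partial_t\rho(t)|_{t=\hat t}=-(1-P_{\hat t}+\hat t P\mathcal K_{\hat t})^{-1}P\mathcal K_{\hat t}(\rho(\hat t)),$$ where $P_{\hat t}=PQ_{\hat t,\rho(\hat t)}$ and the operator $\mathcal K_{\hat t}$ is given by $$\mathcal K_{t}(g)=\left(\left(\frac{\rho(t)}{\Phi_{t,\rho(t)}'}A_g\right)\circ\Phi_{t,\rho(t)}^{-1}\right)',\qquad g\in C^1(S^1,\mathbb{R}).$$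
   Context: $S^1$ is the unit circle, represented as $[0,1]$ with $0$ and $1$ identified, with Lebesgue (Haar) measure; all integrals are with respect to it. $\mathbb{R}^+$ is the set of positive reals, $\mathbb R_0^+=\mathbb R^+\cup\{0\}$. A prime denotes the derivative in the circle variable $x$, and $1$ in the formula of (iii) denotes the identity operator. Uncoupled dynamics: $f:S^1\to S^1$ is uniformly expanding, i.e. there is $\omega>1$ with $|f'(x)|>\omega$ for all $x\in S^1$; $f$ is an $N$-fold covering map. Its transfer operator is $P\varphi(x)=\sum_{y\in f^{-1}(x)}\frac{\varphi(y)}{|f'(y)|}$. Coupling: $A_g(x)=\int_{S^1}h(x,y)g(y)\,dy$ for integrable $g$. For $t\in[-\epsilon_0,\epsilon_0]$ and $\psi\in L^1(S^1,\mathbb{R}_0^+)$ with $\int\psi=1$, $\Phi_{t,\psi}:S^1\to S^1$ is $\Phi_{t,\psi}(x)=x+tA_\psi(x)$ (mod 1). The number $\epsilon_0$ is small enough that every such $\Phi_{t,\psi}$ is a diffeomorphism with $\Phi_{t,\psi}'>0$. Its transfer operator is $Q_{t,\psi}\varphi=\frac{\varphi}{\Phi_{t,\psi}'}\circ\Phi_{t,\psi}^{-1}$. Self-consistent transfer operator: for a probability density $\psi$, $Q_t(\psi):=Q_{t,\psi}\psi$ and $\mathcal L_t(\psi):=P(Q_t(\psi))$ (a nonlinear map). The number $\epsilon_0>0$ is moreover small enough that, for every $t\in[-\epsilon_0,\epsilon_0]$, $\mathcal L_t$ has a unique fixed non-negative probability density $\rho(t)\in\mathrm{Lip}(S^1,\mathbb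 R^+)$, and there are constants $\tilde K>0$, $\Lambda<1$ such that $\|\mathcal L_t^n\varphi-\rho(t)\|_{C^0}\le\tilde K\Lambda^n$ for all $n\in\mathbb N$ and every non-negative Lipschitz $\varphi$ with $\int\varphi=1$. *)

(* Defs.v *)
From HB Require Import structures.
From mathcomp Require Import all_boot all_order all_algebra.
From mathcomp Require Import all_classical all_reals all_analysis.

Set Implicit Arguments.
Unset Strict Implicit.
Unset Printing Implicit Defensive.
Import Order.TTheory GRing.Theory Num.Theory.
Import numFieldNormedType.Exports.

Local Open Scope ring_scope.
Local Open Scope classical_set_scope.

(* S^1 = R/Z.  A function on S^1 is a 1-periodic function on R, a function on
   S^1 x S^1 is a function on R * R which is 1-periodic in each variable, and a
   self-map of S^1 is given by a lift R -> R.  Integrals over S^1 are Lebesgue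
   integrals over [0, 1]. *)

(* C^k regularity.  Only used for V = R and V = R * R: in finite dimension, F is
   C^(k+1) iff it is differentiable and its directional derivatives are C^k. *)
Fixpoint Ck (R : realType) (V : normedModType R) (k : nat) (F : V -> R) : Prop :=
  match k with
  | 0%N => continuous F
  | k'.+1 => (forall x, differentiable F x) /\ (forall v, Ck k' ('D_v F))
  end.

Definition circle_Ck (R : realType) (k : nat) (g : R -> R) : Prop :=
  periodic g 1 /\ Ck k g.

Definition torus_Ck (R : realType) (k : nat) (h : R * R -> R) : Prop :=
  [/\ forall y, periodic (fun x => h (x, y)) 1,
      forall x, periodic (fun y => h (x, y)) 1
    & Ck k h].

(* F lifts a self-map of S^1 of topological degree N or - N; when F' does not
   vanish, this map is an N-fold covering. *)
Definition degree_lift (R : realType) (N : nat) (F : R -> R) : Prop :=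
  exists2 d : int, absz d = N & forall x, F (x + 1) = F x + d%:~R.

Definition circle_diffeo (R : realType) (Phi : R -> R) : Prop :=
  [/\ degree_lift 1 Phi, Ck 1 Phi
    & exists2 G : R -> R, Ck 1 G & cancel Phi G /\ cancel G Phi].

(* Extended-real valued, so that an unbounded g has norm +oo. *)
Definition C0norm (R : realType) (g : R -> R) : \bar R :=
  ereal_sup (range (fun x => `|g x|%:E)).

Definition C1norm (R : realType) (g : R -> R) : \bar R :=
  (C0norm g + C0norm g^`())%E.

Definition circle_integral (R : realType) (g : R -> R) : R :=
  \int[@lebesgue_measure R]_(x in `[0, 1]) g x.

Definition density (R : realType) (psi : R -> R) : Prop :=
  [/\ periodic psi 1, forall x, 0 <= psi x,
      (@lebesgue_measure R).-integrable `[0, 1] (EFin \o psi)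
    & circle_integral psi = 1].

Definition fiber (R : realType) (f : R -> R) (x : R) : set R :=
  [set y | 0 <= y < 1 /\ exists k : int, f y = x + k%:~R].

Definition transferP (R : realType) (f phi : R -> R) : R -> R :=
  fun x => \sum_(y \in fiber f x) (phi y / `|f^`() y|).

Definition meanA (R : realType) (h : R * R -> R) (g : R -> R) : R -> R :=
  fun x => circle_integral (fun y => h (x, y) * g y).

Definition couplingPhi (R : realType) (h : R * R -> R) (t : R) (psi : R -> R)
    : R -> R :=
  fun x => x + t * meanA h psi x.

(* Here and below [pinv setT Phi] is the inverse of the bijection Phi. *)
Definition transferQ (R : realType) (h : R * R -> R) (t : R) (psi phi : R -> R)
    : R -> R :=
  let Phi := couplingPhi h t psi in
  let dPhi := Phi^`() in
  (fun x => phi x / dPhi x) \o pinv setT Phi.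

Definition selfL (R : realType) (f : R -> R) (h : R * R -> R) (t : R)
    (psi : R -> R) : R -> R :=
  transferP f (transferQ h t psi psi).

Definition operK (R : realType) (h : R * R -> R) (t : R) (rho_t g : R -> R)
    : R -> R :=
  let Phi := couplingPhi h t rho_t in
  let dPhi := Phi^`() in
  ((fun x => rho_t x / dPhi x * meanA h g x) \o pinv setT Phi)^`().

(* v is the derivative at t of u, as a curve defined on I with values in
   C^1(S^1, R); it is one-sided if t is an endpoint of the interval I. *)
Definition C1_deriv_at (R : realType) (I : set R) (u : R -> R -> R) (t : R)
    (v : R -> R) : Prop :=
  C1norm (fun x => (u s x - u t x) / (s - t) - v x) @[s --> within I t^'] --> 0%E.

(* u belongs to C^1(I, C^1(S^1, R)). *)
Definition C1_curve (R : realType) (I : set R) (u : R -> R -> R) : Prop :=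
  (forall t, I t -> circle_Ck 1 (u t)) /\
  exists v : R -> R -> R, forall t, I t ->
    [/\ circle_Ck 1 (v t), C1_deriv_at I u t (v t)
      & C1norm (v s \- v t) @[s --> within I (nbhs t)] --> 0%E].

(* 1 - P_t + t P K_t takes values in the functions of zero mean, so its inverse
   only makes sense on this space. *)
Definition C1_mean0 (R : realType) : set (R -> R) :=
  [set g | circle_Ck 1 g /\ circle_integral g = 0].

(* J is the inverse of L on D, bounded for the C^1 norm. *)
Definition is_inverse_on (R : realType) (D : set (R -> R))
    (L J : (R -> R) -> (R -> R)) : Prop :=
  [/\ forall g, D g -> D (L g), forall g, D g -> D (J g),
      forall g, D g -> J (L g) = g, forall g, D g -> L (J g) = g
    & exists C : R, forall g, D g -> (C1norm (J g) <= C%:E * C1norm g)%E].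

(* Main.v *)
Require Import Defs.
From mathcomp Require Import all_boot all_order all_algebra.
From mathcomp Require Import all_classical all_reals all_analysis.
From mathcomp Require Import zify ring lra.
Import Order.TTheory GRing.Theory Num.Theory.
Import numFieldNormedType.Exports.
Local Open Scope ring_scope.
Local Open Scope classical_set_scope.

(* The hypothesis on N says that the transfer operator P of f contracts the
   Lipschitz seminorm on functions of zero mean.  By perturbation so do, for
   small t, the operators P Q_t and P Q_t - t P K_t, where Q_t is the transfer
   operator of Phi_(t, rho t); K_t is bounded from C^0 to C^2, as A_g inherits
   the smoothness of h.  Hence 1 - P Q_t + t P K_t has an inverse on zero mean
   C^1 functions, obtained by iteration, and rho t - 1 is the C^1 solution u of
   u = P Q_t u + (P Q_t 1 - 1).  Differentiating rho t = P Q_t (rho t) gives for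
   rho' and then for rho'' an equation v = W v + b with W a contraction of the
   sup norm and b in C^1, so that rho t is bounded in C^3 uniformly in t.

   For the dependence on t, Q_s = Q_c Q_t where c is defined by
   id + c = Phi_s o Phi_t^-1, and Q_c chi = chi - (c chi)' + O(|c|^2) in C^1.
   Together with the fixed point equations this shows first that
   rho s - rho t = O(|s - t|) in C^2, and then that the difference quotient u of
   rho satisfies (1 - P Q_t + t P K_t) u = - P K_t (rho t) + O(|s - t|) in C^1,
   uniformly in s and t; the formula follows by applying the inverse. *)

Set Implicit Arguments.
Unset Strict Implicit.
Unset Printing Implicit Defensive.

(** The main obstacle is that [Phi_s] depends on [rho s] itself: its displacement differs from that
    of [Phi_t] by [(s - t) A (rho s) + t A (rho s - rho t)], so the increment to be estimated
    reappears on the right. It can be absorbed for small [t] because of the factor [t] and because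
    [A] is controlled by the sup norm of its argument. The second obstacle is a loss of derivatives:
    replacing [Q_c chi] by [chi] costs one derivative and the first order expansion costs two, so an
    expansion in [C^1] needs [chi] in [C^3], uniformly in [t].

    No function space is built. Estimates are explicit bounds whose constants are quantified before
    the functions and before [t]; this is how uniformity in [t] is carried along. On functions of
    zero mean the Lipschitz seminorm dominates the sup norm and serves as the norm; for the
    equations satisfied by the derivatives of [rho t], the weighted norm [gauge] takes its place. *)

Definition drv {R : realType} (g g' : R -> R) : Prop :=
  forall x : R, is_derive x (1 : R) g (g' x).

(* An inductive predicate rather than a fixpoint, so that unification never unfolds it. *)
Inductive CkB {R : realType} : nat -> R -> (R -> R) -> Prop :=
| CkB_0 M g : (forall x, `|g x| <= M) -> continuous g -> CkB 0 M g
| CkB_succ k M g : (forall x, `|g x| <= M) -> (forall x : R, derivable g x (1 : R)) ->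
    CkB k M g^`() -> CkB k.+1 M g.

Definition Lip {R : realType} (M : R) (g : R -> R) : Prop :=
  forall x y, `|g x - g y| <= M * `|x - y|.

(** * Functions on the line with bounded derivatives *)

Section calculus.
Context {R : realType}.
Implicit Types f g : R -> R.

Lemma drv_E g g' : drv g g' -> g^`() = g'.
Proof. by move=> d; apply/funext => x; rewrite derive1E; apply: derive_val. Qed.

Lemma drv_derive1 g : (forall x : R, derivable g x (1 : R)) -> drv g g^`().
Proof. by move=> d x; rewrite derive1E; apply: DeriveDef => //; exact: d. Qed.

Lemma drv_derivable g g' : drv g g' -> forall x : R, derivable g x (1:R).
Proof. by move=> d x; apply: ex_derive. Qed.

Lemma drv_cont g g' : drv g g' -> continuous g.
Proof.
move=> d x; apply: differentiable_continuous; apply/derivable1_diffP.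
exact: (drv_derivable d).
Qed.

Lemma eq_drv g g1 g2 : drv g g1 -> g1 =1 g2 -> drv g g2.
Proof. by move=> d e x; rewrite -e. Qed.

Lemma drvD f f' g g' : drv f f' -> drv g g' ->
  drv (fun x => f x + g x) (fun x => f' x + g' x).
Proof. by move=> df dg x; apply: is_deriveD. Qed.

Lemma drvB f f' g g' : drv f f' -> drv g g' ->
  drv (fun x => f x - g x) (fun x => f' x - g' x).
Proof. by move=> df dg x; apply: is_deriveB. Qed.

Lemma drvM f f' g g' : drv f f' -> drv g g' ->
  drv (fun x => f x * g x) (fun x => f' x * g x + f x * g' x).
Proof.
move=> df dg x; apply: is_derive_eq (is_deriveM (df x) (dg x)) _.
by rewrite /GRing.scale /= addrC mulrC.
Qed.

Lemma drvZ c g g' : drv g g' -> drv (fun x => c * g x) (fun x => c * g' x).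
Proof. by move=> dg x; apply: (@is_deriveZ R R R g c). Qed.

Lemma drv_cst c : drv (fun _ : R => c) (fun _ => 0).
Proof. by move=> x; apply: is_derive_cst. Qed.

Lemma drv_id : drv (fun x : R => x) (fun _ => 1).
Proof. by move=> x; apply: is_derive_id. Qed.

Lemma drv_comp f f' g g' : drv f f' -> drv g g' ->
  drv (fun x => f (g x)) (fun x => f' (g x) * g' x).
Proof. by move=> df dg x; apply: (is_derive1_comp (df _) (dg x)). Qed.

Lemma drv_shift c g g' : drv g g' -> drv (fun x => g (x + c)) (fun x => g' (x + c)).
Proof.
move=> dg; apply: eq_drv (drv_comp dg (drvD drv_id (drv_cst c))) _ => x /=.
by rewrite addr0 mulr1.
Qed.

Lemma drvV g g' : drv g g' -> (forall x, g x != 0) ->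
  drv (fun x => (g x)^-1) (fun x => - g' x * (g x)^-1 ^+ 2).
Proof.
move=> dg g0 x; apply: is_derive_eq (@is_deriveV R g x _ _ (g0 x) (dg x)) _.
by rewrite /GRing.scale /= exprVn; ring.
Qed.

Lemma drv_sum n (F F' : 'I_n -> R -> R) : (forall i, drv (F i) (F' i)) ->
  drv (fun x => \sum_(i < n) F i x) (fun x => \sum_(i < n) F' i x).
Proof.
move=> d x; have := @is_derive_sum R R R n F x 1 (fun i => F' i x) (fun i => d i x).
by rewrite fct_sumE.
Qed.

(** The bound on [z] is free of orientation, so [x] may lie on either side of [y]; it makes the
    remainder in [CkB_taylor2] quadratic. *)
Lemma drv_MVT g g' x y : drv g g' ->
  exists2 z, `|z - y| <= `|x - y| & g x - g y = g' z * (x - y).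
Proof.
move=> d; have H u v : u <= v -> exists z, [/\ u <= z, z <= v & g v - g u = g' z * (v - u)].
  move=> uv; have [|||z] := @MVT_segment R g g' u v => //.
  - by apply: continuous_subspaceT; apply: drv_cont d.
  - by rewrite in_itv /= => /andP[? ?] ?; exists z.
have [/H|/ltW/H] := leP y x; move=> [z [z1 z2 e]]; exists z => //.
- by rewrite !ger0_norm ?subr_ge0//; [lra | exact: le_trans z2].
- by rewrite ler0_norm ?ler0_norm ?subr_le0//; [lra | exact: le_trans z2].
- by rewrite -opprB e; ring.
Qed.

Lemma drv_Lip M g g' : drv g g' -> (forall x, `|g' x| <= M) -> Lip M g.
Proof.
move=> d b x y; have [z _ ->] := drv_MVT x y d.
by rewrite normrM ler_wpM2r.
Qed.

Lemma drv_limit g g' (x : R) : drv g g' ->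
  forall e : R, 0 < e -> exists2 r : R, 0 < r & forall h : R, h != 0 -> `|h| < r ->
    `|(g (x + h) - g x) / h - g' x| <= e.
Proof.
move=> d e e0; have [ex dv] := d x.
have /cvgrPdist_le /(_ e e0) : (fun h : R => h^-1 *: (g (h *: 1 + x) - g x)) @ 0^' --> g' x.
  by rewrite -dv; exact: ex.
move=> /nbhs_ballP [r /= r0 H]; exists r => // h h0 hr.
have := H h; rewrite /ball /= sub0r normrN => /(_ hr h0).
by rewrite /GRing.scale /= distrC mulr1 [h + x]addrC [h^-1 * _]mulrC.
Qed.

(** Every difference quotient is bounded by [M], and the derivative is within [e] of one of them. *)
Lemma Lip_drv M g g' : drv g g' -> Lip M g -> forall x, `|g' x| <= M.
Proof.
move=> d L x; apply/ler_addgt0Pl => e e0.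
have [r r0 /(_ (r / 2))] := drv_limit x d e0.
have r20 : 0 < r / 2 by rewrite divr_gt0.
rewrite gt_eqF// gtr0_norm// => /(_ isT) /(_ ltac:(lra)).
set q := _ / _ => qe; have qM : `|q| <= M.
  rewrite /q normrM normfV ler_pdivrMr ?normr_gt0 ?gt_eqF//.
  by apply: le_trans (L _ _) _; rewrite addrAC subrr add0r.
have -> : g' x = q - (q - g' x) by ring.
by apply: le_trans (ler_normB _ _) _; lra.
Qed.

End calculus.

(** * Calculus of [C^k] bounds with explicit constants *)

Section CkB.
Context {R : realType}.
Implicit Types f g c chi Psi : R -> R.

Lemma CkB_bnd k M g : CkB k M g -> forall x, `|g x| <= M.
Proof. by case. Qed.

Lemma CkB_ge0 k M g : CkB k M g -> 0 <= M.
Proof. by move/CkB_bnd/(_ 0); apply: le_trans. Qed.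

Lemma CkB_drv k M g : CkB k.+1 M g -> drv g g^`().
Proof. by move=> H; inversion H; exact: drv_derive1. Qed.

Lemma CkB_derive1 k M g : CkB k.+1 M g -> CkB k M g^`().
Proof. by move=> H; inversion H. Qed.

Lemma CkB_S k M g g' : drv g g' -> (forall x, `|g x| <= M) -> CkB k M g' ->
  CkB k.+1 M g.
Proof.
move=> d b c; apply: CkB_succ => //; last by rewrite (drv_E d).
by move=> x; exact: (drv_derivable d).
Qed.

Lemma CkB_cont k M g : CkB k M g -> continuous g.
Proof. by case: k => [H|k /CkB_drv /drv_cont//]; inversion H. Qed.

Lemma CkB_le k M M' g : M <= M' -> CkB k M g -> CkB k M' g.
Proof.
move=> le; elim: k g => [|k IH] g Cg; have b x := le_trans (CkB_bnd Cg x) le.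
  by apply: CkB_0 => //; exact: CkB_cont Cg.
apply: (CkB_S (CkB_drv Cg)) => //; exact: IH (CkB_derive1 Cg).
Qed.

Lemma CkB_pred k M g : CkB k.+1 M g -> CkB k M g.
Proof.
elim: k g => [|k IH] g Cg; have b := CkB_bnd Cg.
  by apply: CkB_0 => //; exact: CkB_cont Cg.
apply: (CkB_S (CkB_drv Cg)) => //; exact: IH (CkB_derive1 Cg).
Qed.

Lemma CkB_leq j k M g : (j <= k)%N -> CkB k M g -> CkB j M g.
Proof.
move=> /subnK <-; elim: (k - j)%N => [//|n IH]; rewrite addSn => /CkB_pred; exact: IH.
Qed.

Lemma CkB_cst k a : CkB k `|a| (fun _ : R => a).
Proof.
elim: k a => [|k IH] a; first by apply: CkB_0 => // x; exact: cvg_cst.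
apply: CkB_S (drv_cst a) _ _ => //; apply: CkB_le (IH 0).
by rewrite normr0.
Qed.

Lemma CkBD k M M' f g : CkB k M f -> CkB k M' g -> CkB k (M + M') (fun x => f x + g x).
Proof.
elim: k f g => [|k IH] f g Hf Hg.
  apply: CkB_0 => x; last by apply: cvgD; [exact: (CkB_cont Hf) | exact: (CkB_cont Hg)].
  by apply: le_trans (ler_normD _ _) _; rewrite lerD ?(CkB_bnd Hf) ?(CkB_bnd Hg).
apply: CkB_S (drvD (CkB_drv Hf) (CkB_drv Hg)) _ _ => [x|].
  by apply: le_trans (ler_normD _ _) _; rewrite lerD ?(CkB_bnd Hf) ?(CkB_bnd Hg).
by apply: IH; exact: CkB_derive1.
Qed.

(** The factor [2 ^+ k] counts the terms of the Leibniz formula, doubled by every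
    differentiation. *)
Lemma CkBM k M M' f g : CkB k M f -> CkB k M' g ->
  CkB k (2 ^+ k * (M * M')) (fun x => f x * g x).
Proof.
have bnd j f1 g1 : CkB j M f1 -> CkB j M' g1 -> forall x, `|f1 x * g1 x| <= M * M'.
  by move=> Hf Hg x; rewrite normrM ler_pM// ?(CkB_bnd Hf) ?(CkB_bnd Hg).
elim: k f g => [|k IH] f g Hf Hg.
  rewrite expr0 mul1r; apply: CkB_0 => [|x]; first exact: bnd Hf Hg.
  by apply: cvgM; [exact: (CkB_cont Hf) | exact: (CkB_cont Hg)].
apply: CkB_S (drvM (CkB_drv Hf) (CkB_drv Hg)) _ _ => [x|].
  apply: le_trans (bnd _ _ _ Hf Hg x) _.
  by rewrite ler_peMl ?mulr_ge0 ?(CkB_ge0 Hf) ?(CkB_ge0 Hg)// exprn_ege1// ler1n.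
rewrite exprS -mulrA mulr_natl mulr2n; apply: CkBD; apply: IH.
- exact: CkB_derive1 Hf.
- exact: CkB_pred Hg.
- exact: CkB_pred Hf.
- exact: CkB_derive1 Hg.
Qed.

Lemma CkBZ k a M g : CkB k M g -> CkB k (`|a| * M) (fun x => a * g x).
Proof.
elim: k g => [|k IH] g Hg.
  apply: CkB_0 => x; last by apply: cvgM; [exact: cvg_cst | exact: (CkB_cont Hg)].
  by rewrite normrM ler_wpM2l ?(CkB_bnd Hg).
apply: CkB_S (drvZ a (CkB_drv Hg)) _ _ => [x|]; last by apply: IH; exact: CkB_derive1.
by rewrite normrM ler_wpM2l ?(CkB_bnd Hg).
Qed.

Lemma CkBN k M g : CkB k M g -> CkB k M (fun x => - g x).
Proof.
move=> /(CkBZ (-1)); rewrite normrN1 mul1r.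
by under [X in CkB _ _ X]eq_fun do rewrite mulN1r.
Qed.

Lemma CkBB k M M' f g : CkB k M f -> CkB k M' g -> CkB k (M + M') (fun x => f x - g x).
Proof. by move=> Hf /CkBN; exact: CkBD. Qed.

Lemma CkB_sum k n M (F : 'I_n -> R -> R) : (forall i, CkB k M (F i)) ->
  CkB k (n%:R * M) (fun x => \sum_(i < n) F i x).
Proof.
elim: n F => [|n IH] F H.
  under [X in CkB _ _ X]eq_fun do rewrite big_ord0.
  by rewrite mul0r; have := CkB_cst k 0; rewrite normr0.
under [X in CkB _ _ X]eq_fun do rewrite big_ord_recr /=.
rewrite -natr1 mulrDl mul1r; apply: CkBD (H _).
by apply: IH => i; exact: H.
Qed.

Lemma CkB_comp0 M g Psi : continuous Psi -> CkB 0 M g -> CkB 0 M (fun x => g (Psi x)).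
Proof.
move=> cP Cg; have cg := CkB_cont Cg; apply: CkB_0 => x; first exact: CkB_bnd Cg _.
exact: (@continuous_comp _ _ _ Psi g x (cP x) (cg _)).
Qed.

(** Only the derivative of [Psi] is bounded, to order [k.-1]: [Psi] will be the lift of a circle map
    or an inverse branch, itself unbounded on the line. *)
Lemma CkB_comp k M : exists2 C : R, 1 <= C & forall m g Psi dPsi,
  drv Psi dPsi -> CkB k.-1 M dPsi -> CkB k m g -> CkB k (C * m) (fun x => g (Psi x)).
Proof.
elim: k => [|k [C C1 IH]].
  exists 1 => // m g Psi dPsi /drv_cont cP _; rewrite mul1r; exact: CkB_comp0.
have [M0|M0] := leP 0 M; last first.
  by exists 1 => // m g Psi dPsi _ /CkB_ge0; rewrite leNgt M0.
have C0 : 0 <= C by apply: le_trans C1.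
exists (1 + 2 ^+ k * (C * M)) => [|m g Psi dPsi dP CP Cg].
  by rewrite lerDl !mulr_ge0// exprn_ge0.
have m0 := CkB_ge0 Cg.
apply: CkB_S (drv_comp (CkB_drv Cg) dP) _ _ => [x|].
  apply: le_trans (CkB_bnd Cg _) _; rewrite ler_peMl//.
  by rewrite lerDl !mulr_ge0// exprn_ge0.
have := IH m g^`() Psi dPsi dP (CkB_leq (leq_pred k) CP) (CkB_derive1 Cg).
move/CkBM => /(_ _ _ CP); apply: CkB_le.
have -> : 2 ^+ k * (C * m * M) = 2 ^+ k * (C * M) * m by ring.
by rewrite ler_wpM2r// lerDr.
Qed.

Lemma CkB_V k M dl : 0 < dl -> exists C : R, forall g, (forall x, dl <= `|g x|) ->
  CkB k M g -> CkB k C (fun x => (g x)^-1).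
Proof.
move=> dl0; have bnd g : (forall x, dl <= `|g x|) ->
    (forall x, g x != 0) /\ (forall x, `|(g x)^-1| <= dl^-1).
  move=> gd; have g0 x : g x != 0 by rewrite -normr_gt0; apply: lt_le_trans (gd x).
  by split=> // x; rewrite normfV lef_pV2// posrE ?normr_gt0.
elim: k => [|k [C IH]].
  exists dl^-1 => g /bnd[g0 gb] Cg; apply: CkB_0 => // x.
  by apply: cvgV => //; exact: (CkB_cont Cg).
exists (dl^-1 + 2 ^+ k * (M * (2 ^+ k * (C * C)))) => g gd Cg; have [g0 gb] := bnd _ gd.
have CV := IH g gd (CkB_pred Cg).
have Cd := CkBM (CkBN (CkB_derive1 Cg)) (CkBM CV CV).
apply: CkB_S (drvV (CkB_drv Cg) g0) _ _ => [x|].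
  by apply: le_trans (gb x) _; rewrite lerDl (CkB_ge0 Cd).
by apply: CkB_le Cd; rewrite lerDr invr_ge0 ltW.
Qed.

(** [Psi] solves the autonomous equation [Psi' = w(Psi)]: an order of regularity gained for [w(Psi)]
    is gained for [Psi], and then again for [w(Psi)]. With [w] the reciprocal of the derivative of a
    diffeomorphism, this bounds the derivative of the inverse by a constant that depends on [w] only
    through [M]. *)
Lemma CkB_inv k M : exists C : R, forall w Psi, CkB k M w -> drv Psi (fun x => w (Psi x)) ->
  CkB k C (fun x => w (Psi x)).
Proof.
elim: k => [|k [C IH]].
  by exists M => w Psi Cw d; apply: CkB_comp0 => //; exact: drv_cont d.
have [C' C'1 H] := CkB_comp k.+1 C; exists (C' * M) => w Psi Cw d.
by apply: (H _ _ _ _ d _ Cw); exact: IH (CkB_pred Cw) d.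
Qed.

Let drv_idD c c' : drv c c' -> drv (fun x => x + c x) (fun x => 1 + c' x).
Proof. by move=> d; exact: drvD drv_id d. Qed.

Let CkB_1D k mc c : mc <= 1 -> CkB k mc c -> CkB k 2 (fun x => 1 + c x).
Proof.
by move=> mc1 Cc; apply: CkB_le (CkBD (CkB_cst k 1) Cc); rewrite normr1; lra.
Qed.

(** A factor [mc] is gained at the price of one derivative of [chi]. The induction closes because
    differentiation yields the same difference for [chi'], plus a term that already carries [c']. *)
Lemma CkB_displacement k : exists2 C : R, 0 <= C & forall m mc chi c, mc <= 1 ->
  CkB k.+1 m chi -> CkB k mc c ->
  CkB k (C * mc * m) (fun x => chi (x + c x) - chi x).
Proof.
elim: k => [|k [C C0 IH]].
  exists 1 => // m mc chi c mc1 Cchi Cc; rewrite mul1r.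
  have cchi := CkB_cont Cchi; have cc := CkB_cont Cc; apply: CkB_0 => x.
    have L := drv_Lip (CkB_drv Cchi) (CkB_bnd (CkB_derive1 Cchi)).
    apply: le_trans (L _ _) _; rewrite mulrC [x + _]addrC addrK.
    by rewrite ler_wpM2r ?(CkB_bnd Cc)// (CkB_ge0 Cchi).
  apply: cvgB; last exact: cchi.
  apply: (@continuous_comp _ _ _ (fun x => x + c x) chi x); last exact: cchi.
  by apply: cvgD; [exact: cvg_id | exact: cc].
have [C2 C21 H2] := CkB_comp k (2 : R); have C20 : 0 <= C2 by exact: le_trans C21.
exists (1 + C + 2 ^+ k * C2) => [|m mc chi c mc1 Cchi Cc].
  by rewrite !addr_ge0// mulr_ge0// exprn_ge0.
have dchi := CkB_drv Cchi; have dc := CkB_drv Cc.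
have m0 := CkB_ge0 Cchi; have mc0 := CkB_ge0 Cc.
have D := IH _ _ _ _ mc1 (CkB_derive1 Cchi) (CkB_pred Cc).
have E := CkBM (CkB_derive1 Cc) (H2 _ _ _ _ (drv_idD dc)
  (CkB_1D mc1 (CkB_leq (leq_pred k) (CkB_derive1 Cc))) (CkB_pred (CkB_derive1 Cchi))).
have Ege := CkB_ge0 E.
have d : drv (fun x => chi (x + c x) - chi x)
    (fun x => derive1 chi (x + c x) - derive1 chi x + derive1 c x * derive1 chi (x + c x)).
  by apply: eq_drv (drvB (drv_comp dchi (drv_idD dc)) dchi) _ => x; ring.
apply: (CkB_S d).
- move=> x; have L := drv_Lip dchi (CkB_bnd (CkB_derive1 Cchi)).
  apply: le_trans (L _ _) _; rewrite [x + _]addrC addrK.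
  apply: (@le_trans _ _ (m * mc)); first by rewrite ler_wpM2l// (CkB_bnd Cc).
  rewrite -[leLHS]mul1r [m * mc]mulrC -mulrA ler_wpM2r ?mulr_ge0// -addrA lerDl.
  by rewrite addr_ge0// mulr_ge0// exprn_ge0.
- apply: CkB_le (CkBD D E); rewrite -subr_ge0.
  have -> : (1 + C + 2 ^+ k * C2) * mc * m - (C * mc * m + 2 ^+ k * (mc * (C2 * m))) = mc * m.
    by ring.
  by rewrite mulr_ge0.
Qed.

(** The second order analogue, at the price of two derivatives. The extra term after
    differentiation, [c' (chi'(x + c) - chi'(x))], is a product of two factors of order [mc], by
    [CkB_displacement]. *)
Lemma CkB_taylor2 k : exists2 C : R, 0 <= C & forall m mc chi c, mc <= 1 ->
  CkB k.+2 m chi -> CkB k mc c ->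
  CkB k (C * mc ^+ 2 * m) (fun x => chi (x + c x) - chi x - c x * derive1 chi x).
Proof.
have bnd k' m mc chi c x : CkB k'.+2 m chi -> CkB k' mc c ->
    `|chi (x + c x) - chi x - c x * derive1 chi x| <= mc ^+ 2 * m.
  move=> Cchi Cc; have [z zle ->] := drv_MVT (x + c x) x (CkB_drv Cchi).
  rewrite [x + _]addrC addrK in zle *.
  have -> : derive1 chi z * c x - c x * derive1 chi x = (derive1 chi z - derive1 chi x) * c x by ring.
  have L := drv_Lip (CkB_drv (CkB_derive1 Cchi)) (CkB_bnd (CkB_derive1 (CkB_derive1 Cchi))).
  have cb := CkB_bnd Cc x; have m0 := CkB_ge0 Cchi.
  rewrite normrM; apply: (@le_trans _ _ (m * `|c x| * `|c x|)).
    by rewrite ler_wpM2r//; apply: le_trans (L _ _) _; rewrite ler_wpM2l.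
  by rewrite mulrC [m * _]mulrC mulrA -expr2 ler_wpM2r// lerXn2r// nnegrE (le_trans _ cb).
elim: k => [|k [C C0 IH]].
  exists 1 => // m mc chi c mc1 Cchi Cc; rewrite mul1r.
  have cchi := CkB_cont Cchi; have cc := CkB_cont Cc; apply: CkB_0 => x; first exact: (bnd 0%N).
  apply: cvgB; last by apply: cvgM; [exact: cc | exact: (CkB_cont (CkB_derive1 Cchi))].
  apply: cvgB; last exact: cchi.
  apply: (@continuous_comp _ _ _ (fun x => x + c x) chi x); last exact: cchi.
  by apply: cvgD; [exact: cvg_id | exact: cc].
have [C2 C20 H2] := CkB_displacement k.
exists (1 + C + 2 ^+ k * C2) => [|m mc chi c mc1 Cchi Cc].
  by rewrite !addr_ge0// mulr_ge0// exprn_ge0.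
have dchi := CkB_drv Cchi; have dc := CkB_drv Cc.
have m0 := CkB_ge0 Cchi; have mc0 := CkB_ge0 Cc.
have D := IH _ _ _ _ mc1 (CkB_derive1 Cchi) (CkB_pred Cc).
have E := CkBM (CkB_derive1 Cc) (H2 _ _ _ _ mc1 (CkB_pred (CkB_derive1 Cchi)) (CkB_pred Cc)).
have X : (1 + C + 2 ^+ k * C2) * mc ^+ 2 * m - (C * mc ^+ 2 * m + 2 ^+ k * (mc * (C2 * mc * m))) = mc ^+ 2 * m.
  by ring.
have d : drv (fun x => chi (x + c x) - chi x - c x * derive1 chi x)
    (fun x => derive1 chi (x + c x) - derive1 chi x - c x * derive1 (derive1 chi) x
              + derive1 c x * (derive1 chi (x + c x) - derive1 chi x)).
  apply: eq_drv (drvB (drvB (drv_comp dchi (drv_idD dc)) dchi)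
    (drvM dc (CkB_drv (CkB_derive1 Cchi)))) _ => x.
  by ring.
apply: (CkB_S d).
- move=> x; apply: le_trans (bnd _ _ _ _ _ x Cchi Cc) _.
  rewrite -X lerBlDr lerDl addr_ge0 ?(CkB_ge0 D)// (CkB_ge0 E)//.
- by apply: CkB_le (CkBD D E); rewrite -subr_ge0 X mulr_ge0// exprn_ge0.
Qed.

End CkB.

(** * Means over the circle and periodic primitives *)

Section circle.
Context {R : realType}.
Implicit Types g U : R -> R.

Lemma periodic_int g (m : int) x : periodic g 1 -> g (x + m%:~R) = g x.
Proof.
move=> p; have pn n y : g (y + n%:R) = g y by exact: periodicn.
case: m => n; first exact: pn.
by rewrite NegzE -(pn n.+1) -addrA rmorphN /= pmulrn addNr addr0.
Qed.

Lemma periodic_frac g x : periodic g 1 -> g (x - (Num.floor x)%:~R) = g x.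
Proof. by move=> p; rewrite -rmorphN /= periodic_int. Qed.

Lemma frac_itv (x : R) : 0 <= x - (Num.floor x)%:~R < 1.
Proof. by have := floor_itv x; rewrite intrD => /andP[? ?]; apply/andP; split; lra. Qed.

Lemma periodic_bounded g : periodic g 1 -> continuous g ->
  exists M, forall x, `|g x| <= M.
Proof.
move=> p c; have cn : continuous (fun x => `|g x|).
  by move=> x; apply: cvg_norm; exact: c.
have [z _ H] := @EVT_max R (fun x => `|g x|) 0 1 ler01 (continuous_subspaceT cn).
exists `|g z| => x; rewrite -(periodic_frac x p); apply: H.
by have /andP[? /ltW ?] := frac_itv x; rewrite in_itv /=; apply/andP.
Qed.

Lemma periodic_derive1 g g' : drv g g' -> periodic g 1 -> periodic g' 1.
Proof.
move=> d p; have d1 := drv_shift 1 d => x.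
by rewrite -(drv_E d) -[in RHS](funext p) (drv_E d1) (drv_E d).
Qed.

Lemma continuous_integrable g a b : continuous g ->
  (@lebesgue_measure R).-integrable `[a, b] (EFin \o g).
Proof.
move=> c; apply: continuous_compact_integrable; first exact: segment_compact.
exact: continuous_subspaceT.
Qed.

(** The integrals from [- n], normalised to vanish at [0], agree wherever two of them are defined;
    [N x] selects one whose interval contains [x]. *)
Lemma continuous_primitive g : continuous g -> exists U, drv U g.
Proof.
move=> c; pose I a b : R := \int[@lebesgue_measure R]_(x in `[a, b]) g x.
pose F (n : nat) x : R := I (- n%:R) x - I (- n%:R) 0.
have dF n (x : R) : `|x| < n%:R -> is_derive (x : R) (1 : R) (F n) (g x).
  move=> /ltr_normlP[x1 x2].
  have [] := @continuous_FTC1 R g (BLeft (- n%:R)) x (x + 1).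
  - by lra.
  - exact: continuous_integrable.
  - by rewrite /= lte_fin; lra.
  - exact: c.
  rewrite -/(I (- n%:R)) => ex v.
  have dI : is_derive (x : R) (1 : R) (fun y => I (- n%:R) y) (g x).
    by apply: DeriveDef; [exact: ex | rewrite -derive1E; exact: v].
  apply: is_derive_eq (is_deriveB dI (is_derive_cst (I (- n%:R) 0) x 1)) _.
  by rewrite subr0.
have FF n m (x : R) : (n <= m)%N -> `|x| < n%:R -> F n x = F m x.
  move=> nm xn; have II (z : R) : - n%:R <= z -> I (- m%:R) z = I (- m%:R) (- n%:R) + I (- n%:R) z.
    move=> nz; have nm' : (n%:R : R) <= m%:R by rewrite ler_nat.
    have B : I (- m%:R) z - I (- m%:R) (- n%:R) =
        \int[@lebesgue_measure R]_(x in `]- n%:R, z]) g x.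
      apply: Rintegral_itvB; first exact: continuous_integrable.
        by rewrite bnd_simp lerN2.
      by rewrite bnd_simp.
    have C : \int[@lebesgue_measure R]_(x in `]- n%:R, z]) g x = I (- n%:R) z.
      apply: Rintegral_itv_obnd_cbnd.
      apply: (integrableS _ _ _ (continuous_integrable (- n%:R) z c)) => //.
      exact: subset_itv_oc_cc.
    by rewrite -C -B; ring.
  have [x1 x2] := ltr_normlP _ _ xn; have n0 : 0 <= n%:R :> R by exact: ler0n.
  have -> : F m x = I (- m%:R) x - I (- m%:R) 0 by [].
  by rewrite (II x) ?(II 0) /F ?oppr_le0 ?ler0n//; [ring | rewrite lerNl ltW].
pose N x := Num.bound `|x : R|; have NP x : `|x| < (N x)%:R by exact: archi_boundP.
exists (fun x => F (N x) x) => x.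
(* The index taken at [|x| + 1] is valid on the whole unit ball around [x], so a single [F n]
   represents the primitive near [x]. *)
have xN : `|x| < (N (`|x| + 1))%:R.
  by apply: lt_trans (NP _); rewrite [ltRHS]gtr0_norm ?ltrDl ?ltr_wpDl.
apply: (@near_eq_is_derive _ _ _ (F (N (`|x| + 1)))); last exact: dF.
have : \forall y \near x, `|y - x| < 1.
  by apply/nbhs_ballP; exists 1 => //= y; rewrite /ball /= distrC.
apply: filterS => y yx; have yN : `|y| < (N (`|x| + 1))%:R.
  apply: lt_trans (NP _).
  rewrite [ltRHS]gtr0_norm; last by rewrite ltr_wpDl.
  have -> : y = x + (y - x) by ring.
  by apply: le_lt_trans (ler_normD _ _) _; rewrite ltrD2l.
have [nm|/ltnW nm] := leqP (N y) (N (`|x| + 1)); first by rewrite (FF _ _ _ nm).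
by rewrite (FF _ _ _ nm).
Qed.

(** The mean is encoded as the increment of a primitive over one period, so that changes of
    variables reduce to the chain rule. *)
Definition hasmean g m := exists2 U, drv U g & forall x, U (x + 1) = U x + m.

Lemma drv_cst0 U : drv U (fun _ => 0) -> forall x y, U x = U y.
Proof. by move=> d x y; exact: is_derive_0_is_cst. Qed.

Lemma drv_integral U g : drv U g -> continuous g -> circle_integral g = U 1 - U 0.
Proof.
move=> d c; have cU := drv_cont d.
rewrite /circle_integral /Rintegral (@continuous_FTC2 R g U 0 1) //.
- exact: continuous_subspaceT.
- split.
  + by move=> x _; exact: (drv_derivable d).
  + by apply: cvg_at_right_filter; exact: cU.
  + by apply: cvg_at_left_filter; exact: cU.
- by move=> x _; rewrite (drv_E d).
Qed.

Lemma hasmean_integral g m : continuous g -> hasmean g m -> circle_integral g = m.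
Proof.
by move=> c [U d p]; rewrite (drv_integral d c) -{1}[1]add0r p addrC addKr.
Qed.

Lemma integral_hasmean g : continuous g -> periodic g 1 -> hasmean g (circle_integral g).
Proof.
move=> c p; have [U d] := continuous_primitive c; exists U => // x.
have d0 : drv (fun x => U (x + 1) - U x) (fun _ => 0).
  by apply: eq_drv (drvB (drv_shift 1 d) d) _ => y; rewrite p subrr.
have := drv_cst0 d0 x 0; rewrite add0r -(drv_integral d c) => <-; ring.
Qed.

Lemma hasmeanD g1 g2 m1 m2 : hasmean g1 m1 -> hasmean g2 m2 ->
  hasmean (fun x => g1 x + g2 x) (m1 + m2).
Proof.
move=> [U1 d1 p1] [U2 d2 p2]; exists (fun x => U1 x + U2 x); first exact: drvD.
by move=> x; rewrite p1 p2; ring.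
Qed.

Lemma hasmeanZ a g m : hasmean g m -> hasmean (fun x => a * g x) (a * m).
Proof.
move=> [U d p]; exists (fun x => a * U x); first exact: drvZ.
by move=> x; rewrite p; ring.
Qed.

Lemma hasmeanB g1 g2 m1 m2 : hasmean g1 m1 -> hasmean g2 m2 ->
  hasmean (fun x => g1 x - g2 x) (m1 - m2).
Proof.
move=> H1 /(hasmeanZ (-1)) /(hasmeanD H1).
by rewrite mulN1r; under [X in hasmean X _]eq_fun do rewrite mulN1r.
Qed.

Lemma hasmean_cst a : hasmean (fun _ => a) a.
Proof.
exists (fun x => a * x) => [|x]; last by ring.
by apply: eq_drv (drvZ a drv_id) _ => x; rewrite mulr1.
Qed.

Lemma hasmean_drv U g : drv U g -> periodic U 1 -> hasmean g 0.
Proof. by move=> d p; exists U => // x; rewrite addr0 p. Qed.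

(** A periodic primitive has a critical point between [0] and [1] by Rolle, and [g] vanishes there;
    modulo the period, every point is within distance [1] of it. *)
Lemma Lip_mean0 M g : 0 <= M -> periodic g 1 -> hasmean g 0 -> Lip M g ->
  forall x, `|g x| <= M.
Proof.
move=> M0 p [U d pU] L x.
have [//||||z] := @Rolle R U 0 1.
- by move=> y _; exact: (drv_derivable d).
- by apply: continuous_subspaceT; exact: drv_cont d.
- by rewrite -[1]add0r pU addr0.
rewrite in_itv /= => /andP[z0 z1] [_ dz].
have gz : g z = 0 by rewrite -dz -(@derive_val _ _ _ _ _ _ _ (d z)).
rewrite -(periodic_frac x p) -[X in `|X|]subr0 -gz.
apply: le_trans (L _ _) _; rewrite ler_piMr//.
have /andP[? ?] := frac_itv x; rewrite ler_norml; apply/andP; split; lra.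
Qed.

End circle.

(** * The averaging operator *)

Section torus.
Context {R : realType}.
Implicit Types (h : R * R -> R) (g : R -> R).

Definition dx h : R * R -> R := 'D_(1, 0) h.

Lemma dxP h y : (forall z, differentiable h z) ->
  drv (fun x => h (x, y)) (fun x => dx h (x, y)).
Proof.
move=> dh x.
have E : (fun s : R => s^-1 *: (h (s *: 1 + x, y) - h (x, y))) =
         (fun s : R => s^-1 *: ((h \o shift (x, y)) (s *: (1, 0)) - h (x, y))).
  apply/funext => s /=; congr (_ *: (h _ - _)).
  by rewrite /= -[RHS]/((_, _)); congr (_, _); rewrite /= scaler0 add0r.
have dv : derivable h (x, y) (1, 0) by apply: diff_derivable; exact: dh.
apply: DeriveDef.
- by rewrite /derivable /= E; exact: dv.
- by rewrite /derive /= E.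
Qed.

Lemma torus_dx k h : torus_Ck k.+1 h -> torus_Ck k (dx h).
Proof.
move=> [p1 p2 [dh Ch]]; split=> [y x|x y|]; last exact: Ch.
- have := periodic_derive1 (dxP y dh) (p1 y); exact.
- have d := dxP y dh; have d1 := dxP (y + 1) dh.
  have E : (fun x => h (x, y + 1)) = (fun x => h (x, y)).
    by apply/funext => z; exact: p2.
  rewrite E in d1.
  by have := drv_E d1; rewrite (drv_E d) => /(congr1 (fun F => F x)).
Qed.

Lemma torus_continuous k h : torus_Ck k h -> continuous h.
Proof.
case: k => [|k] [_ _]; first by [].
by move=> [dh _] z; exact: differentiable_continuous.
Qed.

Lemma torus_bounded k h : torus_Ck k h -> exists2 M : R, 0 <= M & forall z, `|h z| <= M.
Proof.
move=> Th; have ch := torus_continuous Th; have [p1 p2 _] := Th.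
have /compact_bounded : compact (h @` (`[0, 1] `*` `[0, 1])).
  apply: continuous_compact; first exact: continuous_subspaceT.
  by apply: compact_setX; exact: segment_compact.
move=> [M [_ /(_ (M + 1))]]; rewrite ltrDl ltr01 => /(_ isT) H.
have bd z : `|h z| <= M + 1.
  case: z => x y; rewrite -(periodic_frac x (p1 y)) -(periodic_frac y (p2 _)).
  apply: H; exists (x - (Num.floor x)%:~R, y - (Num.floor y)%:~R) => //.
  have /andP[? /ltW ?] := frac_itv x; have /andP[? /ltW ?] := frac_itv y.
  by split; rewrite /= in_itv /=; apply/andP.
by exists (M + 1) => //; apply: le_trans (bd (0, 0)).
Qed.

Lemma continuous_slice1 h y : continuous h -> continuous (fun x => h (x, y)).
Proof.
move=> ch x; apply: (@continuous_comp _ _ _ (fun x => (x, y)) h x); last exact: ch.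
exact: (@cvg_pair _ _ _ (nbhs x) (nbhs x) (nbhs y) _ _ _ id (fun=> y) cvg_id (cvg_cst y)).
Qed.

Lemma continuous_slice2 h x : continuous h -> continuous (fun y => h (x, y)).
Proof.
move=> ch y; apply: (@continuous_comp _ _ _ (fun y => (x, y)) h y); last exact: ch.
exact: (@cvg_pair _ _ _ (nbhs y) (nbhs x) (nbhs y) _ _ _ (fun=> x) id (cvg_cst x) cvg_id).
Qed.

Let integrand_continuous h g x : continuous h -> continuous g ->
  continuous (fun y => h (x, y) * g y).
Proof. by move=> ch cg y; apply: cvgM; [exact: continuous_slice2 | exact: cg]. Qed.

Let norm_continuous g : continuous g -> continuous (fun y => `|g y|).
Proof. by move=> cg y; apply: cvg_norm; exact: cg. Qed.

Let cZ a g : continuous g -> continuous (fun y => a * g y).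
Proof. by move=> cg y; apply: cvgM; [exact: cvg_cst | exact: cg]. Qed.

(** [g] enters through its [L^1] norm, which is [1] for a density: this bounds the couplings of all
    the [rho t] at once. *)
Lemma meanA_bounded h g (M m : R) : continuous h -> continuous g ->
  (forall z, `|h z| <= M) -> circle_integral (fun y => `|g y|) <= m ->
  forall x, `|meanA h g x| <= M * m.
Proof.
move=> ch cg hM gm x.
have M0 : 0 <= M by exact: le_trans (hM (0, 0)).
apply: le_trans (le_normr_Rintegral _ _) _ => //.
  by apply: continuous_integrable; exact: integrand_continuous.
apply: (@le_trans _ _ (circle_integral (fun y => M * `|g y|))).
  apply: le_Rintegral => //.
  - apply: continuous_integrable; apply: norm_continuous.
    exact: integrand_continuous.
  - by apply: continuous_integrable; apply: cZ; exact: norm_continuous.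
  - by move=> y _; rewrite normrM ler_wpM2r.
rewrite /circle_integral RintegralZl //; first by rewrite ler_wpM2l.
by apply: continuous_integrable; exact: norm_continuous.
Qed.

Lemma meanA_continuous h g M : continuous h -> continuous g ->
  (forall z, `|h z| <= M) -> continuous (meanA h g).
Proof.
move=> ch cg hM x.
apply: (@continuity_under_integral R _ _ (@lebesgue_measure R)
  (fun x y => h (x, y) * g y) `[0, 1] _ (x - 1) (x + 1) _ _ (fun y => M * `|g y|)).
- exact: measurable_itv.
- by move=> z _; apply: continuous_integrable; exact: integrand_continuous.
- apply: aeW => y _ z _; apply: cvgM; last exact: cvg_cst.
  exact: continuous_slice1.
- by apply: continuous_integrable; apply: cZ; exact: norm_continuous.
- by move=> z _; apply: aeW => y _; rewrite normrM ler_wpM2r.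
- by rewrite inE /= in_itv /=; apply/andP; split; lra.
Qed.

Lemma meanA_drv h g M : (forall z, differentiable h z) -> continuous (dx h) ->
  (forall z, `|dx h z| <= M) -> continuous g ->
  drv (meanA h g) (meanA (dx h) g).
Proof.
move=> dh cdh hM cg x.
have ch : continuous h by move=> z; exact: differentiable_continuous.
have M0 : 0 <= M by exact: le_trans (hM (0, 0)).
have d y : drv (fun x => h (x, y) * g y) (fun x => dx h (x, y) * g y).
  apply: eq_drv (drvM (dxP y dh) (drv_cst (g y))) _ => z.
  by rewrite mulr0 addr0.
have dp z y : partial1of2 (fun x y => h (x, y) * g y) z y = dx h (z, y) * g y.
  by rewrite /partial1of2; rewrite (drv_E (d y)).
have C : (fun s : R => s^-1 *: (meanA h g (s + x) - meanA h g x)) @ 0^' -->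
    meanA (dx h) g x.
  have -> : meanA (dx h) g x = \int[@lebesgue_measure R]_(y in `[0, 1])
      partial1of2 (fun x y => h (x, y) * g y) x y.
    by apply: eq_Rintegral => y _; rewrite dp.
  apply: (@cvg_differentiation_under_integral R _ _ (@lebesgue_measure R)
    (fun x y => h (x, y) * g y) `[0, 1] _ x (x - 1) (x + 1) _ _ _ (fun y => M * `|g y|)).
  - exact: measurable_itv.
  - by rewrite /= in_itv /=; apply/andP; split; lra.
  - by move=> z _; apply: continuous_integrable; exact: integrand_continuous.
  - by move=> z y _ _; exact: (drv_derivable (d y)).
  - by move=> y; rewrite mulr_ge0.
  - by apply: continuous_integrable; apply: cZ; exact: norm_continuous.
  - by move=> z y _ _; rewrite dp normrM ler_wpM2r.
have E : (fun s : R => s^-1 *: (meanA h g (s + x) - meanA h g x)) =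
         (fun s : R => s^-1 *: ((meanA h g \o shift x) (s *: 1) - meanA h g x)).
  by apply/funext => s /=; rewrite /GRing.scale /= mulr1.
rewrite E in C.
apply: DeriveDef; first by apply/cvg_ex; eexists; exact: C.
by apply/cvg_lim; [exact: Rhausdorff | exact: C].
Qed.

(** All derivatives fall on [h], so continuity of [g] is enough for a [C^k] image. *)
Lemma meanA_CkB k h : torus_Ck k h -> exists2 M : R, 0 <= M & forall g (m : R),
  continuous g -> circle_integral (fun y => `|g y|) <= m -> CkB k (M * m) (meanA h g).
Proof.
elim: k h => [|k IH] h Th.
  have [M M0 hM] := torus_bounded Th; exists M => // g m cg gm; apply: CkB_0.
    by apply: meanA_bounded => //; exact: torus_continuous Th.
  by apply: meanA_continuous hM => //; exact: torus_continuous Th.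
have [M M0 hM] := torus_bounded Th; have Tdx := torus_dx Th.
have [M1 M10 hM1] := torus_bounded Tdx; have [M2 M20 H] := IH _ Tdx.
have ch := torus_continuous Th; have cdh := torus_continuous Tdx.
exists (M + M2) => [|g m cg gm]; first exact: addr_ge0.
have m0 : 0 <= m.
  by apply: le_trans gm; apply: Rintegral_ge0 => x _.
have dh : forall z, differentiable h z by case: Th => _ _ [].
apply: (CkB_S (meanA_drv dh cdh hM1 cg)).
  move=> x; apply: le_trans (meanA_bounded ch cg hM gm x) _.
  by rewrite ler_wpM2r// lerDl.
by apply: CkB_le (H g m cg gm); rewrite ler_wpM2r// lerDr.
Qed.

Lemma meanA_periodic h g : (forall y, periodic (fun x => h (x, y)) 1) -> periodic (meanA h g) 1.
Proof. by move=> p x; apply: eq_Rintegral => y _; rewrite (p y). Qed.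

Lemma meanAD h g1 g2 x : continuous h -> continuous g1 -> continuous g2 ->
  meanA h (fun y => g1 y + g2 y) x = meanA h g1 x + meanA h g2 x.
Proof.
move=> ch c1 c2; rewrite /meanA /circle_integral -RintegralD //.
- by apply: eq_Rintegral => y _; rewrite mulrDr.
- by apply: continuous_integrable; exact: integrand_continuous.
- by apply: continuous_integrable; exact: integrand_continuous.
Qed.

Lemma meanAZ h g a x : continuous h -> continuous g ->
  meanA h (fun y => a * g y) x = a * meanA h g x.
Proof.
move=> ch cg; rewrite /meanA /circle_integral -RintegralZl //.
- by apply: eq_Rintegral => y _; rewrite mulrCA.
- by apply: continuous_integrable; exact: integrand_continuous.
Qed.

Lemma circle_integral_le g (m : R) : continuous g -> (forall x, `|g x| <= m) ->
  circle_integral (fun y => `|g y|) <= m.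
Proof.
move=> cg gm; rewrite -[leRHS](hasmean_integral (fun x => @cvg_cst _ _ _ _ _) (hasmean_cst m)).
apply: le_Rintegral => //.
- by apply: continuous_integrable; exact: norm_continuous.
- by apply: continuous_integrable => x; exact: cvg_cst.
Qed.

End torus.

(** * Affine fixed points *)

Section banach.
Context {R : realType}.
Implicit Types u v g : R -> R.

Lemma geometric_small (th M e : R) : 0 <= th -> th < 1 -> 0 < e ->
  exists n, th ^+ n * M <= e.
Proof.
move=> th0 th1 e0; have [M0|M0] := leP M 0.
  by exists 0%N; rewrite expr0 mul1r (le_trans M0)// ltW.
have /cvgrPdist_lt /(_ (e / M)) : (th ^+ n @[n --> \oo] --> (0 : R)).
  by apply: cvg_expr; rewrite ger0_norm.
rewrite divr_gt0// => /(_ isT) [n _ /(_ n (leqnn n))].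
rewrite /= sub0r normrN ger0_norm ?exprn_ge0// ltr_pdivlMr// => /ltW ?.
by exists n.
Qed.

(** A bound that improves from [m] to [th * m + b] can be iterated towards the fixed point
    [b / (1 - th)] of this map. The starting bound [M] leaves no trace in the result, which is how a
    priori bounds become uniform. [Q] will be a sup, Lipschitz or gauge bound. *)
Lemma absorb (Q : R -> Prop) (th b M : R) : 0 <= th -> th < 1 -> 0 <= b -> 0 <= M ->
  (forall m m', m <= m' -> Q m -> Q m') ->
  (forall m, (forall e, 0 < e -> Q (m + e)) -> Q m) ->
  (forall m, 0 <= m -> Q m -> Q (th * m + b)) -> Q M -> Q (b / (1 - th)).
Proof.
move=> th0 th1 b0 M0 mono lim step QM; apply: lim => e e0.
have d0 : 0 < 1 - th by rewrite subr_gt0.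
have [n ne] := geometric_small M th0 th1 e0.
apply: (mono (th ^+ n * M + b / (1 - th))); first by rewrite addrC lerD2l.
have b1 : 0 <= b / (1 - th) by rewrite divr_ge0// ltW.
elim: n {ne} => [|n IH].
  by apply: mono QM; rewrite expr0 mul1r lerDl.
apply: mono (step _ _ IH); last by rewrite addr_ge0// mulr_ge0// exprn_ge0.
rewrite exprS mulrDr mulrA -addrA lerD2l le_eqVlt; apply/orP; left; apply/eqP.
by field; rewrite gt_eqF.
Qed.

Lemma Lip_le (M M' : R) g : M <= M' -> Lip M g -> Lip M' g.
Proof. by move=> MM L x y; apply: le_trans (L x y) _; rewrite ler_wpM2r. Qed.

Lemma Lip_lim (m : R) g : (forall e, 0 < e -> Lip (m + e) g) -> Lip m g.
Proof.
move=> H x y; have [->|xy] := eqVneq x y; first by rewrite !subrr !normr0 mulr0.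
have xy0 : 0 < `|x - y| by rewrite normr_gt0 subr_eq0.
apply/ler_addgt0Pl => e e0; have := H (e / `|x - y|) (divr_gt0 e0 xy0) x y.
by rewrite mulrDl divfK ?gt_eqF// [e + _]addrC.
Qed.

(** The difference quotients of [u] and [v] are within [e] of each other at every scale, so those of
    [u] are Cauchy. By [Lip_drv] the derivatives are then uniformly close, and [u'] inherits
    continuity. *)
Lemma C1_closed u : (forall e : R, 0 < e -> exists v v',
    [/\ drv v v', continuous v' & Lip e (fun x => v x - u x)]) ->
  exists2 u', drv u u' & continuous u'.
Proof.
move=> H; have du : forall x : R, derivable u x (1 : R).
  move=> x; apply: cauchy_cvg; apply: cauchy_exP => e e0.
  have e4 : 0 < e / 4 by lra.
  have [v [v' [dv _ L]]] := H _ e4; exists (v' x).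
  have [r r0 Hr] := drv_limit x dv e4.
  apply/nbhs_ballP; exists r => //= s; rewrite /ball /= sub0r normrN => sr s0.
  have {}Hr := Hr s s0 sr; rewrite /= /GRing.scale /= mulr1 [s + x]addrC [s^-1 * _]mulrC.
  set q := _ / s in Hr; set p := _ / s.
  have qp : `|q - p| <= e / 4.
    have -> : q - p = ((v (x + s) - u (x + s)) - (v x - u x)) / s by rewrite /q /p; ring.
    rewrite normrM normfV ler_pdivrMr ?normr_gt0//.
    by apply: le_trans (L _ _) _; rewrite [x + s]addrC addrK.
  have -> : v' x - p = (q - p) - (q - v' x) by ring.
  by apply: le_lt_trans (ler_normB _ _) _; lra.
exists (derive1 u); first exact: drv_derive1.
move=> x; apply/cvgrPdist_le => e e0; have e3 : 0 < e / 3 by lra.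
have [v [v' [dv cv L]]] := H _ e3.
have B := Lip_drv (drvB dv (drv_derive1 du)) L.
have /cvgrPdist_le /(_ _ e3) := cv x; apply: filterS => y vy.
have -> : derive1 u x - derive1 u y =
  (v' x - v' y) - (v' x - derive1 u x) + (v' y - derive1 u y) by ring.
apply: le_trans (ler_normD _ _) _.
have := ler_normB (v' x - v' y) (v' x - derive1 u x).
by have := B x; have := B y; move: vy; lra.
Qed.

Lemma geometric_limit (a : nat -> R) (K th : R) : 0 <= th -> th < 1 -> 
  (forall n, `|a n.+1 - a n| <= K * th ^+ n) ->
  exists2 l, a n @[n --> \oo] --> l & forall n, `|a n - l| <= K / (1 - th) * th ^+ n.
Proof.
move=> th0 th1 H; have d0 : 0 < 1 - th by rewrite subr_gt0.
have K0 : 0 <= K by have := le_trans (normr_ge0 _) (H 0%N); rewrite expr0 mulr1.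
have B n k : `|a (n + k)%N - a n| <= K / (1 - th) * th ^+ n.
  have -> : K / (1 - th) * th ^+ n = K * th ^+ n / (1 - th) by ring.
  rewrite ler_pdivlMr//; suff : `|a (n + k)%N - a n| * (1 - th) <= K * th ^+ n * (1 - th ^+ k).
    move/le_trans; apply; rewrite ler_piMr// ?mulr_ge0 ?exprn_ge0//.
    by rewrite lerBlDr lerDl exprn_ge0.
  elim: k => [|k IH]; first by rewrite addn0 expr0 !subrr normr0 mul0r mulr0.
  have -> : a (n + k.+1)%N - a n = (a (n + k).+1 - a (n + k)%N) + (a (n + k)%N - a n).
    by rewrite addnS; ring.
  apply: (@le_trans _ _ ((K * th ^+ (n + k) + `|a (n + k)%N - a n|) * (1 - th))).
    rewrite ler_wpM2r ?(ltW d0)//; apply: (le_trans (ler_normD _ _)).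
    by rewrite lerD2r.
  rewrite mulrDl; apply: (le_trans (lerD (lexx _) IH)).
  rewrite exprD exprS le_eqVlt; apply/orP; left; apply/eqP; ring.
have ca : cvgn a.
  apply: cauchy_cvg; apply: cauchy_exP => e e0; have e2 : 0 < e / 2 by lra.
  have [n ne] := geometric_small (K / (1 - th)) th0 th1 e2.
  exists (a n); exists n => // m /= nm; rewrite /ball /= distrC -(subnKC nm).
  by apply: le_lt_trans (B _ _) _; rewrite mulrC; lra.
exists (limn a); first exact: ca.
move=> n; rewrite distrC; apply/ler_addgt0Pl => e e0.
have /cvgrPdist_le /(_ e e0) [k _ /(_ (n + k)%N (leq_addl _ _))] : a n @[n --> \oo] --> limn a by exact: ca.
move=> lk; have -> : limn a - a n = (limn a - a (n + k)%N) + (a (n + k)%N - a n) by ring.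
by apply: le_trans (ler_normD _ _) _; rewrite lerD.
Qed.

(** The ball of radius [M] for the larger of the sup norm and the Lipschitz constant divided by
    [kap]. A large [kap] lets an operator contract although the sup norm of [u] feeds into the
    Lipschitz constant of its image. *)
Definition gauge (kap M : R) u := (forall x, `|u x| <= M) /\ Lip (kap * M) u.

Lemma gauge_le kap (M M' : R) u : 0 <= kap -> M <= M' -> gauge kap M u -> gauge kap M' u.
Proof.
move=> k0 MM [b L]; split=> [x|]; first exact: le_trans (b x) MM.
by apply: Lip_le L; rewrite ler_wpM2l.
Qed.

Lemma gauge_lim kap (m : R) u : 0 < kap -> (forall e, 0 < e -> gauge kap (m + e) u) ->
  gauge kap m u.
Proof.
move=> k0 H; split.
  by move=> x; apply/ler_addgt0Pl => e /H [/(_ x) + _]; rewrite addrC.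
apply: Lip_lim => e e0; have [_ L] := H (e / kap) (divr_gt0 e0 k0).
by rewrite mulrDr mulrCA divff ?gt_eqF// mulr1 in L.
Qed.

Lemma CkB1_gauge kap M u : 1 <= kap -> CkB 1 M u -> gauge kap M u.
Proof.
move=> k1 Cu; split; first exact: CkB_bnd Cu.
apply: Lip_le (drv_Lip (CkB_drv Cu) (CkB_bnd (CkB_derive1 Cu))).
by rewrite ler_peMl// (CkB_ge0 Cu).
Qed.

Lemma gauge_CkB1 kap M u u' : 1 <= kap -> gauge kap M u -> drv u u' -> continuous u' ->
  CkB 1 (kap * M) u.
Proof.
move=> k1 [b L] d c; apply: (CkB_S d) => [x|].
  apply: le_trans (b x) _; rewrite ler_peMl//; exact: le_trans (b x).
by apply: CkB_0 => //; exact: Lip_drv d L.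
Qed.

(** Picard iteration from [g], with a class [D] closed under gauge limits in place of a complete
    space. *)
Lemma affine_fixpoint (kap th : R) (D : (R -> R) -> Prop) (T : (R -> R) -> R -> R) g :
  1 <= kap -> 0 <= th -> th < 1 ->
  (forall u, D u -> exists M, CkB 1 M u) ->
  (forall u, (forall e, 0 < e -> exists2 v, D v & gauge kap e (fun x => v x - u x)) -> D u) ->
  (forall u v, D u -> D v -> D (fun x => u x + v x)) ->
  (forall u v, D u -> D v -> D (fun x => u x - v x)) ->
  (forall u, D u -> D (T u)) ->
  (forall u v x, D u -> D v -> T (fun x => u x - v x) x = T u x - T v x) ->
  (forall u M, D u -> 0 <= M -> gauge kap M u -> gauge kap (th * M) (T u)) ->
  D g -> exists2 u, D u & forall x, u x = T u x + g x.
Proof.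
move=> k1 th0 th1 Dsub Dcl DD DB DT TB Tg Dg.
have k0 : 0 < kap by exact: lt_le_trans k1.
have d0 : 0 < 1 - th by rewrite subr_gt0.
pose U := fix U (n : nat) := if n is n'.+1 then fun x => T (U n') x + g x else g.
have DU n : D (U n) by elim: n => [|n IH] //=; apply: DD => //; exact: DT.
have [M CM] := Dsub _ Dg; have M0 := CkB_ge0 CM.
have gU n : gauge kap (th * M * th ^+ n) (fun x => U n.+1 x - U n x).
  elim: n => [|n IH].
    rewrite expr0 mulr1 /=; have := Tg _ _ Dg M0 (CkB1_gauge k1 CM).
    by congr gauge; apply/funext => x; ring.
  have -> : th * M * th ^+ n.+1 = th * (th * M * th ^+ n) by rewrite exprS; ring.
  have := Tg _ _ (DB _ _ (DU n.+1) (DU n)) _ IH.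
  have -> : T (fun x => U n.+1 x - U n x) = fun x => U n.+2 x - U n.+1 x.
    apply/funext => x; rewrite (TB _ _ _ (DU n.+1) (DU n)) /=; ring.
  by apply; rewrite !mulr_ge0// exprn_ge0.
have lx x : {l | U n x @[n --> \oo] --> l &
    forall n, `|U n x - l| <= th * M / (1 - th) * th ^+ n}.
  by apply: cid2; apply: geometric_limit => // n; exact: (gU n).1.
pose u x := s2val (lx x).
have gu n : gauge kap (th * M / (1 - th) * th ^+ n) (fun x => U n x - u x).
  split=> [x|x y]; first exact: (s2valP' (lx x)).
  (* The scalar limit is applied to [U m x - U m y], with a rate proportional to [|x - y|]; this
     carries the Lipschitz bound over to [U n - u]. *)
  have HL m : `|(U m.+1 x - U m.+1 y) - (U m x - U m y)| <=
      kap * (th * M) * `|x - y| * th ^+ m.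
    have -> : U m.+1 x - U m.+1 y - (U m x - U m y) = U m.+1 x - U m x - (U m.+1 y - U m y) by ring.
    apply: le_trans ((gU m).2 x y) _; rewrite le_eqVlt; apply/orP; left; apply/eqP.
    by ring.
  have [l cl bl] := geometric_limit th0 th1 HL.
  have E : l = u x - u y.
    have cu : (fun n => U n x - U n y) @ \oo --> u x - u y.
      by apply: cvgB; exact: (s2valP (lx _)).
    by rewrite -(cvg_lim (@Rhausdorff R) cl) (cvg_lim (@Rhausdorff R) cu).
  have := bl n; rewrite E.
  have -> : U n x - U n y - (u x - u y) = U n x - u x - (U n y - u y) by ring.
  by move/le_trans; apply; rewrite le_eqVlt; apply/orP; left; apply/eqP; ring.
have Du : D u.
  apply: Dcl => e e0; have [n ne] := geometric_small (th * M / (1 - th)) th0 th1 e0.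
  exists (U n) => //; apply: gauge_le (gu n); first exact: ltW.
  by rewrite mulrC.
exists u => // x; have [l _ _] := lx x.
have Tu n : `|T (U n) x - T u x| <= th * M / (1 - th) * th ^+ n.
  have P : 0 <= th * M / (1 - th) * th ^+ n.
    by rewrite !mulr_ge0 ?exprn_ge0// invr_ge0 ltW.
  have [H _] := Tg _ _ (DB _ _ (DU n) Du) P (gu n).
  rewrite -(TB _ _ _ (DU n) Du); apply: le_trans (H x) _.
  by rewrite ler_piMl// ltW.
apply/eqP; rewrite -subr_eq0 -normr_le0; apply/ler_addgt0Pl => e e0; rewrite addr0.
have e2 : 0 < e / 2 by lra.
have [n ne] := geometric_small (th * M / (1 - th)) th0 th1 e2.
have H1 := Tu n; have H2 := (gu n.+1).1 x; rewrite /= in H2.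
have H3 : th * M / (1 - th) * th ^+ n.+1 <= th * M / (1 - th) * th ^+ n.
  apply: ler_wpM2l; first by rewrite !mulr_ge0// invr_ge0 ltW.
  by rewrite exprS ler_piMl ?exprn_ge0// ltW.
have -> : u x - (T u x + g x) = (T (U n) x - T u x) - (T (U n) x + g x - u x) by ring.
by apply: le_trans (ler_normB _ _) _; rewrite mulrC in ne; lra.
Qed.

End banach.

(** * Transfer operators of inverse branches *)

Section transfer.
Context {R : realType}.
Implicit Types (phi psi w H dH : R -> R).

(** The weight is left free because differentiating a transfer equation multiplies it by [dH]: the
    equations of [rho], [rho'] and [rho''] all have this form. *)
Definition wtransfer (N : nat) H w phi : R -> R :=
  fun x => \sum_(j < N) w (x + j%:R) * phi (H (x + j%:R)).

Lemma wtransferD N H w phi psi x : wtransfer N H w (fun y => phi y + psi y) x = wtransfer N H w phi x + wtransfer N H w psi x.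
Proof. by rewrite /wtransfer -big_split; apply: eq_bigr => j _; rewrite mulrDr. Qed.

Lemma wtransferZ N H w a phi x : wtransfer N H w (fun y => a * phi y) x = a * wtransfer N H w phi x.
Proof. by rewrite /wtransfer mulr_sumr; apply: eq_bigr => j _; rewrite mulrCA. Qed.

Lemma wtransferB N H w phi psi x : wtransfer N H w (fun y => phi y - psi y) x = wtransfer N H w phi x - wtransfer N H w psi x.
Proof. by rewrite /wtransfer -sumrB; apply: eq_bigr => j _; rewrite mulrBr. Qed.

Lemma sum_le_const N (F : 'I_N -> R) m : (forall j, F j <= m) -> \sum_(j < N) F j <= N%:R * m.
Proof.
move=> H; apply: le_trans (ler_sum _ (fun j _ => H j)) _.
by rewrite sumr_const card_ord mulr_natl.
Qed.

Lemma wtransfer_bnd N H w phi (A m : R) : (forall x, `|w x| <= A) -> (forall x, `|phi x| <= m) ->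
  forall x, `|wtransfer N H w phi x| <= N%:R * (A * m).
Proof.
move=> wA pm x; apply: le_trans (ler_norm_sum _ _ _) _; apply: sum_le_const => j.
by rewrite normrM ler_pM.
Qed.

Lemma wtransfer_drv N H dH w w' phi phi' : drv H dH -> drv w w' -> drv phi phi' ->
  drv (wtransfer N H w phi) (fun x => wtransfer N H w' phi x + wtransfer N H (fun y => w y * dH y) phi' x).
Proof.
move=> dH_ dw dp.
have d (j : 'I_N) := drv_shift j%:R (drvM dw (drv_comp dp dH_)).
apply: eq_drv (drv_sum d) _ => x.
rewrite /wtransfer -big_split; apply: eq_bigr => j _ /=; ring.
Qed.

Lemma CkB_shift k M c phi : CkB k M phi -> CkB k M (fun x => phi (x + c)).
Proof.
elim: k phi => [|k IH] phi Cp.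
  by apply: CkB_comp0 Cp; exact: drv_cont (drvD drv_id (drv_cst c)).
apply: (CkB_S (drv_shift c (CkB_drv Cp))) => [x|]; first exact: CkB_bnd Cp _.
exact: IH (CkB_derive1 Cp).
Qed.

Lemma wtransfer_CkB k N (Mw MH : R) : exists2 C : R, 0 <= C & forall H dH w phi m,
  drv H dH -> CkB k.-1 MH dH -> CkB k Mw w -> CkB k m phi -> CkB k (C * m) (wtransfer N H w phi).
Proof.
have [C C1 HC] := CkB_comp k MH; have [Mw0|Mw0] := leP 0 Mw; last first.
  by exists 0 => // H dH w phi m _ _ /CkB_ge0; rewrite leNgt Mw0.
exists (N%:R * (2 ^+ k * (Mw * C))) => [|H dH w phi m d CH Cw Cp].
  by rewrite !mulr_ge0// ?exprn_ge0//; exact: le_trans C1.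
have X := CkBM Cw (HC _ _ _ _ d CH Cp).
have -> : N%:R * (2 ^+ k * (Mw * C)) * m = N%:R * (2 ^+ k * (Mw * (C * m))) by ring.
by apply: CkB_sum => j; exact: CkB_shift X.
Qed.

Lemma wtransfer_Lip N H w phi (al A B m m0 : R) : 0 <= A -> 0 <= m -> Lip al H ->
  (forall x, `|w x| <= A) -> Lip B w -> Lip m phi -> (forall x, `|phi x| <= m0) ->
  Lip (N%:R * (A * al * m + B * m0)) (wtransfer N H w phi).
Proof.
move=> A0 m0' LH wA Lw Lp p0 x y; rewrite /wtransfer -sumrB.
apply: le_trans (ler_norm_sum _ _ _) _; rewrite -mulrA; apply: sum_le_const => j.
set u := x + _; set v := y + _.
have uv : u - v = x - y by rewrite /u /v; ring.
have -> : w u * phi (H u) - w v * phi (H v) =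
  w u * (phi (H u) - phi (H v)) + (w u - w v) * phi (H v) by ring.
apply: le_trans (ler_normD _ _) _; rewrite !normrM mulrDl.
apply: lerD.
  rewrite -mulrA -mulrA; apply: ler_pM => //; apply: le_trans (Lp _ _) _.
  by rewrite mulrCA; apply: ler_wpM2l => //; rewrite -uv; exact: LH.
by rewrite mulrAC -uv; apply: ler_pM.
Qed.

(* The inverse branches of a degree [+- N] lift F are the [H (x + j)] with H the
   inverse of F and j < N; [sg] is the sign of the degree. *)
Definition branch (N : nat) (sg : R) H dH :=
  [/\ sg = 1 \/ sg = -1, drv H dH & forall x, H (x + N%:R) = H x + sg].

Definition btransfer N sg H dH phi : R -> R := wtransfer N H (fun x => sg * dH x) phi.

(** Translation by [1] sends branch [j] to branch [j + 1], so only the two ends of the sum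
    differ. *)
Lemma sum_shift N (a : R -> R) x :
  \sum_(j < N) a (x + 1 + j%:R) = \sum_(j < N) a (x + j%:R) + (a (x + N%:R) - a x).
Proof.
elim: N => [|N IH]; first by rewrite !big_ord0 addr0 subrr addr0.
rewrite !big_ord_recr /= IH -[N.+1%:R]natr1.
have -> : x + 1 + N%:R = x + (N%:R + 1) by ring.
by ring.
Qed.

Lemma branch_dH N sg H dH : branch N sg H dH -> forall x, dH (x + N%:R) = dH x.
Proof.
move=> [_ d s] x; have d1 := drv_shift N%:R d.
have d2 := drvD d (drv_cst sg).
have E : (fun x => H (x + N%:R)) = (fun x => H x + sg) by apply/funext => y; exact: s.
have := congr1 (fun F => F x) (drv_E d1).
by rewrite E (drv_E d2) addr0 => <-.
Qed.

Lemma periodic_sg sg phi : sg = 1 \/ sg = -1 -> periodic phi 1 ->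
  forall x, phi (x + sg) = phi x.
Proof.
move=> [->|->] p x; first exact: p.
by have := @periodic_int R phi (-1) x p; rewrite rmorphN.
Qed.

Lemma btransfer_periodic N sg H dH phi : branch N sg H dH -> periodic phi 1 ->
  periodic (btransfer N sg H dH phi) 1.
Proof.
move=> br p x; have [s d Hs] := br.
rewrite /btransfer /wtransfer (sum_shift N (fun y => sg * dH y * phi (H y))) /=.
by rewrite (branch_dH br) Hs (periodic_sg s p) subrr addr0.
Qed.

(** A primitive of the transfer is [sg] times the sum of [U] over the branches. By [sum_shift] its
    increment is [sg * (U (H x + sg) - U (H x))], which is [m] for either sign. *)
Lemma btransfer_mean N sg H dH phi m : branch N sg H dH -> hasmean phi m ->
  hasmean (btransfer N sg H dH phi) m.
Proof.
move=> [s d Hs] [U dU pU]; exists (fun x => sg * \sum_(j < N) U (H (x + j%:R))).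
  have dj (j : 'I_N) := drv_shift j%:R (drv_comp dU d).
  apply: eq_drv (drvZ sg (drv_sum dj)) _ => x.
  by rewrite /btransfer /wtransfer mulr_sumr; apply: eq_bigr => j _; ring.
move=> x; rewrite (sum_shift N (fun y => U (H y))) /= Hs.
case: s => ->; first by rewrite pU; ring.
by have := pU (H x - 1); rewrite subrK => ->; ring.
Qed.

(** The origin of the hypothesis on [N]: on each branch, [al ^+ 2] bounds the weight times the slope
    of [H], while [be], the slope of the weight, multiplies the sup norm of [phi], at most [m] by
    [Lip_mean0]. *)
Lemma btransfer_contract N sg H dH d2H phi (al be m : R) : branch N sg H dH -> drv dH d2H ->
  (forall x, `|dH x| <= al) -> (forall x, `|d2H x| <= be) ->
  0 <= m -> periodic phi 1 -> hasmean phi 0 -> Lip m phi ->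
  Lip (N%:R * (al ^+ 2 + be) * m) (btransfer N sg H dH phi).
Proof.
move=> [s d Hs] d2 dHal d2Hbe m0 p me L.
have al0 : 0 <= al by exact: le_trans (dHal 0).
have sg1 : `|sg| = 1 by case: s => ->; rewrite ?normrN normr1.
have -> : N%:R * (al ^+ 2 + be) * m = N%:R * (al * al * m + be * m) by ring.
apply: wtransfer_Lip => //.
- exact: drv_Lip d dHal.
- by move=> x; rewrite normrM sg1 mul1r.
- by apply: (drv_Lip (drvZ sg d2)) => x; rewrite normrM sg1 mul1r.
- exact: Lip_mean0.
Qed.

(** [v] is only known to be bounded. Iteration produces a [C^1] solution [u] of the same equation,
    and [v = u] because the transfer contracts the sup norm of the difference by [N * A <= th]. *)
Lemma wtransfer_core N (th A Mw : R) : 0 <= A -> 0 <= Mw -> N%:R * A <= th -> th < 1 ->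
  exists2 C : R, 0 <= C & forall H dH w v b m, drv H dH -> continuous dH ->
  (forall x, `|dH x| <= 1) -> (forall x, `|w x| <= A) -> CkB 1 Mw w ->
  (forall x, `|v x| <= m) -> CkB 1 m b -> (forall x, v x = wtransfer N H w v x + b x) ->
  CkB 1 (C * m) v.
Proof.
move=> A0 Mw0 NA th1; have N0 : 0 <= N%:R :> R by exact: ler0n.
have th0 : 0 <= th by apply: le_trans NA; rewrite mulr_ge0.
have d0 : 0 < 1 - th by rewrite subr_gt0.
(* Chosen so that [N * Mw], the contribution of the slope of the weight, is at most
   [(th' - th) * kap], the room made by passing from [th] to the midpoint [th']. *)
pose kap := 1 + 2 * N%:R * Mw / (1 - th).
have k1 : 1 <= kap by rewrite lerDl divr_ge0 ?mulr_ge0// ltW.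
have k0 : 0 < kap by exact: lt_le_trans k1.
have kE : N%:R * Mw = (kap - 1) * (1 - th) / 2 by rewrite /kap; field; rewrite gt_eqF.
pose th' := (1 + th) / 2.
have th'1 : th' < 1 by rewrite /th'; lra.
have th'0 : 0 <= th' by rewrite /th'; lra.
have thth : th <= th' by rewrite /th'; lra.
exists (kap / (1 - th')) => [|H dH w v b m d cd dH1 wA Cw vm Cb vE].
  by apply: divr_ge0; [exact: ltW | rewrite subr_ge0 ltW].
have m0 : 0 <= m by exact: le_trans (vm 0).
have step u M : 0 <= M -> gauge kap M u -> gauge kap (th' * M) (wtransfer N H w u).
  move=> M0 [ub uL]; split=> [x|].
    apply: le_trans (wtransfer_bnd N H wA ub x) _.
    by rewrite mulrA; apply: ler_wpM2r => //; exact: le_trans thth.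
  have Lw := drv_Lip (CkB_drv Cw) (CkB_bnd (CkB_derive1 Cw)).
  have kM0 : 0 <= kap * M by rewrite mulr_ge0// ltW.
  apply: Lip_le (wtransfer_Lip N A0 kM0 (drv_Lip d dH1) wA Lw uL ub).
  have -> : N%:R * (A * 1 * (kap * M) + Mw * M) = (N%:R * A * kap + N%:R * Mw) * M by ring.
  rewrite mulrA; apply: ler_wpM2r => //; rewrite kE.
  have : N%:R * A * kap <= th * kap by rewrite ler_wpM2r// ltW.
  by rewrite /th'; nra.
have [C1 _ HC1] := wtransfer_CkB 1 N Mw 1.
have CH : CkB 0 1 dH by exact: CkB_0.
have [u [Mu Cu] uE] : exists2 u, (exists M, CkB 1 M u) & forall x, u x = wtransfer N H w u x + b x.
  apply: (@affine_fixpoint R kap th' (fun u => exists M, CkB 1 M u)) => //.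
  - move=> u Hu; have [|u' du cu] := @C1_closed R u.
      move=> e e0; have [|v0 [M0 Cv] gv] := Hu (e / kap); first by rewrite divr_gt0.
      exists v0, (derive1 v0); split; first exact: CkB_drv Cv.
        exact: CkB_cont (CkB_derive1 Cv).
      by have := gv.2; rewrite mulrC divfK ?gt_eqF.
    have [v0 [M0 Cv] [gv gL]] := Hu 1 ltr01.
    have Lv := drv_Lip (CkB_drv Cv) (CkB_bnd (CkB_derive1 Cv)).
    have M00 := CkB_ge0 Cv.
    have ub x : `|u x| <= M0 + kap.
      have -> : u x = v0 x - (v0 x - u x) by ring.
      apply: le_trans (ler_normB _ _) _; apply: lerD; first exact: (CkB_bnd Cv).
      by apply: le_trans (gv x) _.
    have Lu : Lip (M0 + kap) u.
      move=> x y; have -> : u x - u y = (v0 x - v0 y) - ((v0 x - u x) - (v0 y - u y)) by ring.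
      apply: le_trans (ler_normB _ _) _; rewrite mulrDl; apply: lerD; first exact: Lv.
      by have := gL x y; rewrite mulr1.
    exists (M0 + kap); apply: (CkB_S du) => //.
    by apply: CkB_0 => //; exact: Lip_drv du Lu.
  - by move=> u1 u2 [M1 H1] [M2 H2]; exists (M1 + M2); exact: CkBD.
  - by move=> u1 u2 [M1 H1] [M2 H2]; exists (M1 + M2); exact: CkBB.
  - by move=> u1 [M1 H1]; exists (C1 * M1); exact: HC1 d CH Cw H1.
  - by move=> u1 u2 x _ _; exact: wtransferB.
  - by move=> u1 M1 _; exact: step.
  - by exists m.
have Du := CkB_drv Cu; have cu := CkB_cont (CkB_derive1 Cu).
(* The bound [Mu] depends on [u]; absorption replaces it by one proportional to [m]. *)
have gu : gauge kap (m / (1 - th')) u.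
  apply: (@absorb R (fun M => gauge kap M u) th' m Mu) => //.
  - exact: CkB_ge0 Cu.
  - by move=> a a'; apply: gauge_le; exact: ltW.
  - by move=> a; exact: gauge_lim.
  - move=> a a0 ga; have [sb sL] := step _ _ a0 ga; have [bb bL] := CkB1_gauge k1 Cb.
    split=> [x|x y].
      by rewrite uE; apply: le_trans (ler_normD _ _) _; apply: lerD.
    have -> : u x - u y = (wtransfer N H w u x - wtransfer N H w u y) + (b x - b y).
      by rewrite !(uE _) ; rewrite /=; ring.
    by apply: le_trans (ler_normD _ _) _; rewrite mulrDr mulrDl; apply: lerD.
  - exact: CkB1_gauge.
suff -> : v = u.
  have -> : kap / (1 - th') * m = kap * (m / (1 - th')) by ring.
  exact: gauge_CkB1 gu Du cu.
have vu0 : forall x, `|v x - u x| <= 0 / (1 - th).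
  apply: (@absorb R (fun M => forall x, `|v x - u x| <= M) th 0 (m + Mu)) => //.
  - by rewrite addr_ge0// (CkB_ge0 Cu).
  - by move=> a a' aa Ha x; exact: le_trans (Ha x) aa.
  - by move=> a Ha x; apply/ler_addgt0Pl => e /Ha; rewrite addrC.
  - move=> a a0 Ha x; rewrite addr0 vE uE.
    have -> : wtransfer N H w v x + b x - (wtransfer N H w u x + b x) = wtransfer N H w (fun x => v x - u x) x.
      by rewrite wtransferB; ring.
    apply: le_trans (wtransfer_bnd N H wA Ha x) _.
    by rewrite mulrA; apply: ler_wpM2r.
  - move=> x; apply: le_trans (ler_normB _ _) _; apply: lerD => //.
    exact: (CkB_bnd Cu).
apply/funext => x; apply/eqP; rewrite -subr_eq0 -normr_le0.
by have := vu0 x; rewrite mul0r.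
Qed.

End transfer.

(** * Gain of regularity for solutions of transfer equations *)

Section regularity.
Context {R : realType}.
Implicit Types (phi psi w H dH : R -> R).

(** [phi'] solves a transfer equation with weight [w * dH] and an inhomogeneity in [C^1], so
    [wtransfer_core] applies to it. The equation is returned as well, so that the step can be
    repeated on [phi']. *)
Lemma reg_step N (th A Mw MH : R) : 0 <= A -> N%:R * A <= th -> th < 1 ->
  exists2 C : R, 0 <= C & forall H dH w phi b m, drv H dH -> CkB 1 MH dH ->
  (forall x, `|dH x| <= 1) -> CkB 2 Mw w -> (forall x, `|w x * dH x| <= A) ->
  CkB 1 m phi -> CkB 2 m b -> (forall x, phi x = wtransfer N H w phi x + b x) ->
  CkB 2 (C * m) phi /\
  (forall x, derive1 phi x = wtransfer N H (fun y => w y * dH y) (derive1 phi) x +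
    (wtransfer N H (derive1 w) phi x + derive1 b x)).
Proof.
move=> A0 NA th1; have Mw0 : 0 <= 2 ^+ 1 * (`|Mw| * `|MH|) :> R by rewrite expr1 !mulr_ge0.
have [C0 C00 HC] := wtransfer_core A0 Mw0 NA th1.
have [C1 C10 HC1] := wtransfer_CkB 1 N Mw MH.
exists (1 + C0 * (C1 + 1)) => [|H dH w phi b m d CH dH1 Cw wA Cp Cb pE].
  by rewrite addr_ge0// mulr_ge0// addr_ge0.
have m0 := CkB_ge0 Cp; have dphi := CkB_drv Cp.
have vE x : derive1 phi x = wtransfer N H (fun y => w y * dH y) (derive1 phi) x +
    (wtransfer N H (derive1 w) phi x + derive1 b x).
  have dE := drvD (wtransfer_drv N d (CkB_drv Cw) dphi) (CkB_drv Cb).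
  have E : phi = (fun x => wtransfer N H w phi x + b x) by apply/funext.
  by rewrite {1}E (drv_E dE); ring.
split; last exact: vE.
have Cb2 : CkB 1 ((C1 + 1) * m) (fun x => wtransfer N H (derive1 w) phi x + derive1 b x).
  rewrite mulrDl mul1r; apply: CkBD; last exact: CkB_derive1.
  by apply: HC1 (CkB_derive1 Cw) Cp; [exact: d | exact: CkB_pred CH].
have Cv : CkB 1 (C0 * ((C1 + 1) * m)) (derive1 phi).
  have wC : CkB 1 (2 ^+ 1 * (`|Mw| * `|MH|)) (fun y => w y * dH y).
    apply: CkB_le (CkBM (CkB_pred Cw) CH); rewrite !expr1 ler_wpM2l//.
    by rewrite -normrM ler_norm.
  have vb x : `|derive1 phi x| <= (C1 + 1) * m.
    apply: le_trans (CkB_bnd (CkB_derive1 Cp) x) _.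
    by rewrite mulrDl mul1r lerDr mulr_ge0.
  exact: (HC H dH _ _ _ _ d (CkB_cont CH) dH1 wA wC vb Cb2 vE).
have E : (1 + C0 * (C1 + 1)) * m = m + C0 * ((C1 + 1) * m) by ring.
apply: (CkB_S dphi); last by apply: CkB_le Cv; rewrite E lerDr.
move=> x; apply: le_trans (CkB_bnd Cp x) _; rewrite E lerDl.
by rewrite mulr_ge0// mulr_ge0// addr_ge0.
Qed.

(** The data that stay fixed while [t] varies: a constant depending on [N], [al], [be] and [M] alone
    is valid for every [P Q_t]. *)
Definition good_branch N (sg al be M : R) H dH :=
  [/\ branch N sg H dH, CkB 3 M dH, forall x, `|dH x| <= al
    & forall x, `|derive1 dH x| <= be].

Lemma sg_norm (sg : R) : sg = 1 \/ sg = -1 -> `|sg| = 1.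
Proof. by move=> [] ->; rewrite ?normrN normr1. Qed.

Lemma good_weight N sg al be M H dH : good_branch N sg al be M H dH ->
  [/\ drv H dH, CkB 3 M (fun x => sg * dH x), 0 <= al
    & forall x, `|sg * dH x * dH x| <= al ^+ 2].
Proof.
move=> [[s d _] CH dHal _]; have al0 : 0 <= al by exact: le_trans (dHal 0).
split; [exact: d | | exact: al0 | move=> x].
  have := CkBZ sg CH; rewrite (sg_norm s) mul1r; exact.
rewrite -mulrA normrM (sg_norm s) mul1r normrM expr2; exact: ler_pM.
Qed.

Lemma transfer_reg2 N (th al be M : R) : N%:R * al ^+ 2 <= th -> th < 1 -> al <= 1 ->
  exists2 C : R, 0 <= C & forall sg H dH phi b m, good_branch N sg al be M H dH ->
  CkB 1 m phi -> CkB 2 m b -> (forall x, phi x = btransfer N sg H dH phi x + b x) ->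
  CkB 2 (C * m) phi.
Proof.
move=> Nal th1 al1; have [C C0 HC] := reg_step M M (sqr_ge0 al) Nal th1.
exists C => // sg H dH phi b m gH Cp Cb pE; have [d Cw al0 wA] := good_weight gH.
have [_ CH dHal _] := gH.
have dH1 x : `|dH x| <= 1 by exact: le_trans (dHal x) al1.
by have [] := HC _ _ _ _ _ _ d (CkB_leq (isT : (1 <= 3)%N) CH) dH1 (CkB_pred Cw) wA Cp Cb pE.
Qed.

(** [reg_step] is used twice, the second time on the equation of [phi']. The relevant weight then
    has one more factor [dH] and is still at most [al ^+ 2], since [al <= 1]. *)
Lemma transfer_reg3 N (th al be M : R) : N%:R * al ^+ 2 <= th -> th < 1 -> al <= 1 ->
  exists2 C : R, 0 <= C & forall sg H dH phi b m, good_branch N sg al be M H dH ->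
  CkB 1 m phi -> CkB 3 m b -> (forall x, phi x = btransfer N sg H dH phi x + b x) ->
  CkB 3 (C * m) phi.
Proof.
move=> Nal th1 al1; have [C C0 HC] := reg_step M M (sqr_ge0 al) Nal th1.
have [C1 C10 HC1] := reg_step (2 ^+ 2 * (M * M)) M (sqr_ge0 al) Nal th1.
have [C2 C20 HC2] := wtransfer_CkB 2 N M M.
exists (C + C1 * (C + C2 * C + 1)) => [|sg H dH phi b m gH Cp Cb pE].
  by rewrite addr_ge0// mulr_ge0// !addr_ge0// mulr_ge0.
have [d Cw al0 wA] := good_weight gH; have [_ CH dHal _] := gH.
have dH1 x : `|dH x| <= 1 by exact: le_trans (dHal x) al1.
have CH1 := CkB_leq (isT : (1 <= 3)%N) CH; have m0 := CkB_ge0 Cp.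
have [Cp2 vE] := HC _ _ _ _ _ _ d CH1 dH1 (CkB_pred Cw) wA Cp (CkB_pred Cb) pE.
have Cv : CkB 1 ((C + C2 * C + 1) * m) (derive1 phi).
  apply: CkB_le (CkB_derive1 Cp2); rewrite ler_wpM2r// -addrA lerDl.
  by rewrite addr_ge0// mulr_ge0.
have Cb2 : CkB 2 ((C + C2 * C + 1) * m)
    (fun x => wtransfer N H (derive1 (fun x => sg * dH x)) phi x + derive1 b x).
  apply: CkB_le (CkBD (HC2 _ _ _ _ _ d (CkB_leq (isT : (1 <= 3)%N) CH) (CkB_derive1 Cw) Cp2) (CkB_derive1 Cb)).
  by rewrite mulrA -[X in _ + X]mul1r -mulrDl ler_wpM2r// -addrA lerDr.
have wA' x : `|sg * dH x * dH x * dH x| <= al ^+ 2.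
  by rewrite normrM -[leRHS]mulr1 ler_pM.
have [Cv2 _] := HC1 _ _ _ _ _ _ d CH1 dH1 (CkBM (CkB_pred Cw) (CkB_pred CH)) wA' Cv Cb2 vE.
apply: (CkB_S (CkB_drv Cp)) => [x|].
  apply: le_trans (CkB_bnd Cp2 x) _; rewrite ler_wpM2r// lerDl.
  by rewrite mulr_ge0// !addr_ge0// mulr_ge0.
by apply: CkB_le Cv2; rewrite mulrA ler_wpM2r// lerDr.
Qed.

End regularity.

(** * Perturbations of the identity *)

Section displacement.
Context {R : realType}.
Implicit Types (a c chi phi Psi dPsi G dG : R -> R).

(** Diffeomorphisms close to the identity are recorded by their displacement [a], which can be
    bounded in [C^k], as the lift [id + a] cannot. *)
Definition disp_inverse a Psi := (forall x, Psi x + a (Psi x) = x) /\ (forall x, Psi (x + a x) = x).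

Definition dinv a Psi : R -> R := fun x => (1 + derive1 a (Psi x))^-1.

(** For [dPsi] the positive derivative of [Psi], this is the transfer operator of the inverse of
    [Psi]. *)
Definition Qop Psi dPsi phi : R -> R := fun x => phi (Psi x) * dPsi x.

Let half_lower e x : e <= 1 / 2 -> `|x| <= e -> 1 / 2 <= 1 + x :> R.
Proof. by move=> ? /ler_normlP [? ?]; lra. Qed.

Lemma disp_drv a Psi (e : R) : CkB 1 e a -> e <= 1 / 2 -> disp_inverse a Psi -> drv Psi (dinv a Psi).
Proof.
move=> Ca e2 [K1 K2] y.
have da := drvD drv_id (CkB_drv Ca).
rewrite -{1}(K1 y); apply: (@is_derive_inverse R (fun x => x + a x)).
- by apply: filterE => x; exact: K2.
- by have ca := drv_cont da; apply: filterE => x; exact: ca.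
- exact: da.
- have := half_lower e2 (CkB_bnd (CkB_derive1 Ca) (Psi y)).
  by move=> ?; rewrite gt_eqF//; lra.
Qed.

Lemma disp_shift a Psi : periodic a 1 -> disp_inverse a Psi -> forall x, Psi (x + 1) = Psi x + 1.
Proof.
move=> p [K1 K2] x; rewrite -[in RHS](K2 (Psi x + 1)); congr Psi.
by rewrite p -{1}(K1 x); ring.
Qed.

Lemma dinv_bnd a Psi (e : R) : CkB 1 e a -> e <= 1 / 2 -> forall x, 0 <= dinv a Psi x <= 1 + 2 * e.
Proof.
move=> Ca e2 x; have B := CkB_bnd (CkB_derive1 Ca) (Psi x).
have h := half_lower e2 B; rewrite /dinv; have e0 := CkB_ge0 Ca.
set z := 1 + _ in h *; have z0 : 0 < z by lra.
rewrite invr_ge0 (ltW z0) /= -[leLHS]mul1r ler_pdivrMr//.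
have zle : 1 - e <= z by move/ler_normlP: B => [? ?]; rewrite /z; lra.
by have : (1 + 2 * e) * (1 - e) <= (1 + 2 * e) * z; [rewrite ler_wpM2l//; lra | nra].
Qed.

(** [Psi' = w(Psi)] with [w = 1 / (1 + a')], so [CkB_inv] applies; [e <= 1 / 2] keeps [1 + a']
    between [1 / 2] and [3 / 2]. *)
Lemma dinv_CkB k : exists2 C : R, 0 <= C & forall a Psi (e : R), CkB k.+1 e a -> e <= 1 / 2 ->
  disp_inverse a Psi -> CkB k C (dinv a Psi).
Proof.
have [C1 H1] := CkB_V k (3 / 2 : R) (ltac:(lra) : 0 < 1 / 2 :> R).
have [C2 H2] := CkB_inv k C1; exists `|C2| => // a Psi e Ca e2 D.
apply: CkB_le (ler_norm _) _.
apply: (H2 (fun x => (1 + derive1 a x)^-1) Psi); last exact: disp_drv (CkB_leq _ Ca) e2 D.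
apply: H1 => [x|].
  have h := half_lower e2 (CkB_bnd (CkB_derive1 Ca) x).
  by rewrite ger0_norm//; lra.
by apply: CkB_le (CkBD (CkB_cst k 1) (CkB_derive1 Ca)); rewrite normr1; lra.
Qed.

Lemma dinv_drv a Psi (e : R) : CkB 2 e a -> e <= 1 / 2 -> disp_inverse a Psi ->
  drv (dinv a Psi) (fun x => - derive1 (derive1 a) (Psi x) * dinv a Psi x ^+ 3).
Proof.
move=> Ca e2 D; have d := disp_drv (CkB_pred Ca) e2 D.
have d1 := drvD (drv_cst 1) (drv_comp (CkB_drv (CkB_derive1 Ca)) d).
apply: eq_drv (drvV d1 _) _ => [x|x].
  have := half_lower e2 (CkB_bnd (CkB_derive1 Ca) (Psi x)).
  by move=> ?; rewrite gt_eqF//; lra.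
by rewrite -/(dinv a Psi x); ring.
Qed.

(** The [8] is [2 ^+ 3]: [dinv] is at most [1 + 2 * e <= 2] and enters as a cube. *)
Lemma dinv_drv_bnd a Psi (e : R) : CkB 2 e a -> e <= 1 / 2 -> disp_inverse a Psi ->
  forall x, `|derive1 (dinv a Psi) x| <= 8 * e.
Proof.
move=> Ca e2 D x; rewrite (drv_E (dinv_drv Ca e2 D)) normrM normrN mulrC.
have /andP[b0 b1] := dinv_bnd Psi (CkB_pred Ca) e2 x; have e0 := CkB_ge0 Ca.
rewrite normrX ger0_norm// ler_pM ?exprn_ge0//.
  have -> : (8 : R) = 2 ^+ 3 by ring.
  by rewrite lerXn2r// ?nnegrE//; lra.
exact: CkB_bnd (CkB_derive1 (CkB_derive1 Ca)) _.
Qed.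

Lemma Qop_CkB k : exists2 C : R, 0 <= C & forall a Psi (e : R) phi m,
  CkB k.+1 e a -> e <= 1 / 2 -> disp_inverse a Psi -> CkB k m phi ->
  CkB k (C * m) (Qop Psi (dinv a Psi) phi).
Proof.
have [C0 C00 H0] := dinv_CkB k; have [C1 C11 H1] := CkB_comp k C0.
exists (2 ^+ k * (C1 * C0)) => [|a Psi e phi m Ca e2 D Cp].
  by rewrite !mulr_ge0// ?exprn_ge0//; exact: le_trans C11.
have CPs := H0 _ _ _ Ca e2 D.
have d := disp_drv (CkB_leq _ Ca) e2 D.
apply: CkB_le (CkBM (H1 _ _ _ _ (d isT) (CkB_leq (leq_pred k) CPs) Cp) CPs).
by rewrite le_eqVlt; apply/orP; left; apply/eqP; ring.
Qed.

(** Composing with [Psi] turns the branches of a map into those of its composition with [id + a].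
    The bounds [al] and [be] move by [O(e)], so a strict contraction survives for small [e]. *)
Lemma good_perturb N (sg al be MG e : R) G dG : branch N sg G dG -> CkB 3 MG dG ->
  (forall x, `|dG x| <= al) -> (forall x, `|derive1 dG x| <= be) -> e <= 1 / 2 ->
  exists M : R, forall a Psi, CkB 4 e a -> periodic a 1 -> disp_inverse a Psi ->
  good_branch N sg ((1 + 2 * e) * al) (8 * e * al ^+ 2 + (1 + 2 * e) * be) M
    (fun x => Psi (G x)) (fun x => dinv a Psi (G x) * dG x).
Proof.
move=> [s d Gs] CG Gal Gbe e2.
have al0 : 0 <= al by exact: le_trans (Gal 0).
have [C0 C00 H0] := @dinv_CkB 3; have [C1 C11 H1] := CkB_comp 3 MG.
exists (2 ^+ 3 * (C1 * C0 * MG)) => a Psi Ca pa D.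
have e0 := CkB_ge0 Ca.
have CPs := H0 _ _ _ Ca e2 D; have dP := disp_drv (CkB_leq (isT : (1 <= 4)%N) Ca) e2 D.
have Ca2 := CkB_leq (isT : (2 <= 4)%N) Ca.
have bP y : `|dinv a Psi y| <= 1 + 2 * e.
  have /andP[b0 b1] := dinv_bnd Psi (CkB_pred Ca2) e2 y.
  by rewrite ger0_norm.
split.
- split=> //; first exact: drv_comp dP d.
  move=> x; rewrite Gs; have := disp_shift pa D; case: s => -> sh; first exact: sh.
  by have := sh (G x - 1); rewrite subrK => ->; ring.
- exact: CkBM (H1 _ _ _ _ d (CkB_pred CG) CPs) CG.
- by move=> x; rewrite normrM ler_pM.
- move=> x; have dd := drvM (drv_comp (CkB_drv CPs) d) (CkB_drv CG).
  rewrite (drv_E dd); apply: le_trans (ler_normD _ _) _; rewrite !normrM; apply: lerD.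
    by rewrite -mulrA -expr2 ler_pM ?exprn_ge0// ?(dinv_drv_bnd Ca2)// lerXn2r ?nnegrE.
  by rewrite ler_pM.
Qed.

(** [P Q] is itself a branch transfer, so the contraction and regularity estimates apply to it
    directly. *)
Lemma btransfer_comp N sg G dG Psi dPsi phi x :
  btransfer N sg (fun x => Psi (G x)) (fun x => dPsi (G x) * dG x) phi x =
  btransfer N sg G dG (Qop Psi dPsi phi) x.
Proof. by apply: eq_bigr => j _; rewrite /Qop; ring. Qed.

End displacement.

(** * Expansion of [Q_c] in a small displacement [c] *)

Section expansion.
Context {R : realType}.
Implicit Types (a c chi phi Psi dPsi : R -> R).

Lemma CkB_ext k M (f g : R -> R) : (forall x, f x = g x) -> CkB k M f -> CkB k M g.
Proof. by move=> /funext ->. Qed.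

Lemma recip_CkB k : exists2 C : R, 0 <= C & forall c mc, mc <= 1 / 2 -> CkB k.+1 mc c ->
  (forall x, 1 + derive1 c x != 0) /\ CkB k C (fun x => (1 + derive1 c x)^-1).
Proof.
have [C HC] := CkB_V k (3 / 2 : R) (ltac:(lra) : 0 < 1 / 2 :> R).
exists `|C| => // c mc mc2 Cc.
have h x : 1 / 2 <= `|1 + derive1 c x|.
  have /ler_normlP[? ?] := CkB_bnd (CkB_derive1 Cc) x.
  by rewrite ger0_norm; lra.
split=> [x|]; first by rewrite -normr_gt0; have := h x; lra.
apply: CkB_le (ler_norm _) _; apply: HC => //.
by apply: CkB_le (CkBD (CkB_cst k 1) (CkB_derive1 Cc)); rewrite normr1; lra.
Qed.

(** With [y = Psi x], that is [x = y + c y], the difference is [- (chi (y + c) - chi) - c' chi / (1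
    + c')] at [y]. Both terms carry [c], and composition with [Psi] preserves the bound. *)
Lemma Qop_sub_CkB k : exists2 C : R, 0 <= C & forall c Psi mc chi m, mc <= 1 / 2 ->
  CkB k.+1 mc c -> disp_inverse c Psi -> CkB k.+1 m chi ->
  CkB k (C * (mc * m)) (fun x => Qop Psi (dinv c Psi) chi x - chi x).
Proof.
have [C0 C00 H0] := @dinv_CkB R k; have [C1 C11 H1] := CkB_comp k C0.
have [C2 C20 H2] := @recip_CkB k; have [C3 C30 H3] := @CkB_displacement R k.
have C10 : 0 <= C1 by exact: le_trans C11.
exists (C1 * (C3 + 2 ^+ k * (2 ^+ k * C2))) => [|c Psi mc chi m mc2 Cc D Cchi].
  by rewrite mulr_ge0// addr_ge0// !mulr_ge0// exprn_ge0.
have mc1 : mc <= 1 by lra.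
have [w0 Cw] := H2 _ _ mc2 Cc.
have CPs := CkB_leq (leq_pred k) (H0 _ _ _ Cc mc2 D).
have dP := disp_drv (CkB_leq (isT : (1 <= k.+1)%N) Cc) mc2 D.
have E1 := H3 _ _ _ _ mc1 Cchi (CkB_pred Cc).
have E2 := CkBM (CkBM (CkB_derive1 Cc) Cw) (CkB_pred Cchi).
have := H1 _ _ _ _ dP CPs (CkBN (CkBD E1 E2)).
have -> : C1 * (C3 * mc * m + 2 ^+ k * (2 ^+ k * (mc * C2) * m)) =
  C1 * (C3 + 2 ^+ k * (2 ^+ k * C2)) * (mc * m) by ring.
apply: CkB_ext => x; have [K _] := D.
rewrite /Qop /dinv !K; set z := derive1 c (Psi x).
have z0 : 1 + z != 0 by exact: w0.
by field.
Qed.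

(** With [y = Psi x] and [n = c chi], the remainder is [c'^2 chi / (1 + c') - (chi (y + c) - chi - c
    chi') + (n' (y + c) - n')] at [y]: three terms quadratic in [c]. Bounding the last one in [C^1]
    takes [n] in [C^3], hence both [c] and [chi]. *)
Lemma Qop_expansion : exists2 C : R, 0 <= C & forall c Psi mc chi m, mc <= 1 / 2 ->
  CkB 3 mc c -> disp_inverse c Psi -> CkB 3 m chi ->
  CkB 1 (C * (mc ^+ 2 * m))
    (fun x => Qop Psi (dinv c Psi) chi x - chi x + derive1 (fun y => c y * chi y) x).
Proof.
have [C0 C00 H0] := @dinv_CkB R 1; have [C1 C11 H1] := CkB_comp 1 C0.
have [C2 C20 H2] := @recip_CkB 1; have [C3 C30 H3] := @CkB_displacement R 1.
have [C4 C40 H4] := @CkB_taylor2 R 1.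
have C10 : 0 <= C1 by exact: le_trans C11.
exists (C1 * (4 * C2 * 2 + C4 + C3 * 8)) => [|c Psi mc chi m mc2 Cc D Cchi].
  by rewrite !(mulr_ge0, addr_ge0).
have mc1 : mc <= 1 by lra.
have Cc2 := CkB_pred Cc; have Cc1 := CkB_pred Cc2.
have [w0 Cw] := H2 _ _ mc2 Cc2.
have CPs := CkB_pred (H0 _ _ _ Cc2 mc2 D).
have dP := disp_drv Cc1 mc2 D.
have E1 := CkBM (CkBM (CkBM (CkB_derive1 Cc2) (CkB_derive1 Cc2)) Cw) (CkB_pred (CkB_pred Cchi)).
have E2 := H4 _ _ _ _ mc1 Cchi Cc1.
have dn := drvM (CkB_drv Cc) (CkB_drv Cchi).
have Cn := CkBD (CkBM (CkB_derive1 Cc) (CkB_pred Cchi)) (CkBM (CkB_pred Cc) (CkB_derive1 Cchi)).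
have E3 := H3 _ _ _ _ mc1 Cn Cc1.
have := H1 _ _ _ _ dP CPs (CkBD (CkBB E1 E2) E3).
rewrite (drv_E dn).
have -> : C1 * (2 ^+ 1 * (2 ^+ 1 * (2 ^+ 1 * (mc * mc) * C2) * m) + C4 * mc ^+ 2 * m +
    C3 * mc * (2 ^+ 2 * (mc * m) + 2 ^+ 2 * (mc * m))) =
  C1 * (4 * C2 * 2 + C4 + C3 * 8) * (mc ^+ 2 * m) by ring.
apply: CkB_ext => x; have [K _] := D.
rewrite /Qop /dinv !K; set z := derive1 c (Psi x).
have z0 : 1 + z != 0 by exact: w0.
by field.
Qed.

(* [id + c = (id + b) o (id + a)^-1] *)
Lemma disp_compose a b Psia Psib : disp_inverse a Psia -> disp_inverse b Psib ->
  disp_inverse (fun x => b (Psia x) - a (Psia x)) (fun x => Psib x + a (Psib x)).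
Proof.
move=> [A1 A2] [B1 B2]; split=> x.
  by rewrite A2 -[RHS]B1; ring.
have -> : x + (b (Psia x) - a (Psia x)) = Psia x + b (Psia x) by rewrite -{1}(A1 x); ring.
by rewrite B2.
Qed.

(** Differentiating [Psib = Psia o Psic] matches the weights. *)
Lemma Qop_compose a b Psia Psib (e mc : R) phi x : CkB 1 e a -> CkB 1 e b -> e <= 1 / 2 ->
  disp_inverse a Psia -> disp_inverse b Psib -> 
  let c := fun x => b (Psia x) - a (Psia x) in
  let Psic := fun x => Psib x + a (Psib x) in
  CkB 1 mc c -> mc <= 1 / 2 ->
  Qop Psib (dinv b Psib) phi x = Qop Psic (dinv c Psic) (Qop Psia (dinv a Psia) phi) x.
Proof.
move=> Ca Cb e2 Da Db c Psic Cc mc2; have Dc := disp_compose Da Db.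
have [A1 A2] := Da; rewrite /Qop /Psic A2 -mulrA; congr (_ * _).
have d1 := disp_drv Cb e2 Db.
have d2 := drv_comp (disp_drv Ca e2 Da) (disp_drv Cc mc2 Dc).
have E : (fun x => Psia (Psic x)) = Psib by apply/funext => y; rewrite /Psic A2.
by have := drv_E d2; rewrite E (drv_E d1) => /(congr1 (fun F => F x)).
Qed.

End expansion.

(** * From the norms and regularity classes of the statement to explicit bounds *)

Section interface.
Context {R : realType}.
Implicit Types (f g phi : R -> R).

Lemma C0norm_ge g x : (`|g x|%:E <= C0norm g)%E.
Proof. by apply: ereal_sup_ubound; exists x. Qed.

Lemma C0norm_le g (M : R) : (forall x, `|g x| <= M) -> (C0norm g <= M%:E)%E.
Proof. by move=> H; apply: ge_ereal_sup => _ [x _ <-]; rewrite lee_fin. Qed.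

Lemma C0norm_fin g (M : R) : (forall x, `|g x| <= M) ->
  exists m : R, [/\ C0norm g = m%:E, 0 <= m, m <= M & forall x, `|g x| <= m].
Proof.
move=> H; have := C0norm_le H; have := C0norm_ge g.
case: (C0norm g) => [m| |] //= H1 H2; last by have := H1 0.
have gm x : `|g x| <= m by rewrite -lee_fin.
by exists m; split=> //; exact: le_trans (gm 0).
Qed.

Lemma C1norm_le g g' (M : R) : drv g g' -> (forall x, `|g x| <= M) -> (forall x, `|g' x| <= M) ->
  (C1norm g <= (2 * M)%:E)%E.
Proof.
move=> d H1 H2; rewrite /C1norm (drv_E d).
have -> : (2 * M)%:E = (M%:E + M%:E)%E :> \bar R by rewrite -EFinD; congr _%:E; ring.
by apply: leeD; exact: C0norm_le.
Qed.

Lemma Ck_succ k f : Ck k.+1 f -> drv f (derive1 f) /\ Ck k (derive1 f).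
Proof.
move=> [df Df]; split.
  by apply: drv_derive1 => x; apply/derivable1_diffP.
by have := Df 1; congr Ck; apply/funext => x; rewrite derive1E.
Qed.

Lemma Ck_continuous k f : Ck k f -> continuous f.
Proof. by case: k => [//|k] /Ck_succ[/drv_cont]. Qed.

Lemma Ck_CkB k g : Ck k g -> periodic g 1 -> exists M, CkB k M g.
Proof.
elim: k g => [|k IH] g Cg p.
  by have [M HM] := periodic_bounded p Cg; exists M; exact: CkB_0.
have [d Cd] := Ck_succ Cg.
have [M HM] := periodic_bounded p (Ck_continuous Cg).
have [M' CM'] := IH _ Cd (periodic_derive1 d p).
have M0 : 0 <= M by exact: le_trans (HM 0).
exists (M + M'); apply: (CkB_S d) => [x|]; last by apply: CkB_le CM'; rewrite lerDr.
by apply: le_trans (HM x) _; rewrite lerDl (CkB_ge0 CM').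
Qed.

Lemma CkB_Ck k M g : CkB k M g -> Ck k g.
Proof.
elim: k M g => [|k IH] M g Cg; first exact: CkB_cont Cg.
have d := CkB_drv Cg; have dg x : differentiable g x.
  by apply/derivable1_diffP; exact: (drv_derivable d).
split=> // v; apply: (IH (`|v| * M)).
apply: CkB_ext (CkBZ v (CkB_derive1 Cg)) => x.
by rewrite deriveE// derive1E deriveE// -{2}[v]mulr1 linearZ.
Qed.

Lemma CkB_circle_Ck k M g : periodic g 1 -> CkB k M g -> circle_Ck k g.
Proof. by move=> p /CkB_Ck. Qed.

Lemma circle_Ck_CkB k g : circle_Ck k g -> periodic g 1 /\ exists M, CkB k M g.
Proof. by move=> [p /Ck_CkB H]; split=> //; exact: H. Qed.

End interface.

(** * Inverse branches of an expanding map *)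

Section inverse_lift.
Context {R : realType}.

Let min_max0 (u v : R) : u * v < 0 -> Num.min u v <= 0 <= Num.max u v.
Proof.
move=> uv; rewrite ge_min le_max.
by case: (lerP u 0) => u0; case: (lerP v 0) => v0; rewrite ?(ltW v0) ?(ltW u0) ?orbT//; nra.
Qed.

Variables (f : R -> R) (N : nat) (omega : R).
Hypotheses (f_C5 : Ck 5 f) (f_deg : degree_lift N f) (omega_gt1 : 1 < omega)
  (f_expanding : forall x, omega < `|derive1 f x|).

Let df : drv f (derive1 f). Proof. by have [] := Ck_succ f_C5. Qed.

Let f'_neq0 x : derive1 f x != 0.
Proof. by rewrite -normr_gt0; apply: lt_trans (f_expanding x); apply: lt_trans omega_gt1. Qed.

Let f_inj x y : f x = f y -> x = y.
Proof.
move=> e; have [z _] := drv_MVT x y df; rewrite e subrr => /esym/eqP.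
by rewrite mulf_eq0 (negbTE (f'_neq0 z)) /= subr_eq0 => /eqP.
Qed.

Lemma lift_int (d : int) (x : R) (k : int) : (forall x, f (x + 1) = f x + d%:~R) ->
  f (x + k%:~R) = f x + (d * k)%:~R.
Proof.
move=> H; have p : periodic (fun x => f x - d%:~R * x) 1.
  by move=> y; rewrite H; ring.
by have := periodic_int k x p; rewrite intrM => e; move: (f _) e => z e; lra.
Qed.

Lemma periodic_derive1_lift : periodic (derive1 f) 1.
Proof.
have [d _ H] := f_deg => x.
have d1 := drv_shift 1 df; have d2 := drvD df (drv_cst d%:~R).
have E : (fun x => f (x + 1)) = (fun x => f x + d%:~R) by apply/funext => y; exact: H.
have := congr1 (fun F => F x) (drv_E d1).
by rewrite E (drv_E d2) addr0 => <-.
Qed.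

(** [f'] has no zero, hence a constant sign; by the mean value theorem on one period the degree is a
    value of [f'], so it is nonzero and has that sign. *)
Lemma degree_sign : exists2 s : int, s = 1 \/ s = -1 &
  [/\ forall x (k : int), f (x + k%:~R) = f x + (s * N%:Z * k)%:~R, (0 < N)%N
    & forall x, `|derive1 f x| = s%:~R * derive1 f x].
Proof.
have [d dN H] := f_deg.
have [z _] := drv_MVT 1 0 df; rewrite -{1}[1]add0r H subr0 mulr1 addrC addKr => dz.
have c' : continuous (derive1 f).
  by have [_ /Ck_continuous] := Ck_succ f_C5.
have same x : 0 < derive1 f z * derive1 f x.
  rewrite ltNge; apply/negP => le0.
  have ivt a b : a <= b -> derive1 f a * derive1 f b <= 0 -> False.
    move=> ab; rewrite le_eqVlt mulf_eq0 !(negbTE (f'_neq0 _)) /= => ab0.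
    have [//||y _ y0] := @IVT R (derive1 f) a b 0 ab.
    - exact: continuous_subspaceT.
    - exact: min_max0.
    - by have := f'_neq0 y; rewrite y0 eqxx.
  have [zx|/ltW xz] := leP z x; first exact: ivt zx le0.
  by apply: ivt xz _; rewrite mulrC.
have d0 : d != 0.
  by apply/eqP => d0; have := f'_neq0 z; rewrite -dz d0 eqxx.
have ds : d = sgz d * N%:Z by rewrite -dN; exact: intEsg.
exists (sgz d); first by move: d0; rewrite -sgz_eq0; case: sgzP => //; [left|right].
split.
- by move=> x k; rewrite -ds; exact: lift_int.
- by rewrite -dN absz_gt0.
- move=> x; have := same x; rewrite -dz; case: (sgzP d) d0 => [->//|dp _|dn _].
  + by rewrite pmulr_rgt0 ?ltr0z// => /gtr0_norm ->; rewrite mul1r.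
  + by rewrite nmulr_rgt0 ?ltrz0// => /ltr0_norm ->; rewrite mulN1r.
Qed.

(** The lift is a bijection of the line with inverse [G], and the preimages of [x] on the circle are
    the classes of [G (x + j)] for [j < N]. The bounds come from [G' = 1 / f'(G)] and
    [G'' = - f''(G) G'^3]. *)
Lemma inverse_lift (F2 : R) : (forall x, `|derive1 (derive1 f) x| <= F2) ->
  exists s : int, exists G dG M, [/\ branch N s%:~R G dG, CkB 3 M dG,
    (forall x, `|dG x| <= omega^-1), (forall x, `|derive1 dG x| <= F2 * omega ^- 3) &
    forall phi, periodic phi 1 -> transferP f phi = btransfer N s%:~R G dG phi].
Proof.
move=> f2; have [s s1 [fk N0 fs]] := degree_sign.
have om0 : 0 < omega by apply: lt_trans omega_gt1.
(* Over [m] periods [f] moves by [s N m], at least [m] in absolute value, so [y] lies between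
   [f (- m)] and [f m]. *)
have surj y : exists x, f x = y.
  pose m := Num.bound `|y - f 0|.
  have mb : `|y - f 0| < m%:R by exact: archi_boundP.
  have NR1 : 1 <= N%:R :> R by rewrite ler1n.
  have fm : f m%:R = f 0 + s%:~R * N%:R * m%:R.
    by have := fk 0 m%:Z; rewrite add0r !intrM.
  have fm' : f (- m%:R) = f 0 - s%:~R * N%:R * m%:R.
    by have := fk 0 (- m%:Z); rewrite add0r mulrN !rmorphN /= !intrM.
  have [|||x _ <-] := @IVT R f (- m%:R) m%:R y; last by exists x.
  - by rewrite ge0_cp.
  - by apply: continuous_subspaceT; exact: drv_cont df.
  - rewrite fm fm'; have : m%:R <= N%:R * m%:R :> R by rewrite ler_peMl.
    rewrite -!mulrA; move: (N%:R * m%:R) => K; move/ltr_normlP: mb => [b1 b2] mK.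
    rewrite ge_min le_max; case: s1 => ->; rewrite ?rmorphN1 ?rmorph1.
      by apply/andP; split; apply/orP; [left|right]; lra.
    by apply/andP; split; apply/orP; [right|left]; lra.
have [G GK] := choice surj.
have KG x : G (f x) = x by apply: f_inj; rewrite GK.
pose dG x := (derive1 f (G x))^-1.
have dGd : drv G dG.
  move=> y; rewrite -{1}(GK y); apply: (@is_derive_inverse R f).
  - by apply: filterE => x; exact: KG.
  - by have cf := drv_cont df; apply: filterE => x; exact: cf.
  - exact: df.
  - exact: f'_neq0.
have Gk x (k : int) : G (x + (s * N%:Z * k)%:~R) = G x + k%:~R.
  by apply: f_inj; rewrite GK fk GK.
have ss : s * s = 1 by case: s1 => ->.
have br : branch N s%:~R G dG.
  split=> //; first by case: s1 => ->; [left|right].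
  by move=> x; rewrite -Gk mulrAC ss mul1r.
have [_ Cf'] := Ck_succ f_C5.
have [M CM] := Ck_CkB Cf' periodic_derive1_lift.
have [C HC] := CkB_V 3 M om0; have [C' HC'] := @CkB_inv R 3 C.
exists s, G, dG, C'; split=> //.
- apply: (HC' (fun y => (derive1 f y)^-1) G _ dGd).
  by apply: HC (CkB_pred CM) => x; exact: ltW.
- by move=> x; rewrite normfV lef_pV2 ?posrE ?normr_gt0// ltW.
- move=> x; have dd := drvV (drv_comp (CkB_drv CM) dGd) (fun x => f'_neq0 (G x)).
  rewrite (drv_E dd) -/(dG x) -mulNr -mulrA normrM normrN -exprS normrX.
  apply: ler_pM => //.
  rewrite -exprVn; apply: lerXn2r; rewrite ?nnegrE ?invr_ge0 ?(ltW om0)//.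
  by rewrite normfV lef_pV2 ?posrE ?normr_gt0// ltW.
move=> phi pphi; apply/funext => x; rewrite /transferP.
(* The representative in [[0, 1[], the interval used by [fiber]. *)
pose hh (j : nat) := G (x + j%:R) - (Num.floor (G (x + j%:R)))%:~R.
have bij : set_bij `I_N (fiber f x) hh.
  split.
  - move=> j jN; split; first exact: frac_itv.
    exists (j%:Z + s * N%:Z * (- Num.floor (G (x + j%:R)))).
    rewrite /hh -rmorphN /= fk GK -addrA; congr (_ + _).
    by rewrite [RHS]rmorphD.
  (* Branches with the same class satisfy [i = j + s N m], and both indices lie below [N]. *)
  - move=> i j; rewrite !inE => iN jN e.
    pose m := Num.floor (G (x + i%:R)) - Num.floor (G (x + j%:R)).
    have Gij : G (x + i%:R) = G (x + j%:R) + m%:~R.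
      by move: e; rewrite /hh /m rmorphB /=; lra.
    have : (i%:Z)%:~R = (j%:Z + s * N%:Z * m)%:~R :> R.
      apply: (addrI x); rewrite -[LHS]GK [X in f X]Gij fk GK rmorphD /=.
      by rewrite addrA.
    move/intr_inj => ij; move: iN jN; rewrite /= => iN jN.
    have m0 : m = 0 by case: s1 ij => ->; nia.
    by move: ij; rewrite m0 mulr0 addr0 => -[].
  (* The remainder of [k] modulo [N] selects the branch; the quotient, up to the sign [s], is the
     integer by which [y] is translated. *)
  - move=> y [/andP[y0 y1] [k fy]].
    pose j := `|(k %% N%:Z)%Z|%N; pose q := (k %/ N%:Z)%Z.
    have jE : j%:Z = (k %% N%:Z)%Z by rewrite gez0_abs// modz_ge0// -lt0n.
    have jN : (j < N)%N by rewrite -ltz_nat jE ltz_pmod.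
    have kE : k = j%:Z + s * N%:Z * (s * q).
      rewrite jE {1}(divz_eq k N%:Z) -/q addrC; congr (_ + _).
      by rewrite mulrACA ss mul1r mulrC.
    have yE : y = G (x + j%:R) + (s * q)%:~R.
      by apply: f_inj; rewrite fk GK fy {1}kE rmorphD /= addrA.
    exists j => //; rewrite /hh.
    have -> : Num.floor (G (x + j%:R)) = - (s * q).
      have h1 : (- (s * q))%:~R = - (s * q)%:~R :> R by rewrite rmorphN.
      apply: floor_def; rewrite intrD h1; move: yE y0 y1.
      by move: (G _) ((s * q)%:~R : R) => u v -> *; apply/andP; split; lra.
    by rewrite yE rmorphN /= opprK.
rewrite (reindex_fsbig hh _ _ _ bij) -fsbig_ord; apply: eq_bigr => j _.
rewrite /hh (periodic_frac _ pphi) (periodic_frac _ (_ : periodic (fun y => `|derive1 f y|) 1)).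
  rewrite fs invfM -[X in _ * (X * _)]/(_) mulrC; congr (_ * _).
  by rewrite -/(dG _); congr (_ * _); case: s1 => ->; rewrite ?invrN invr1.
by move=> u; rewrite periodic_derive1_lift.
Qed.

End inverse_lift.

(** * The coupling in terms of displacements *)

Section coupling.
Context {R : realType}.
Implicit Types (g phi psi : R -> R) (h : R * R -> R).

Lemma diffeo_disp h (t : R) psi : circle_diffeo (couplingPhi h t psi) ->
  disp_inverse (fun x => t * meanA h psi x) (pinv setT (couplingPhi h t psi)).
Proof.
move=> [_ _ [Psi _ [K1 K2]]]; split=> x.
  by apply: (@pinvK _ _ _ setT (couplingPhi h t psi)); rewrite inE; exists (Psi x).
by apply: (@pinvKV _ _ _ setT (couplingPhi h t psi)); rewrite ?inE// => u v _ _; exact: (can_inj K1).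
Qed.

Lemma coupling_derive1 h (t e : R) psi : CkB 1 e (fun x => t * meanA h psi x) ->
  derive1 (couplingPhi h t psi) = fun x => 1 + derive1 (fun x => t * meanA h psi x) x.
Proof. by move=> Ca; rewrite (drv_E (drvD drv_id (CkB_drv Ca))). Qed.

Lemma transferQ_Qop h (t e : R) psi phi : CkB 1 e (fun x => t * meanA h psi x) ->
  let Psi := pinv setT (couplingPhi h t psi) in
  transferQ h t psi phi = Qop Psi (dinv (fun x => t * meanA h psi x) Psi) phi.
Proof. by move=> Ca Psi; apply/funext => x; rewrite /transferQ (coupling_derive1 Ca). Qed.

Lemma operK_E h (t e : R) rho g : CkB 1 e (fun x => t * meanA h rho x) ->
  let Psi := pinv setT (couplingPhi h t rho) in
  operK h t rho g =
  derive1 (fun x => Qop Psi (dinv (fun x => t * meanA h rho x) Psi) rho x * meanA h g (Psi x)).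
Proof. by move=> Ca Psi; rewrite /operK (coupling_derive1 Ca). Qed.

End coupling.

(** * Contractions on functions of zero mean *)

Section mean_zero.
Context {R : realType}.
Implicit Types (u v g phi : R -> R).

Definition mean0 u := [/\ periodic u 1, hasmean u 0 & exists M, CkB 1 M u].

Lemma mean0P u : mean0 u <-> (@C1_mean0 R) u.
Proof.
split=> [[p m [M C]]|[Cu m]].
  by split; [exact: CkB_circle_Ck C | apply: hasmean_integral m; exact: CkB_cont C].
have [p [M C]] := circle_Ck_CkB Cu; split=> //; last by exists M.
by have := integral_hasmean (CkB_cont C) p; rewrite m.
Qed.

Lemma mean0D u v : mean0 u -> mean0 v -> mean0 (fun x => u x + v x).
Proof.
move=> [p1 m1 [M1 C1]] [p2 m2 [M2 C2]]; split.
- by move=> x; rewrite p1 p2.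
- by rewrite -[0]addr0; exact: hasmeanD.
- by exists (M1 + M2); exact: CkBD.
Qed.

Lemma mean0Z a u : mean0 u -> mean0 (fun x => a * u x).
Proof.
move=> [p m [M C]]; split.
- by move=> x; rewrite p.
- by rewrite -[0](mulr0 a); exact: hasmeanZ.
- by exists (`|a| * M); exact: CkBZ.
Qed.

Lemma mean0B u v : mean0 u -> mean0 v -> mean0 (fun x => u x - v x).
Proof.
move=> [p1 m1 [M1 C1]] [p2 m2 [M2 C2]]; split.
- by move=> x; rewrite p1 p2.
- by rewrite -[0]subr0; exact: hasmeanB.
- by exists (M1 + M2); exact: CkBB.
Qed.

Lemma Lip_ge0 (M : R) g : Lip M g -> 0 <= M.
Proof.
move=> /(_ 1 0); rewrite subr0 normr1 mulr1; exact: le_trans.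
Qed.

Lemma mean0_bnd (M : R) u : mean0 u -> Lip M u -> forall x, `|u x| <= M.
Proof. by move=> [p m _] L; apply: Lip_mean0 => //; exact: Lip_ge0 L. Qed.

Lemma mean0_CkB1 (M : R) u : mean0 u -> Lip M u -> CkB 1 M u.
Proof.
move=> m0 L; have [p m [M' C]] := m0; have d := CkB_drv C.
apply: (CkB_S d); first exact: mean0_bnd.
by apply: CkB_0; [exact: Lip_drv d L | exact: CkB_cont (CkB_derive1 C)].
Qed.

Lemma CkB1_Lip (M : R) u : CkB 1 M u -> Lip M u.
Proof. by move=> C; exact: drv_Lip (CkB_drv C) (CkB_bnd (CkB_derive1 C)). Qed.

Lemma Lip_absorb (th b M : R) u : 0 <= th -> th < 1 -> 0 <= b -> Lip M u ->
  (forall m, 0 <= m -> Lip m u -> Lip (th * m + b) u) -> Lip (b / (1 - th)) u.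
Proof.
move=> th0 th1 b0 L step; apply: (@absorb R (fun m => Lip m u) th b M) => //.
- exact: Lip_ge0 L.
- by move=> m m'; exact: Lip_le.
- by move=> m H; exact: Lip_lim.
Qed.

(** Differentiability of the limit is [C1_closed]; its mean vanishes because the integral of [v - u]
    is at most [e] in absolute value. *)
Lemma mean0_closed u :
  (forall e, 0 < e -> exists2 v, mean0 v & gauge 1 e (fun x => v x - u x)) -> mean0 u.
Proof.
move=> H.
have p : periodic u 1.
  move=> x; apply/eqP; rewrite -subr_eq0 -normr_le0; apply/ler_addgt0Pl => e e0.
  have [v [pv _ _] [b _]] := H (e / 2) (ltac:(lra) : 0 < e / 2).
  have := b x; have := b (x + 1); rewrite pv addr0.
  have -> : u (x + 1) - u x = (v x - u x) - (v x - u (x + 1)) by ring.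
  by move=> h1 h2; apply: le_trans (ler_normB _ _) _; lra.
have [u' du cu] : exists2 u', drv u u' & continuous u'.
  apply: C1_closed => e /H [v [_ _ [M C]] [_ L]]; exists v, (derive1 v); split.
  - exact: CkB_drv C.
  - exact: CkB_cont (CkB_derive1 C).
  - by rewrite mul1r in L.
have [M CM] : exists M, CkB 1 M u.
  have pu' := periodic_derive1 du p.
  have [M1 H1] := periodic_bounded p (drv_cont du).
  have [M2 H2] := periodic_bounded pu' cu.
  exists (Num.max M1 M2); apply: (CkB_S du) => [x|].
    by rewrite le_max H1.
  by apply: CkB_0 => // x; rewrite le_max H2 orbT.
split=> //; last by exists M.
have mu := integral_hasmean (CkB_cont CM) p.
suff -> : 0 = circle_integral u by [].
apply/esym/eqP; rewrite -normr_le0; apply/ler_addgt0Pl => e e0; rewrite addr0.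
have [v [pv mv [M' C']] [b _]] := H e e0.
have mw := hasmeanB mv mu; have cw := CkB_cont (CkBB C' CM).
have := circle_integral_le cw b; apply: le_trans.
have := @le_normr_Rintegral _ _ R (@lebesgue_measure R) `[0, 1] (fun x => v x - u x)
  (measurable_itv _) (continuous_integrable 0 1 cw).
by rewrite -/(circle_integral _) (hasmean_integral cw mw) sub0r normrN.
Qed.

(** The gauge is used with [kap = 1], as zero mean lets the Lipschitz seminorm control the sup
    norm. *)
Lemma mean0_solve (th : R) (T : (R -> R) -> R -> R) g : 0 <= th -> th < 1 ->
  (forall u, mean0 u -> mean0 (T u)) ->
  (forall u v x, mean0 u -> mean0 v -> T (fun x => u x - v x) x = T u x - T v x) ->
  (forall u m, mean0 u -> Lip m u -> Lip (th * m) (T u)) ->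
  mean0 g -> exists2 u, mean0 u & forall x, u x = T u x + g x.
Proof.
move=> th0 th1 Tm TB TL mg.
apply: (@affine_fixpoint R 1 th mean0) => //.
- by move=> u [].
- exact: mean0_closed.
- exact: mean0D.
- exact: mean0B.
- move=> u M mu M0 [_ L]; rewrite mul1r in L; have TLu := TL _ _ mu L.
  by split; [exact: mean0_bnd (Tm _ mu) TLu | rewrite mul1r].
Qed.

Lemma mean0_fixed_Lip (th m : R) (T : (R -> R) -> R -> R) g u : 0 <= th -> th < 1 ->
  (forall u m, mean0 u -> Lip m u -> Lip (th * m) (T u)) ->
  mean0 u -> Lip m g -> (forall x, u x = T u x + g x) -> Lip (m / (1 - th)) u.
Proof.
move=> th0 th1 TL mu Lg E; have [_ _ [M C]] := mu.
apply: (Lip_absorb th0 th1 (Lip_ge0 Lg) (CkB1_Lip C)) => k k0 Lk x y.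
rewrite !(E _); have -> : T u x + g x - (T u y + g y) = (T u x - T u y) + (g x - g y) by ring.
apply: le_trans (ler_normD _ _) _; rewrite mulrDl; apply: lerD => //.
exact: TL.
Qed.

End mean_zero.

(** * Uniform regularity of invariant densities *)

Section invariant_density.
Context {R : realType}.
Implicit Types (phi u rho H dH : R -> R).

Lemma btransfer_mean0 N (sg M : R) H dH u : branch N sg H dH -> CkB 1 M dH -> mean0 u ->
  mean0 (btransfer N sg H dH u).
Proof.
move=> br CH [p m [Mu Cu]]; have [s d _] := br; split.
- exact: btransfer_periodic.
- exact: btransfer_mean.
- have [C _ HC] := wtransfer_CkB 1 N (`|sg| * M) M; exists (C * Mu).
  by apply: HC Cu; [exact: d | exact: CkB_pred CH | exact: CkBZ].
Qed.

Lemma good_contract N (sg al be M m : R) H dH u : good_branch N sg al be M H dH ->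
  periodic u 1 -> hasmean u 0 -> Lip m u ->
  Lip (N%:R * (al ^+ 2 + be) * m) (btransfer N sg H dH u).
Proof.
move=> [br CH Hal Hbe] p mu L.
exact: btransfer_contract br (CkB_drv CH) Hal Hbe (Lip_ge0 L) p mu L.
Qed.

(** The Lipschitz constant [L] must not enter [C]. It is eliminated by comparison with [1 + u],
    whose bound does not involve [rho]: [w = rho - 1 - u] is a Lipschitz fixed point of [T] of zero
    mean, so absorption brings its Lipschitz constant down to [0]. *)
Lemma invariant_density_CkB3 N (th al be M : R) : 0 <= be ->
  N%:R * (al ^+ 2 + be) <= th -> th < 1 -> al <= 1 ->
  exists C : R, forall sg H dH rho L, good_branch N sg al be M H dH -> periodic rho 1 ->
  hasmean rho 1 -> Lip L rho -> (forall x, rho x = btransfer N sg H dH rho x) -> CkB 3 C rho.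
Proof.
move=> be0 Nth th1 al1; have N0 : 0 <= N%:R :> R by exact: ler0n.
have Nal : N%:R * al ^+ 2 <= th by apply: le_trans Nth; rewrite ler_wpM2l// lerDl.
have th0 : 0 <= th by apply: le_trans Nal; rewrite mulr_ge0// sqr_ge0.
have [C3 C30 H3] := transfer_reg3 be M Nal th1 al1.
have [C1 C10 H1] := wtransfer_CkB 1 N M M.
exists (C3 * (1 + (C1 + 1) / (1 - th))) => sg H dH rho L gH pr mr Lr rE.
have [br CH Hal Hbe] := gH; have [d Cw _ _] := good_weight gH.
have CH1 := CkB_pred (CkB_pred CH).
pose T := btransfer N sg H dH.
have TL u m : periodic u 1 -> hasmean u 0 -> Lip m u -> Lip (th * m) (T u).
  move=> p mu Lu; apply: Lip_le (good_contract gH p mu Lu).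
  by rewrite ler_wpM2r// (Lip_ge0 Lu).
have TL0 u m : mean0 u -> Lip m u -> Lip (th * m) (T u) by move=> [p mu _]; exact: TL.
have C1c : CkB 1 1 (fun _ : R => 1 : R) by have := CkB_cst 1 (1 : R); rewrite normr1.
pose g x := T (fun _ => 1) x - 1.
have Cg : CkB 1 (C1 + 1) g.
  apply: CkBD; last by apply: CkBN.
  by rewrite -[C1]mulr1; apply: H1 C1c; [exact: d | exact: CkB_pred CH1 | exact: CkB_pred (CkB_pred Cw)].
have mg : mean0 g.
  split; last by exists (C1 + 1).
  - by move=> x; rewrite /g /T (btransfer_periodic br).
  - rewrite -[0](subrr 1); apply: hasmeanB (hasmean_cst 1).
    by apply: btransfer_mean br _; exact: hasmean_cst.
have TB u v x : T (fun x => u x - v x) x = T u x - T v x by exact: wtransferB.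
have [u mu uE] := mean0_solve th0 th1 (fun u => btransfer_mean0 br CH1) (fun u v x _ _ => TB u v x) TL0 mg.
have Lu := mean0_fixed_Lip th0 th1 TL0 mu (CkB1_Lip Cg) uE.
have [pu hu [Mu Cu]] := mu.
pose w x := rho x - 1 - u x.
have pw : periodic w 1 by move=> x; rewrite /w pr pu.
have hw : hasmean w 0.
  have -> : 0 = 1 - 1 - 0 :> R by ring.
  by apply: hasmeanB hu; apply: hasmeanB (hasmean_cst 1).
have Lw : Lip (L + (C1 + 1) / (1 - th)) w.
  move=> x y; have -> : w x - w y = (rho x - rho y) - (u x - u y) by rewrite /w; ring.
  by apply: le_trans (ler_normB _ _) _; rewrite mulrDl; apply: lerD.
have wE x : w x = T w x.
  have rT : T rho x = rho x by rewrite rE.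
  have -> : T w x = T rho x - T (fun _ => 1) x - T u x by rewrite -!TB.
  by rewrite rT /w (uE x : u x = T u x + g x) /g; ring.
have Lw0 : Lip (0 / (1 - th)) w.
  apply: (Lip_absorb th0 th1 (lexx 0) Lw) => m m0 Lm x y.
  by rewrite !(wE _) addr0; exact: TL.
have rhoE x : 1 + u x = rho x.
  rewrite mul0r in Lw0; have := Lip_mean0 (lexx 0) pw hw Lw0 x.
  rewrite normr_le0 /w => /eqP e; have -> : rho x = 1 + u x + (rho x - 1 - u x) by ring.
  by rewrite e addr0.
have Crho : CkB 1 (1 + (C1 + 1) / (1 - th)) rho.
  by apply: CkB_ext rhoE _; apply: CkBD C1c _; exact: mean0_CkB1.
apply: (H3 _ _ _ _ (fun _ => 0) _ gH Crho).
  have := CkB_cst 3 (0 : R); rewrite normr0; apply: CkB_le; exact: CkB_ge0 Crho.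
by move=> x; rewrite addr0.
Qed.

End invariant_density.

(** * Linear response *)

Section response.
Context {R : realType}.
Implicit Types (t m b : R) (g u v phi : R -> R).
(** [A] stands for [meanA h] and enters through linearity, periodicity and the smoothing bound from
    [C^0] to [C^4]; [e] is the radius of the admissible [t], and [eps] bounds all displacements
    [a t]. *)
Variables (N : nat) (sg al be MG M th Mh eps e M3 : R) (G dG : R -> R).
Variables (A : (R -> R) -> R -> R) (a Psi rho : R -> R -> R).
Hypotheses (G_branch : branch N sg G dG) (G_CkB : CkB 3 MG dG).
Hypotheses (be0 : 0 <= be) (Nth : N%:R * (al ^+ 2 + be) <= th) (th1 : th < 1) (al1 : al <= 1).
Hypotheses (e_gt0 : 0 < e) (eps2 : eps <= 1 / 2) (Mh0 : 0 <= Mh).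
Hypotheses (A_CkB : forall (g : R -> R) (m : R), continuous g -> (forall x, `|g x| <= m) -> CkB 4 (Mh * m) (A g))
  (A_B : forall (g1 g2 : R -> R) (x : R), continuous g1 -> continuous g2 ->
     A (fun y => g1 y - g2 y) x = A g1 x - A g2 x)
  (A_Z : forall (b : R) (g : R -> R) (x : R), continuous g -> A (fun y => b * g y) x = b * A g x)
  (A_periodic : forall g, periodic (A g) 1).
Hypotheses (aE : forall t x, a t x = t * A (rho t) x)
  (a_CkB : forall t, `|t| <= e -> CkB 4 eps (a t))
  (a_disp : forall t, `|t| <= e -> disp_inverse (a t) (Psi t))
  (H_good : forall t, `|t| <= e -> good_branch N sg al be M (fun x => Psi t (G x))
     (fun x => dinv (a t) (Psi t) (G x) * dG x)).
Hypotheses (rho_periodic : forall t, `|t| <= e -> periodic (rho t) 1)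
  (rho_mean : forall t, `|t| <= e -> hasmean (rho t) 1)
  (rho_CkB : forall t, `|t| <= e -> CkB 3 M3 (rho t)).

Definition Pop := btransfer N sg G dG.
Definition Qt t := Qop (Psi t) (dinv (a t) (Psi t)).
(** The density after the coupling and before [f]. *)
Definition chi t := Qt t (rho t).
Definition flux t g : R -> R := fun x => chi t x * A g (Psi t x).
Definition Kt t g := derive1 (flux t g).
(** The linearisation of the self-consistent operator at [rho t]: the second term is the effect of a
    change of density on [Phi_t]. *)
Definition Tt t u : R -> R := fun x => Pop (Qt t u) x - t * Pop (Kt t u) x.

Hypothesis rho_fixed : forall t, `|t| <= e -> forall x, rho t x = Pop (chi t) x.

Let th_ge0 : 0 <= th.
Proof. by apply: le_trans Nth; rewrite mulr_ge0// addr_ge0// sqr_ge0. Qed.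

Let sg1 : `|sg| = 1.
Proof. by have [s _ _] := G_branch; exact: sg_norm. Qed.

Let e00 : `|0 : R| <= e. Proof. by rewrite normr0 ltW. Qed.

Let M3_ge0 : 0 <= M3. Proof. exact: CkB_ge0 (rho_CkB e00). Qed.

Lemma a_periodic t : periodic (a t) 1.
Proof. by move=> x; rewrite !aE A_periodic. Qed.

Lemma Pop_CkB k : (k <= 3)%N -> exists2 C : R, 0 <= C & forall m phi,
  CkB k m phi -> CkB k (C * m) (Pop phi).
Proof.
move=> k3; have [C C0 HC] := wtransfer_CkB k N MG MG; exists C => // m phi Cp.
have [_ d _] := G_branch; have Ck := CkB_leq k3 G_CkB.
apply: (HC _ dG) Cp; [exact: d | exact: CkB_leq (leq_pred k) Ck|].
by have := CkBZ sg Ck; rewrite sg1 mul1r.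
Qed.

Lemma PopB phi1 phi2 x : Pop (fun y => phi1 y - phi2 y) x = Pop phi1 x - Pop phi2 x.
Proof. exact: wtransferB. Qed.

Lemma PopD phi1 phi2 x : Pop (fun y => phi1 y + phi2 y) x = Pop phi1 x + Pop phi2 x.
Proof. exact: wtransferD. Qed.

Lemma PopZ b phi x : Pop (fun y => b * phi y) x = b * Pop phi x.
Proof. exact: wtransferZ. Qed.

Lemma Qt_CkB k : (k <= 3)%N -> exists2 C : R, 0 <= C & forall t m phi, `|t| <= e ->
  CkB k m phi -> CkB k (C * m) (Qt t phi).
Proof.
move=> k3; have [C C0 HC] := @Qop_CkB R k; exists C => // t m phi te.
apply: HC (eps2) (a_disp te); exact: CkB_leq (a_CkB te).
Qed.

Lemma QtB t phi1 phi2 x : Qt t (fun y => phi1 y - phi2 y) x = Qt t phi1 x - Qt t phi2 x.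
Proof. by rewrite /Qt /Qop mulrBl. Qed.

Lemma PopQt t phi x : Pop (Qt t phi) x =
  btransfer N sg (fun x => Psi t (G x)) (fun x => dinv (a t) (Psi t) (G x) * dG x) phi x.
Proof. by rewrite btransfer_comp. Qed.

Lemma PopQt_Lip t m u : `|t| <= e -> mean0 u -> Lip m u -> Lip (th * m) (Pop (Qt t u)).
Proof.
move=> te [p mu _] L; have := good_contract (H_good te) p mu L.
rewrite -(funext (PopQt t u)); apply: Lip_le.
by rewrite ler_wpM2r// (Lip_ge0 L).
Qed.

Lemma PopQt_mean0 t u : `|t| <= e -> mean0 u -> mean0 (Pop (Qt t u)).
Proof.
move=> te mu; have [br CH _ _] := H_good te.
by rewrite (funext (PopQt t u)); exact: btransfer_mean0 br (CkB_pred (CkB_pred CH)) mu.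
Qed.

Lemma chi_periodic t : `|t| <= e -> periodic (chi t) 1.
Proof.
move=> te x; have sh := disp_shift (a_periodic t) (a_disp te).
have pa' := periodic_derive1 (CkB_drv (a_CkB te)) (a_periodic t).
by rewrite /chi /Qt /Qop /dinv !sh pa' (rho_periodic te).
Qed.

Lemma Psi_comp_CkB : exists2 C : R, 1 <= C & forall t m g, `|t| <= e ->
  CkB 3 m g -> CkB 3 (C * m) (fun x => g (Psi t x)).
Proof.
have [C0 C00 H0] := @dinv_CkB R 3; have [C C1 HC] := CkB_comp 3 C0.
exists C => // t m g te; apply: HC.
  exact: disp_drv (CkB_leq (isT : (1 <= 4)%N) (a_CkB te)) eps2 (a_disp te).
exact: CkB_pred (H0 _ _ _ (a_CkB te) eps2 (a_disp te)).
Qed.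

Lemma flux_CkB : exists2 C : R, 0 <= C & forall t m g, `|t| <= e ->
  continuous g -> (forall x, `|g x| <= m) -> CkB 3 (C * m) (flux t g).
Proof.
have [C1 C10 H1] := Qt_CkB (leqnn 3); have [C2 C21 H2] := Psi_comp_CkB.
exists (2 ^+ 3 * (C1 * M3 * (C2 * Mh))) => [|t m g te cg gm].
  by rewrite !mulr_ge0// ?exprn_ge0//; exact: le_trans C21.
have X := CkBM (H1 _ _ _ te (rho_CkB te)) (H2 _ _ _ te (CkB_pred (A_CkB cg gm))).
by apply: CkB_le X; rewrite le_eqVlt; apply/orP; left; apply/eqP; ring.
Qed.

Lemma flux_periodic t g : `|t| <= e -> periodic (flux t g) 1.
Proof.
move=> te x; rewrite /flux (chi_periodic te) (disp_shift (a_periodic t) (a_disp te)).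
by rewrite A_periodic.
Qed.

Lemma Kt_CkB : exists2 C : R, 0 <= C & forall t m g, `|t| <= e ->
  continuous g -> (forall x, `|g x| <= m) -> CkB 2 (C * m) (Kt t g).
Proof.
have [C C0 HC] := flux_CkB; exists C => // t m g te cg gm.
exact: CkB_derive1 (HC _ _ _ te cg gm).
Qed.

Lemma continuous_bounded_flux t g : `|t| <= e -> continuous g ->
  (exists m, forall x, `|g x| <= m) -> drv (flux t g) (Kt t g).
Proof.
move=> te cg [m gm]; have [C _ HC] := flux_CkB.
exact: CkB_drv (HC _ _ _ te cg gm).
Qed.

Lemma KtB t g1 g2 m1 m2 : `|t| <= e -> CkB 0 m1 g1 -> CkB 0 m2 g2 ->
  Kt t (fun y => g1 y - g2 y) = fun x => Kt t g1 x - Kt t g2 x.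
Proof.
move=> te C1 C2.
have d1 := continuous_bounded_flux te (CkB_cont C1) (ex_intro _ m1 (CkB_bnd C1)).
have d2 := continuous_bounded_flux te (CkB_cont C2) (ex_intro _ m2 (CkB_bnd C2)).
rewrite -(drv_E (drvB d1 d2)); congr (derive1 _); apply/funext => x.
by rewrite /flux A_B; [ring | exact: CkB_cont C1 | exact: CkB_cont C2].
Qed.

Lemma KtZ t b g m : `|t| <= e -> CkB 0 m g -> Kt t (fun y => b * g y) = fun x => b * Kt t g x.
Proof.
move=> te C.
have d := continuous_bounded_flux te (CkB_cont C) (ex_intro _ m (CkB_bnd C)).
rewrite -(drv_E (drvZ b d)); congr (derive1 _); apply/funext => x.
by rewrite /flux A_Z; [ring | exact: CkB_cont C].
Qed.

Lemma PopKt_mean0 t g m : `|t| <= e -> CkB 0 m g -> mean0 (Pop (Kt t g)).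
Proof.
move=> te C; have cg := CkB_cont C; have bg := CkB_bnd C.
apply: btransfer_mean0 G_branch (CkB_pred (CkB_pred G_CkB)) _.
have d := continuous_bounded_flux te cg (ex_intro _ m bg).
split.
- exact: periodic_derive1 d (flux_periodic g te).
- exact: hasmean_drv d (flux_periodic g te).
- have [C' _ HC] := Kt_CkB; exists (C' * m); exact: CkB_pred (HC _ _ _ te cg bg).
Qed.

Lemma Tt_mean0 t u : `|t| <= e -> mean0 u -> mean0 (Tt t u).
Proof.
move=> te mu; have [_ _ [m C]] := mu.
by apply: mean0B; [exact: PopQt_mean0 | apply: mean0Z; exact: PopKt_mean0 (CkB_pred C)].
Qed.

Lemma TtB t u v x : `|t| <= e -> mean0 u -> mean0 v ->
  Tt t (fun x => u x - v x) x = Tt t u x - Tt t v x.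
Proof.
move=> te [_ _ [m1 C1]] [_ _ [m2 C2]].
rewrite /Tt (KtB te (CkB_pred C1) (CkB_pred C2)) PopB.
by rewrite (funext (QtB t u v)) PopB; ring.
Qed.

(** [P K_t] bounds the Lipschitz seminorm of its image by the sup norm of [u], hence by [m]; for
    [|t| <= e1] the perturbation uses at most half of the gap [1 - th]. *)
Lemma Tt_Lip : exists2 e1 : R, 0 < e1 <= e & forall t m u, `|t| <= e1 ->
  mean0 u -> Lip m u -> Lip ((1 + th) / 2 * m) (Tt t u).
Proof.
have [C1 C10 H1] := Kt_CkB; have [C2 C20 H2] := Pop_CkB (isT : (1 <= 3)%N).
have C0 : 0 < C2 * C1 + 1 by rewrite ltr_wpDl// mulr_ge0.
pose e1 := Num.min e ((1 - th) / 2 / (C2 * C1 + 1)).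
have e1P : 0 < e1 <= e.
  by rewrite ge_min lexx lt_min e_gt0 !divr_gt0// subr_gt0.
exists e1 => // t m u te1 mu Lu.
have te : `|t| <= e by apply: le_trans te1 _; case/andP: e1P.
have [p hm [mm Cu]] := mu; have m0 := Lip_ge0 Lu.
have L1 := PopQt_Lip te mu Lu.
have L2 := CkB1_Lip (H2 _ _ (CkB_pred (H1 _ _ _ te (CkB_cont Cu) (mean0_bnd mu Lu)))).
move=> x y; have -> : Tt t u x - Tt t u y =
  (Pop (Qt t u) x - Pop (Qt t u) y) - t * (Pop (Kt t u) x - Pop (Kt t u) y).
  by rewrite /Tt; ring.
apply: le_trans (ler_normB _ _) _; rewrite normrM.
apply: (@le_trans _ _ (th * m * `|x - y| + `|t| * (C2 * (C1 * m) * `|x - y|))).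
  by apply: lerD; [exact: L1 | rewrite ler_wpM2l//; exact: L2].
have t2 : `|t| * (C2 * C1 + 1) <= (1 - th) / 2.
  rewrite -ler_pdivlMr//; apply: le_trans te1 _.
  by rewrite ge_min lexx orbT.
have t3 : `|t| * (C2 * C1) <= (1 - th) / 2.
  by apply: le_trans t2; rewrite ler_wpM2l// lerDl.
have -> : th * m * `|x - y| + `|t| * (C2 * (C1 * m) * `|x - y|) =
  (th + `|t| * (C2 * C1)) * (m * `|x - y|) by ring.
by rewrite -mulrA ler_wpM2r ?mulr_ge0//; lra.
Qed.


Let small_radius (B eta e1 : R) : 0 < e1 -> 0 <= B -> 0 < eta ->
  exists2 e2, 0 < e2 <= e1 & B * e2 <= eta.
Proof.
move=> e10 B0 eta0; have B1 : 0 < B + 1 by rewrite ltr_wpDl.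
exists (Num.min e1 (eta / (B + 1))).
  by rewrite ge_min lexx lt_min e10 divr_gt0.
apply: (@le_trans _ _ ((B + 1) * (eta / (B + 1)))); last by rewrite mulrCA divff ?mulr1// gt_eqF.
apply: ler_pM => //; first by rewrite le_min (ltW e10) divr_ge0// ltW.
  by rewrite lerDl.
by rewrite ge_min lexx orbT.
Qed.

Definition del s t : R -> R := fun x => rho s x - rho t x.
(** The displacement [c] of [Phi_s o Phi_t^-1]; [shift_inv] is the inverse map
    [Phi_t o Phi_s^-1]. *)
Definition shift_disp s t : R -> R := fun x => a s (Psi t x) - a t (Psi t x).
Definition shift_inv s t : R -> R := fun x => Psi s x + a t (Psi s x).
Definition Qshift s t := Qop (shift_inv s t) (dinv (shift_disp s t) (shift_inv s t)).

Lemma del_CkB s t : `|s| <= e -> `|t| <= e -> CkB 3 (2 * M3) (del s t).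
Proof.
move=> se te; have -> : 2 * M3 = M3 + M3 by ring.
exact: CkBB (rho_CkB se) (rho_CkB te).
Qed.

Lemma del_mean0 s t : `|s| <= e -> `|t| <= e -> mean0 (del s t).
Proof.
move=> se te; split.
- by move=> x; rewrite /del !rho_periodic.
- by rewrite -[0](subrr 1); exact: hasmeanB (rho_mean se) (rho_mean te).
- by exists (2 * M3); exact: CkB_pred (CkB_pred (del_CkB se te)).
Qed.

Lemma A_del s t x : `|s| <= e -> `|t| <= e -> A (rho s) x = A (rho t) x + A (del s t) x.
Proof.
move=> se te; rewrite A_B; first by ring.
- exact: CkB_cont (rho_CkB se).
- exact: CkB_cont (rho_CkB te).
Qed.

Lemma shift_dispE s t x : `|s| <= e -> `|t| <= e ->
  shift_disp s t x = (s - t) * A (rho s) (Psi t x) + t * A (del s t) (Psi t x).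
Proof. by move=> se te; rewrite /shift_disp !aE (A_del _ se te); ring. Qed.

Lemma shift_disp_disp s t : `|s| <= e -> `|t| <= e -> disp_inverse (shift_disp s t) (shift_inv s t).
Proof. by move=> se te; exact: disp_compose (a_disp te) (a_disp se). Qed.

Lemma shift_disp_CkB : exists2 C : R, 0 <= C & forall s t m, `|s| <= e -> `|t| <= e ->
  (forall x, `|del s t x| <= m) -> CkB 3 (C * (`|s - t| + `|t| * m)) (shift_disp s t).
Proof.
have [C C1 HC] := Psi_comp_CkB; have C0 : 0 <= C by exact: le_trans C1.
exists (C * (Mh * (M3 + 1))) => [|s t m se te dm]; first by rewrite !mulr_ge0// addr_ge0.
have m0 : 0 <= m by exact: le_trans (dm 0).
have cs := CkB_cont (rho_CkB se); have cd := CkB_cont (del_CkB se te).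
have X := CkBD (CkBZ (s - t) (A_CkB cs (CkB_bnd (rho_CkB se)))) (CkBZ t (A_CkB cd dm)).
have Y := HC _ _ _ te (CkB_pred X).
apply: CkB_ext (CkB_le _ Y) => [x|]; first by rewrite shift_dispE.
rewrite -subr_ge0; have -> : C * (Mh * (M3 + 1)) * (`|s - t| + `|t| * m) -
    C * (`|s - t| * (Mh * M3) + `|t| * (Mh * m)) = C * Mh * (`|s - t| + M3 * (`|t| * m)) by ring.
by rewrite !(mulr_ge0, addr_ge0).
Qed.

Lemma Qt_shift s t mc phi x : `|s| <= e -> `|t| <= e -> CkB 1 mc (shift_disp s t) -> mc <= 1 / 2 ->
  Qt s phi x = Qshift s t (Qt t phi) x.
Proof.
move=> se te Cc mc2; have l14 := isT : (1 <= 4)%N.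
exact: Qop_compose (CkB_leq l14 (a_CkB te)) (CkB_leq l14 (a_CkB se)) eps2 (a_disp te)
  (a_disp se) Cc mc2.
Qed.

(** [Q_s (rho s) - Q_t (rho t)] splits into [Q_s del], on which [P Q_s] contracts, and
    [(Q_s - Q_t) (rho t)], which is [Q_c chi - chi]. *)
Lemma del_eq s t mc x : `|s| <= e -> `|t| <= e -> CkB 1 mc (shift_disp s t) -> mc <= 1 / 2 ->
  del s t x = Pop (Qt s (del s t)) x + Pop (fun y => Qshift s t (chi t) y - chi t y) x.
Proof.
move=> se te Cc mc2; rewrite PopB (funext (QtB s (rho s) (rho t))) PopB.
rewrite -(funext (fun x => Qt_shift (rho t) x se te Cc mc2)).
by rewrite {1}/del (rho_fixed se) (rho_fixed te) /chi; ring.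
Qed.

Lemma chi_CkB : exists2 C : R, 0 <= C & forall t, `|t| <= e -> CkB 3 C (chi t).
Proof.
have [C C0 HC] := Qt_CkB (leqnn 3); exists (C * M3); first exact: mulr_ge0.
by move=> t te; exact: HC (rho_CkB te).
Qed.

(** Absorption in [del_eq] first gives a Lipschitz bound on [del]. The displacement is then
    [O(|s - t|)] in [C^3], so the inhomogeneity of [del_eq] is [O(|s - t|)] in [C^2] and
    [transfer_reg2] raises the bound to [C^2]. *)
Lemma del_estimate : exists2 e1, 0 < e1 <= e & exists2 C : R, 0 <= C & forall s t,
  `|s| <= e1 -> `|t| <= e1 ->
  [/\ C * `|s - t| <= 1 / 2, CkB 2 (C * `|s - t|) (del s t)
    & CkB 3 (C * `|s - t|) (shift_disp s t)].
Proof.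
have [Cc Cc0 HCc] := shift_disp_CkB; have [Mx Mx0 HMx] := chi_CkB.
have [C1 C10 HC1] := @Qop_sub_CkB R 1; have [C2 C20 HC2] := @Qop_sub_CkB R 2.
have [P1 P10 HP1] := Pop_CkB (isT : (1 <= 3)%N); have [P2 P20 HP2] := Pop_CkB (isT : (2 <= 3)%N).
have Nal : N%:R * al ^+ 2 <= th by apply: le_trans Nth; rewrite ler_wpM2l// lerDl.
have [R2 R20 HR2] := transfer_reg2 be M Nal th1 al1.
pose D := P1 * (C1 * (Cc * Mx)); have D0 : 0 <= D by rewrite !mulr_ge0.
pose th2 := (1 + th) / 2; have th20 : 0 <= th2 by rewrite divr_ge0// addr_ge0.
have th1_ := th1; have th21 : th2 < 1 by rewrite /th2; lra.
pose K := D / (1 - th2); have K0 : 0 <= K by rewrite divr_ge0// subr_ge0 ltW.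
pose Kc := Cc * (1 + e * K).
have Kc0 : 0 <= Kc by rewrite mulr_ge0// addr_ge0// mulr_ge0// ltW.
pose Kd := R2 * (K + P2 * (C2 * (Kc * Mx))).
have Kd0 : 0 <= Kd.
  apply: mulr_ge0 => //; apply: addr_ge0 => //.
  by do 3 apply: mulr_ge0 => //.
pose C := Kc + Kd; have C0 : 0 <= C by rewrite addr_ge0.
have half0 : 0 < 1 / 2 :> R by lra.
have d0 : 0 < (1 - th) / 2 by lra.
have B10 : 0 <= Cc * (2 + 2 * M3) by rewrite mulr_ge0// addr_ge0// mulr_ge0.
(* [ea] keeps the displacement below [1 / 2], [eb] makes its part proportional to [|t|] absorbable,
   and [ec] bounds [C * |s - t|] by [1 / 2]. *)
have [ea /andP[ea0 eae] Ha] := small_radius e_gt0 B10 half0.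
have [eb /andP[eb0 eba] Hb] := small_radius ea0 D0 d0.
have [ec /andP[ec0 ecb] Hc] := small_radius eb0 (mulr_ge0 (ler0n _ 2) C0) half0.
exists ec; first by rewrite ec0 (le_trans ecb)// (le_trans eba).
exists C => // s t s1 t1.
have sb := le_trans s1 ecb; have tb := le_trans t1 ecb.
have sa := le_trans sb eba; have ta := le_trans tb eba.
have se := le_trans sa eae; have te := le_trans ta eae.
have st m r : `|s| <= r -> `|t| <= r -> `|s - t| <= 2 * r.
  by move=> sr tr; apply: le_trans (ler_normB _ _) _; rewrite mulr_natl mulr2n; exact: lerD.
have dmean := del_mean0 se te; have Cdel := CkB_pred (CkB_pred (del_CkB se te)).
have st0 := normr_ge0 (s - t).
have mc2 m : 0 <= m -> m <= 2 * M3 -> Cc * (`|s - t| + `|t| * m) <= 1 / 2.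
  move=> m0 mM; apply: le_trans Ha; rewrite -mulrA ler_wpM2l// mulrDl.
  by apply: lerD; [exact: st | rewrite mulrC; exact: ler_pM].
have step m : 0 <= m -> Lip m (del s t) -> Lip (th2 * m + D * `|s - t|) (del s t).
  (* Capping [m] by the known bound [2 * M3] keeps the displacement below [1 / 2] however large [m]
     is. *)
  move=> m0 L; pose m' := Num.min m (2 * M3).
  have L' : Lip m' (del s t).
    by rewrite /m'; case: (leP m (2 * M3)) => _; [exact: L | exact: CkB1_Lip Cdel].
  have m'0 := Lip_ge0 L'; have m'm : m' <= m by rewrite ge_min lexx.
  have m'M : m' <= 2 * M3 by rewrite ge_min lexx orbT.
  have Cs := HCc s t m' se te (mean0_bnd dmean L').
  have mch := mc2 _ m'0 m'M.
  have L1 := PopQt_Lip se dmean L'.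
  have L2 := CkB1_Lip (HP1 _ _ (HC1 _ _ _ _ _ mch (CkB_pred Cs) (shift_disp_disp se te) (CkB_pred (HMx _ te)))).
  have E := fun x => del_eq x se te (CkB_pred (CkB_pred Cs)) mch.
  move=> x y; rewrite !(E _).
  set p := Pop _; set q := Pop _.
  have -> : p x + q x - (p y + q y) = (p x - p y) + (q x - q y) by ring.
  apply: le_trans (ler_normD _ _) _.
  apply: le_trans (lerD (L1 x y) (L2 x y)) _; rewrite -mulrDl ler_wpM2r//.
  have -> : P1 * (C1 * (Cc * (`|s - t| + `|t| * m') * Mx)) = D * `|s - t| + (D * `|t|) * m'.
    by rewrite /D; ring.
  have Dt : D * `|t| <= (1 - th) / 2 by apply: le_trans Hb; rewrite ler_wpM2l.
  have -> : th2 * m = th * m + (1 - th) / 2 * m by rewrite /th2; field.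
  rewrite [D * `|s - t| + _]addrC addrA lerD2r; apply: lerD; first exact: ler_wpM2l.
  by apply: ler_pM => //; rewrite mulr_ge0.
have Ldel : Lip (K * `|s - t|) (del s t).
  have := Lip_absorb th20 th21 (mulr_ge0 D0 st0) (CkB1_Lip Cdel) step.
  by rewrite /K mulrAC.
have dbnd := mean0_bnd dmean Ldel.
have Ks0 : 0 <= K * `|s - t| by rewrite mulr_ge0.
have Cs : CkB 3 (Kc * `|s - t|) (shift_disp s t).
  apply: CkB_le (HCc s t _ se te dbnd); rewrite /Kc -mulrA ler_wpM2l// mulrDl mul1r lerD2l.
  by rewrite -mulrA ler_wpM2r.
have st2 : `|s - t| <= 2 * ec by exact: st.
have Cst : C * `|s - t| <= 1 / 2.
  by apply: le_trans Hc; rewrite [2 * C]mulrC -mulrA ler_wpM2l.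
have Kcst : Kc * `|s - t| <= 1 / 2.
  by apply: le_trans Cst; rewrite ler_wpM2r// lerDl.
split=> //.
- have Cb : CkB 2 (P2 * (C2 * (Kc * `|s - t| * Mx)))
      (Pop (fun y => Qshift s t (chi t) y - chi t y)).
    exact: HP2 _ _ (HC2 _ _ _ _ _ Kcst Cs (shift_disp_disp se te) (HMx _ te)).
  have E x : del s t x = btransfer N sg (fun x => Psi s (G x)) (fun x => dinv (a s) (Psi s) (G x) * dG x)
      (del s t) x + Pop (fun y => Qshift s t (chi t) y - chi t y) x.
    by rewrite -PopQt; exact: del_eq x se te (CkB_pred (CkB_pred Cs)) Kcst.
  pose m := (K + P2 * (C2 * (Kc * Mx))) * `|s - t|.
  have X : CkB 2 (R2 * m) (del s t).
    apply: (HR2 _ _ _ _ _ _ (H_good se) _ _ E).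
    + apply: CkB_le (mean0_CkB1 dmean Ldel); rewrite ler_wpM2r// lerDl; do 3 apply: mulr_ge0 => //.
    + apply: CkB_le Cb; rewrite /m.
      have -> : P2 * (C2 * (Kc * `|s - t| * Mx)) = P2 * (C2 * (Kc * Mx)) * `|s - t| by ring.
      by rewrite ler_wpM2r// lerDr.
  apply: CkB_le X; rewrite /m mulrA -/Kd ler_wpM2r// lerDr//.
- by apply: CkB_le Cs; rewrite ler_wpM2r// lerDl.
Qed.

(** As [rho s = rho t + del], the displacement is also [(s - t) A (rho t) + s A del], composed with
    [Psi t]; the coefficient of [del] becomes [s] instead of [t]. *)
Lemma shift_flux s t : `|s| <= e -> `|t| <= e ->
  derive1 (fun x => shift_disp s t x * chi t x) =
  fun x => (s - t) * Kt t (rho t) x + s * Kt t (del s t) x.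
Proof.
move=> se te.
have d1 := continuous_bounded_flux te (CkB_cont (rho_CkB te)) (ex_intro _ M3 (CkB_bnd (rho_CkB te))).
have d2 := continuous_bounded_flux te (CkB_cont (del_CkB se te)) (ex_intro _ _ (CkB_bnd (del_CkB se te))).
rewrite -(drv_E (drvD (drvZ (s - t) d1) (drvZ s d2))); congr (derive1 _); apply/funext => x.
by rewrite shift_dispE// (A_del _ se te) /flux; ring.
Qed.

(** The expression is [P] of three terms of order [|s - t|^2]: [(Q_c - 1) (Q_t del)], where [c] and
    [del] are both small; the remainder in the expansion of [Q_c chi]; and [- (s - t) K_t del],
    which turns the coefficient [s] of [shift_flux] into the [t] of [Tt]. *)
Lemma response_remainder : exists2 e1, 0 < e1 <= e & exists2 C : R, 0 <= C & forall s t,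
  `|s| <= e1 -> `|t| <= e1 -> CkB 1 (C * `|s - t| ^+ 2)
    (fun x => del s t x - Tt t (del s t) x + (s - t) * Pop (Kt t (rho t)) x).
Proof.
have [e1 e1e [C0 C00 H0]] := del_estimate.
have [Mx Mx0 HMx] := chi_CkB.
have [C1 C10 HC1] := @Qop_sub_CkB R 1; have [C2 C20 HC2] := @Qop_expansion R.
have [C3 C30 HC3] := Kt_CkB; have [P1 P10 HP1] := Pop_CkB (isT : (1 <= 3)%N).
have [C4 C40 HC4] := Qt_CkB (isT : (2 <= 3)%N).
exists e1 => //; exists (P1 * (C1 * (C0 * (C4 * C0)) + C2 * (C0 ^+ 2 * Mx) + C3 * C0)).
  by rewrite !(mulr_ge0, addr_ge0, exprn_ge0).
move=> s t s1 t1; have [_ ee] := andP e1e.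
have se := le_trans s1 ee; have te := le_trans t1 ee.
have [half Cdel Cs] := H0 _ _ s1 t1.
have D := shift_disp_disp se te.
have X1 := HC1 _ _ _ _ _ half (CkB_pred Cs) D (HC4 _ _ _ te Cdel).
have X2 := HC2 _ _ _ _ _ half Cs D (HMx _ te).
have X3 := CkBZ (s - t) (CkB_pred (HC3 _ _ _ te (CkB_cont Cdel) (CkB_bnd Cdel))).
have := HP1 _ _ (CkBB (CkBD X1 X2) X3).
have -> : P1 * (C1 * (C0 * `|s - t| * (C4 * (C0 * `|s - t|))) +
    C2 * ((C0 * `|s - t|) ^+ 2 * Mx) + `|s - t| * (C3 * (C0 * `|s - t|))) =
  P1 * (C1 * (C0 * (C4 * C0)) + C2 * (C0 ^+ 2 * Mx) + C3 * C0) * `|s - t| ^+ 2 by ring.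
apply: CkB_ext => x.
pose Y1 y := Qshift s t (Qt t (del s t)) y - Qt t (del s t) y.
pose Y2 y := Qshift s t (chi t) y - chi t y.
pose Y3 y := (s - t) * Kt t (rho t) y + s * Kt t (del s t) y.
have E : Pop (fun y => Y1 y + (Y2 y + Y3 y) - (s - t) * Kt t (del s t) y) x =
    Pop Y1 x + (Pop Y2 x + Pop Y3 x) - (s - t) * Pop (Kt t (del s t)) x.
  by rewrite -PopZ -!PopD -PopB.
rewrite (shift_flux se te); apply: etrans E _.
have Cs1 := CkB_pred (CkB_pred Cs).
rewrite {1}(del_eq x se te Cs1 half) -/Y2.
rewrite (funext (fun x => Qt_shift (del s t) x se te Cs1 half)).
have -> : Pop Y1 x = Pop (Qshift s t (Qt t (del s t))) x - Pop (Qt t (del s t)) x by rewrite -PopB.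
have -> : Pop Y3 x = (s - t) * Pop (Kt t (rho t)) x + s * Pop (Kt t (del s t)) x.
  by rewrite -!PopZ -PopD.
by rewrite /Tt; ring.
Qed.

Lemma TtZ t b m u x : `|t| <= e -> CkB 0 m u -> Tt t (fun x => b * u x) x = b * Tt t u x.
Proof.
move=> te Cu; rewrite /Tt (KtZ b te Cu) PopZ.
have -> : Qt t (fun x => b * u x) = fun x => b * Qt t u x.
  by apply/funext => y; rewrite /Qt /Qop mulrA.
by rewrite PopZ; ring.
Qed.

(** [J g] is a chosen solution of [u = T_t u + g]; its uniqueness, again by contraction, is what
    makes [J] a two-sided inverse of [1 - T_t]. *)
Lemma Tt_resolvent t (th2 : R) : `|t| <= e -> 0 <= th2 -> th2 < 1 ->
  (forall m u, mean0 u -> Lip m u -> Lip (th2 * m) (Tt t u)) ->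
  exists J : (R -> R) -> R -> R, forall g, mean0 g ->
  [/\ mean0 (J g), forall x, J g x = Tt t (J g) x + g x,
      forall m, Lip m g -> Lip (m / (1 - th2)) (J g)
    & forall u, mean0 u -> (forall x, u x = Tt t u x + g x) -> u = J g].
Proof.
move=> te th20 th21 TL.
have ex g : exists u, mean0 g -> mean0 u /\ forall x, u x = Tt t u x + g x.
  have [mg|nmg] := pselect (mean0 g); last by exists g => /nmg.
  have [u mu uE] := mean0_solve th20 th21 (fun u => Tt_mean0 te)
    (fun u v x => @TtB t u v x te) (fun u m => @TL m u) mg.
  by exists u.
have [J HJ] := choice ex; exists J => g mg; have [mJ JE] := HJ g mg.
split=> // [m Lg|u mu uE].
  exact: mean0_fixed_Lip th20 th21 (fun u m => @TL m u) mJ Lg JE.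
have mw := mean0B mu mJ.
have wE x : u x - J g x = Tt t (fun x => u x - J g x) x + 0.
  by rewrite TtB// addr0 uE JE; ring.
have L0 : Lip 0 (fun _ : R => 0 : R) by move=> x y; rewrite subrr normr0 mul0r.
have Lw := mean0_fixed_Lip th20 th21 (fun u m => @TL m u) mw L0 wE.
apply/funext => x; apply/eqP; rewrite -subr_eq0 -normr_le0.
by have := mean0_bnd mw Lw x; rewrite mul0r.
Qed.

(** The difference quotient minus its expected limit solves [w = T_t w + E], with [E] the expression
    of [response_remainder] divided by [s - t]. The rate is uniform in [t], which will also give
    continuity of the derivative. *)
Lemma linear_response : exists2 e1, 0 < e1 <= e & exists2 C : R, 0 <= C &
  forall t, `|t| <= e1 ->
  [/\ forall g m, CkB 0 m g -> periodic (Kt t g) 1 /\ mean0 (Pop (Kt t g)),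
      forall u, mean0 u -> mean0 (Tt t u)
    & exists2 J : (R -> R) -> R -> R, forall g, mean0 g ->
      [/\ mean0 (J g), forall x, J g x = Tt t (J g) x + g x,
          forall m, Lip m g -> Lip (C * m) (J g)
        & forall u, mean0 u -> (forall x, u x = Tt t u x + g x) -> u = J g]
    & forall s, `|s| <= e1 -> s != t -> CkB 1 (C * `|s - t|)
        (fun x => (rho s x - rho t x) / (s - t) - - J (Pop (Kt t (rho t))) x)].
Proof.
have [ea /andP[ea0 eae] [C C0 HC]] := response_remainder.
have [eb /andP[eb0 ebe] TL] := Tt_Lip.
pose th2 := (1 + th) / 2; have th20 : 0 <= th2 by rewrite divr_ge0// addr_ge0.
have th1_ := th1; have th21 : th2 < 1 by rewrite /th2; lra.
have q0 : 0 <= (1 - th2)^-1 by rewrite invr_ge0 subr_ge0 ltW.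
exists (Num.min ea eb); first by rewrite lt_min ea0 eb0 ge_min eae.
(* One constant for both the bound [1 / (1 - th2)] of [J] and the rate [C / (1 - th2)]. *)
exists ((C + 1) / (1 - th2)); first by rewrite mulr_ge0// addr_ge0.
move=> t; rewrite le_min => /andP[ta tb]; have te := le_trans ta eae.
have [J HJ] := Tt_resolvent te th20 th21 (fun m u => TL t m u tb).
split.
- move=> g m Cg; split; last exact: PopKt_mean0 te Cg.
  have d := continuous_bounded_flux te (CkB_cont Cg) (ex_intro _ m (CkB_bnd Cg)).
  exact: periodic_derive1 d (flux_periodic g te).
- by move=> u; exact: Tt_mean0.
exists J => [g mg|s].
  have [mJ JE JL Ju] := HJ g mg; split=> // m Lm; apply: Lip_le (JL _ Lm).
  have m0 := Lip_ge0 Lm; rewrite [leRHS]mulrAC ler_wpM2r//.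
  by rewrite mulrDl mul1r lerDr mulr_ge0.
rewrite le_min => /andP[sa sb] st; have se := le_trans sa eae.
have st0 : 0 < `|s - t| by rewrite normr_gt0 subr_eq0.
have mdel := del_mean0 se te.
pose r := Pop (Kt t (rho t)).
have mr : mean0 r := PopKt_mean0 te (CkB_leq (isT : (0 <= 3)%N) (rho_CkB te)).
have [mJ JE _ _] := HJ _ mr; have [_ _ [MJ CJ]] := mJ.
pose v x := -1 * J r x; have mv : mean0 v by exact: mean0Z.
have vE x : v x = Tt t v x - r x by rewrite /v (TtZ _ _ te (CkB_pred CJ)) {1}JE; ring.
have mu := mean0Z (s - t)^-1 mdel.
have mw := mean0B mu mv.
have [_ _ [Md Cd]] := mdel.
pose E x := (s - t)^-1 * (del s t x - Tt t (del s t) x + (s - t) * r x).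
have CE := CkBZ (s - t)^-1 (HC s t sa ta).
have wE x : (s - t)^-1 * del s t x - v x = Tt t (fun x => (s - t)^-1 * del s t x - v x) x + E x.
  rewrite TtB// (TtZ _ _ te (CkB_pred Cd)) {1}vE /E.
  by field; rewrite subr_eq0.
have Lw := mean0_fixed_Lip th20 th21 (fun u m => TL t m u tb) mw (CkB1_Lip CE) wE.
have := mean0_CkB1 mw Lw.
have -> : `|(s - t)^-1| * (C * `|s - t| ^+ 2) / (1 - th2) = C / (1 - th2) * `|s - t|.
  have n1 : `|s - t| != 0 by rewrite gt_eqF.
  have n2 : 1 - th2 != 0 by rewrite subr_eq0 gt_eqF.
  by rewrite normfV; move: (1 - th2) n2 => d n2; field; rewrite ?n1 ?n2.
move=> X; apply: CkB_ext (CkB_le _ X) => [x|].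
  by rewrite mulrC /v mulN1r.
by rewrite ler_wpM2r// ler_wpM2r// lerDl.
Qed.

End response.

(** * Convergence in the [C^1] norm and choice of the perturbation size *)

Section convergence.
Context {R : realType}.
Implicit Types (g : R -> R).

Lemma C1norm_ge0 g : (0 <= C1norm g)%E.
Proof.
have C0 g' : (0 <= C0norm g')%E by apply: le_trans (C0norm_ge g' 0); rewrite lee_fin.
by rewrite adde_ge0.
Qed.

Lemma CkB_C1norm (M : R) g : CkB 1 M g -> (C1norm g <= (2 * M)%:E)%E.
Proof. by move=> C; exact: C1norm_le (CkB_drv C) (CkB_bnd C) (CkB_bnd (CkB_derive1 C)). Qed.

Lemma C1norm_cvg0 (F : set_system R) (t C : R) (w : R -> R -> R) : Filter F -> F --> t ->
  (\forall s \near F, CkB 1 (C * `|s - t|) (w s)) -> C1norm (w s) @[s --> F] --> 0%E.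
Proof.
move=> FF Ft near_bound.
have cv : (2 * (C * `|s - t|))%:E @[s --> F] --> 0%E.
  apply: cvg_EFin; first by apply: nearW.
  have -> : 0 = 2 * (C * `|t - t|) :> R by rewrite subrr normr0 !mulr0.
  apply: cvgM; first exact: cvg_cst.
  apply: cvgM; first exact: cvg_cst.
  by apply: cvg_norm; apply: cvgB; [exact: Ft | exact: cvg_cst].
apply: (@squeeze_cvge _ _ _ _ (fun _ => 0%E) _ (fun s => (2 * (C * `|s - t|))%:E)) => //.
- by apply: filterS near_bound => s Cs; rewrite C1norm_ge0 CkB_C1norm.
- exact: cvg_cst.
Qed.

Lemma lipschitz_Lip (g : R -> R) : lipschitz g -> exists L, Lip L g.
Proof.
move=> [M [_ /(_ (M + 1))]]; rewrite ltrDl ltr01 => /(_ isT) H.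
by exists (M + 1) => x y; exact: (H (x, y)).
Qed.

Lemma Lip_continuous (L : R) g : Lip L g -> continuous g.
Proof.
move=> H x; apply/cvgrPdist_le => e e0; have L0 := Lip_ge0 H.
apply/nbhs_ballP; exists (e / (L + 1)) => /=; first by rewrite divr_gt0// ltr_wpDl.
move=> y; rewrite /ball /= ltr_pdivlMr ?ltr_wpDl// => xy; apply: le_trans (H x y) _.
apply: le_trans (ltW xy); rewrite mulrC ler_wpM2l// lerDl//.
Qed.

Lemma small_perturbation (N : nat) (F2 omega : R) : 0 <= F2 -> 1 < omega ->
  N%:R * (F2 * omega ^- 3 + omega ^- 2) < 1 ->
  exists eps th : R, [/\ 0 < eps, eps <= 1 / 2, th < 1, (1 + 2 * eps) * omega^-1 <= 1 &
   N%:R * (((1 + 2 * eps) * omega^-1) ^+ 2 +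
     (8 * eps * omega^-1 ^+ 2 + (1 + 2 * eps) * (F2 * omega ^- 3))) <= th].
Proof.
move=> F0 o1; set p := F2 * _; set q := omega ^- 2 => lt1.
have o0 : 0 < omega by apply: lt_trans o1.
have p0 : 0 <= p by rewrite mulr_ge0// invr_ge0 exprn_ge0// ltW.
have q0 : 0 <= q by rewrite invr_ge0 exprn_ge0// ltW.
have n0 : 0 <= N%:R :> R by exact: ler0n.
(* [B] bounds the growth rate in [eps]: [(1 + 2 * eps) ^+ 2 <= 1 + 6 * eps] and the term
   [8 * eps * q] give [14 * q], the last term gives [2 * p]. The bound of [eps] by [(omega - 1) / 2]
   ensures [(1 + 2 * eps) / omega <= 1]. *)
pose th0 := N%:R * (p + q); pose B := N%:R * (14 * q + 2 * p).
have B0 : 0 <= B by rewrite mulr_ge0// addr_ge0// mulr_ge0.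
pose eps := Num.min (1 / 2) (Num.min ((omega - 1) / 2) ((1 - th0) / 2 / (B + 1))).
have th01 : th0 < 1 by [].
have B1 : 0 < B + 1 by rewrite ltr_wpDl.
have eps0 : 0 < eps.
  rewrite /eps !lt_min; apply/and3P; split; [by lra | by lra |].
  by rewrite !divr_gt0// subr_gt0.
have e12 : eps <= 1 / 2 by rewrite /eps ge_min lexx.
have eo : eps <= (omega - 1) / 2 by rewrite /eps !ge_min lexx orbT.
have eB : eps * (B + 1) <= (1 - th0) / 2.
  by rewrite -ler_pdivlMr// /eps !ge_min lexx !orbT.
exists eps, ((1 + th0) / 2); split=> //; first by lra.
  by rewrite ler_pdivrMr// mul1r; lra.
have -> : omega^-1 ^+ 2 = q by rewrite exprVn.
rewrite exprMn exprVn -/q.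
have e2 : (1 + 2 * eps) ^+ 2 <= 1 + 6 * eps by nra.
have L1 : (1 + 2 * eps) ^+ 2 * q <= (1 + 6 * eps) * q by rewrite ler_wpM2r.
have : N%:R * ((1 + 2 * eps) ^+ 2 * q + (8 * eps * q + (1 + 2 * eps) * p)) <=
  N%:R * ((1 + 6 * eps) * q + (8 * eps * q + (1 + 2 * eps) * p)).
  by rewrite ler_wpM2l// lerD2r.
have -> : N%:R * ((1 + 6 * eps) * q + (8 * eps * q + (1 + 2 * eps) * p)) = th0 + eps * B.
  by rewrite /th0 /B; ring.
move/le_trans; apply; have : eps * B <= eps * (B + 1) by apply: ler_wpM2l; [exact: ltW | rewrite lerDl].
by move: (eps * B) (eps * (B + 1)) eB => *; lra.
Qed.

End convergence.

Unset Implicit Arguments.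

Theorem theorem1p2 (R : realType) (f : R -> R) (h : R * R -> R)
  (N : nat) (omega e0 : R) (rho : R -> R -> R)
  (f_C5 : Ck 5 f) (f_deg : degree_lift N f) (h_C5 : torus_Ck 5 h)
  (omega_gt1 : 1 < omega) (f_expanding : forall x, omega < `|f^`() x|)
  (N_small : (N%:R%:E * (C0norm f^`(2) * (omega ^- 3)%:E
                         + (omega ^- 2)%:E) < 1)%E)
  (e0_gt0 : 0 < e0)
  (Phi_diffeo : forall (t : R) (psi : R -> R), `|t| <= e0 -> density psi ->
     circle_diffeo (couplingPhi h t psi) /\
     forall x, 0 < (couplingPhi h t psi)^`() x)
  (rho_fixed : forall t : R, `|t| <= e0 ->
     [/\ density (rho t), lipschitz (rho t), forall x, 0 < rho t x
       & selfL f h t (rho t) = rho t])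
  (rho_unique : forall (t : R) (phi : R -> R), `|t| <= e0 -> density phi ->
     lipschitz phi -> selfL f h t phi = phi -> phi = rho t)
  (rho_attracts : forall t : R, `|t| <= e0 ->
     exists2 Lambda : R, Lambda < 1 & forall phi : R -> R,
       density phi -> lipschitz phi ->
       exists2 K : R, 0 < K & forall n : nat,
         (C0norm (fun x => iter n (selfL f h t) phi x - rho t x)%R
            <= (K * Lambda ^+ n)%:E)%E) :
  exists e1 : R, [/\ 0 < e1, e1 <= e0,
    forall t, `|t| <= e1 -> circle_Ck 3 (rho t) &
  exists e2 : R, [/\ 0 < e2, e2 <= e1,
    C1_curve `[- e2, e2] rho &
  exists e3 : R, [/\ 0 < e3, e3 <= e2 &
    forall t, `|t| < e3 ->
      let Pt := fun g => transferP f (transferQ h t (rho t) g) in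
      let PK := fun g => transferP f (operK h t (rho t) g) in
      C1_mean0 (PK (rho t)) /\
      exists2 J, is_inverse_on (@C1_mean0 R)
                   (fun g x => g x - Pt g x + t * PK g x) J
        & C1_deriv_at setT rho t (fun x => - J (PK (rho t)) x)]]].
Proof.
have o0 : 0 < omega by apply: lt_trans omega_gt1.
have [df Cf'] := Ck_succ f_C5; have [df' Cf''] := Ck_succ Cf'.
have pf' := periodic_derive1_lift f_C5 f_deg.
have pf'' := periodic_derive1 df' pf'.
have [F2' bf''] := periodic_bounded pf'' (Ck_continuous Cf'').
have [F2 [F2E F20 _ f2]] := C0norm_fin bf''.
have {}N_small : N%:R * (F2 * omega ^- 3 + omega ^- 2) < 1.
  move: N_small; rewrite (F2E : C0norm f^`(2) = F2%:E) => lt1.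
  by rewrite -lte_fin; exact: lt1.
have [s [G [dG [MG [G_branch G_CkB Gal Gbe transferE]]]]] :=
  inverse_lift f_C5 f_deg omega_gt1 f_expanding f2.
have [eps [th [eps0 eps2 th1 al1 Nth]]] := small_perturbation F20 omega_gt1 N_small.
have [M HM] := good_perturb G_branch G_CkB Gal Gbe eps2.
pose be := 8 * eps * omega^-1 ^+ 2 + (1 + 2 * eps) * (F2 * omega ^- 3).
have eps_ge0 := ltW eps0.
have be0 : 0 <= be.
  have oV0 : 0 <= omega^-1 by rewrite invr_ge0 ltW.
  apply: addr_ge0; first by apply: mulr_ge0; [exact: mulr_ge0 | exact: exprn_ge0].
  apply: mulr_ge0; first by apply: addr_ge0 => //; exact: mulr_ge0.
  by rewrite -exprVn; apply: mulr_ge0 => //; exact: exprn_ge0.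
have [M3 HM3] := invariant_density_CkB3 M be0 Nth th1 al1.
have [Mh Mh0 HMh] := meanA_CkB h_C5.
have ch := torus_continuous h_C5.
have Mh1 : 0 < Mh + 1 by rewrite ltr_wpDl.
(* [|t| * (Mh + 1) <= eps] makes the displacement at most [eps] in [C^5], since [rho t] has [L^1]
   norm [1]. *)
pose e := Num.min e0 (eps / (Mh + 1)).
have e_gt0 : 0 < e by rewrite lt_min e0_gt0 divr_gt0.
have ee0 (t : R) : `|t| <= e -> `|t| <= e0 by rewrite le_min => /andP[].
pose A (g : R -> R) : R -> R := meanA h g.
pose a (t x : R) : R := t * A (rho t) x.
pose Psi (t : R) : R -> R := pinv setT (couplingPhi h t (rho t)).
have rho_Lip (t : R) : `|t| <= e -> exists L, Lip L (rho t).
  by move=> /ee0 te; have [_ /lipschitz_Lip] := rho_fixed t te.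
have rho_cont (t : R) : `|t| <= e -> continuous (rho t).
  by move=> /rho_Lip [L]; exact: Lip_continuous.
have rho_per (t : R) : `|t| <= e -> periodic (rho t) 1.
  by move=> /ee0 te; have [[]] := rho_fixed t te.
have rho_mean (t : R) : `|t| <= e -> hasmean (rho t) 1.
  move=> te; have [[_ _ _ <-] _ _ _] := rho_fixed t (ee0 t te).
  by apply: integral_hasmean; [exact: rho_cont | exact: rho_per].
have a_CkB5 (t : R) : `|t| <= e -> CkB 5 eps (a t).
  move=> te; have [[_ rho0 _ rho1] _ _ _] := rho_fixed t (ee0 t te).
  have rn : circle_integral (fun y => `|rho t y|) <= 1.
    by rewrite -rho1 /circle_integral; under eq_Rintegral do rewrite ger0_norm//.
  apply: CkB_le (CkBZ t (HMh _ _ (rho_cont t te) rn)); rewrite mulr1.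
  apply: (@le_trans _ _ (`|t| * (Mh + 1))); first by rewrite ler_wpM2l// lerDl.
  by rewrite -ler_pdivlMr//; move: te; rewrite le_min => /andP[].
have a_CkB (t : R) : `|t| <= e -> CkB 4 eps (a t) by move=> /a_CkB5 /CkB_pred.
have a_CkB1 (t : R) : `|t| <= e -> CkB 1 eps (a t) by move=> /a_CkB; exact: CkB_leq.
have a_disp (t : R) : `|t| <= e -> disp_inverse (a t) (Psi t).
  move=> te; have [dens _ _ _] := rho_fixed t (ee0 t te).
  by apply: diffeo_disp; have [] := Phi_diffeo t (rho t) (ee0 t te) dens.
have A_per (g : R -> R) : periodic (A g) 1 by apply: meanA_periodic; case: h_C5.
have a_per (t : R) : periodic (a t) 1 by move=> x; rewrite /a A_per.
have H_good (t : R) : `|t| <= e -> good_branch N s%:~R ((1 + 2 * eps) * omega^-1) be M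
    (fun x => Psi t (G x)) (fun x => dinv (a t) (Psi t) (G x) * dG x).
  by move=> te; exact: HM (a_CkB t te) (a_per t) (a_disp t te).
pose P := Pop N s%:~R G dG.
have Q_per (t : R) (g : R -> R) : `|t| <= e -> periodic g 1 -> periodic (Qt a Psi t g) 1.
  move=> te pg x; have sh := disp_shift (a_per t) (a_disp t te).
  have pa' := periodic_derive1 (CkB_drv (a_CkB t te)) (a_per t).
  by rewrite /Qt /Qop /dinv !sh pa' pg.
have QE (t : R) (g : R -> R) : `|t| <= e -> transferQ h t (rho t) g = Qt a Psi t g.
  by move=> te; exact: transferQ_Qop (a_CkB1 t te).
have rho_eq (t : R) : `|t| <= e -> forall x, rho t x = P (chi a Psi rho t) x.
  move=> te x; have [_ _ _ fE] := rho_fixed t (ee0 t te).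
  rewrite -[LHS](congr1 (fun F => F x) fE) /selfL (QE t (rho t) te).
  by rewrite (transferE _ (Q_per t _ te (rho_per t te))).
have rho_CkB (t : R) : `|t| <= e -> CkB 3 M3 (rho t).
  move=> te; have [L HL] := rho_Lip t te.
  apply: (HM3 _ _ _ _ _ (H_good t te) (rho_per t te) (rho_mean t te) HL) => x.
  by rewrite -PopQt; exact: rho_eq.
have A_CkB (g : R -> R) (m : R) : continuous g -> (forall x, `|g x| <= m) -> CkB 4 (Mh * m) (A g).
  by move=> cg gm; apply: CkB_pred; apply: HMh => //; exact: circle_integral_le.
have A_Z (b : R) (g : R -> R) (x : R) : continuous g -> A (fun y => b * g y) x = b * A g x.
  by move=> cg; exact: meanAZ.
have A_B (g1 g2 : R -> R) (x : R) : continuous g1 -> continuous g2 ->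
    A (fun y => g1 y - g2 y) x = A g1 x - A g2 x.
  move=> c1 c2; rewrite /A; under [in LHS]eq_fun do rewrite -mulN1r.
  rewrite meanAD// ?meanAZ// ?mulN1r// => y.
  by apply: cvgM; [exact: cvg_cst | exact: c2].
have [e1 /andP[e10 e1e] [C C0 HC]] := linear_response G_branch G_CkB be0 Nth th1 al1 e_gt0 eps2
  Mh0 A_CkB A_B A_Z A_per (fun t x => erefl (a t x)) a_CkB a_disp H_good rho_per rho_mean rho_CkB rho_eq.
have ee (t : R) : `|t| <= e1 -> `|t| <= e by move=> t1; exact: le_trans t1 e1e.
pose PK (t : R) (g : R -> R) : R -> R := P (Kt A a Psi rho t g).
have PKE (t : R) (g : R -> R) (m : R) : `|t| <= e1 -> CkB 0 m g ->
    transferP f (operK h t (rho t) g) = PK t g.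
  move=> te Cg; have [/(_ g m Cg)[pK _] _ _] := HC t te.
  have -> : operK h t (rho t) g = Kt A a Psi rho t g := operK_E g (a_CkB1 t (ee t te)).
  exact: transferE.
have PQE (t : R) (g : R -> R) : `|t| <= e1 -> periodic g 1 ->
    transferP f (transferQ h t (rho t) g) = P (Qt a Psi t g).
  move=> te pg; rewrite (QE t g (ee t te)); apply: transferE.
  exact: Q_per (ee t te) pg.
pose T (t : R) := Tt N s%:~R G dG A a Psi rho t.
(* The condition on [t] is placed under the existential so that [J] can be chosen for all [t] at
   once; beyond [e1] it is zero. *)
have exJ (t : R) : exists J : (R -> R) -> R -> R, `|t| <= e1 ->
    (forall g, mean0 g ->
      [/\ mean0 (J g), forall x, J g x = T t (J g) x + g x,
          forall m, Lip m g -> Lip (C * m) (J g)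
        & forall u, mean0 u -> (forall x, u x = T t u x + g x) -> u = J g]) /\
    (forall r, `|r| <= e1 -> r != t -> CkB 1 (C * `|r - t|)
        (fun x => (rho r x - rho t x) / (r - t) - - J (PK t (rho t)) x)).
  have [te|nte] := pselect (`|t| <= e1); last by exists (fun _ _ => 0) => /nte.
  by have [_ _ [J J1 J2]] := HC t te; exists J.
have [J HJ] := choice exJ.
pose v (t x : R) : R := - J t (PK t (rho t)) x.
have rho0 (t : R) : `|t| <= e1 -> CkB 0 M3 (rho t).
  by move=> te; exact: CkB_leq (rho_CkB t (ee t te)).
have mPK (t : R) : `|t| <= e1 -> mean0 (PK t (rho t)).
  by move=> te; have [/(_ _ _ (rho0 t te))[_ ?] _ _] := HC t te.
have mv (t : R) : `|t| <= e1 -> mean0 (v t).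
  move=> te; have [/(_ _ (mPK t te))[mJ _ _ _] _] := HJ t te.
  by have := mean0Z (-1) mJ; under [X in mean0 X -> _]eq_fun do rewrite mulN1r.
have quotient (t r : R) : `|t| <= e1 -> `|r| <= e1 -> r != t ->
    CkB 1 (C * `|r - t|) (fun x => (rho r x - rho t x) / (r - t) - v t x).
  by move=> te; have [_] := HJ t te; exact.
(* The difference quotient is symmetric in r and t, so that v inherits its rate of convergence. *)
have v_Lip (t r : R) : `|t| <= e1 -> `|r| <= e1 -> CkB 1 (2 * C * `|r - t|) (v r \- v t).
  move=> te re; have [->|rt] := eqVneq r t.
    have := CkB_cst 1 (0 : R); rewrite subrr !normr0 mulr0.
    by apply: CkB_ext => x /=; rewrite subrr.
  have tr : t != r by rewrite eq_sym.
  have := CkBB (quotient t r te re rt) (quotient r t re te tr).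
  have -> : 2 * C * `|r - t| = C * `|r - t| + C * `|t - r|.
    by rewrite [`|t - r|]distrC; ring.
  apply: CkB_ext => x.
  rewrite -[RHS]/(v r x - v t x).
  have -> : (rho t x - rho r x) / (t - r) = (rho r x - rho t x) / (r - t).
    by field; rewrite !subr_eq0 rt tr.
  by move: (v t x) (v r x) (_ / _) => p q w; ring.
(* The estimates hold on a common interval, so one radius serves for the three assertions. *)
exists e1; split; [exact: e10 | | |].
- by apply: le_trans e1e _; rewrite ge_min lexx.
- by move=> t te; exact: CkB_circle_Ck (rho_per t (ee t te)) (rho_CkB t (ee t te)).
exists e1; split; [exact: e10 | exact: lexx | |].
  have I_le (t : R) : `[- e1, e1] t -> `|t| <= e1 by rewrite /= in_itv /= -ler_norml.
  split=> [t /I_le te|].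
    have [pt Ct] := (rho_per t (ee t te), rho_CkB t (ee t te)).
    exact: CkB_circle_Ck pt (CkB_leq (isT : (1 <= 3)%N) Ct).
  exists v => t /I_le te; split.
  - by have /mean0P[] := mv t te.
  - apply: (@C1norm_cvg0 R (within `[- e1, e1] t^') t C).
    + exact: cvg_trans (cvg_within _) (cvg_within _).
    + exact: (@filterE _ (nbhs t) _ _ (fun r rt Ir => quotient t r te (I_le r Ir) rt)).
  - apply: (@C1norm_cvg0 R (within `[- e1, e1] (nbhs t)) t (2 * C)).
    + exact: cvg_within.
    + exact: (@filterE _ (nbhs t) _ _ (fun r Ir => v_Lip t r te (I_le r Ir))).
exists e1; split; [exact: e10 | exact: lexx |] => t t1 Pt PK'; have te := ltW t1.
have PKr : PK' (rho t) = PK t (rho t) by exact: PKE (rho0 t te).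
have [Jt _] := HJ t te.
(* On zero mean functions the operator to be inverted is [1 - T_t]. *)
have LE (g : R -> R) : mean0 g -> (fun x => g x - Pt g x + t * PK' g x) = (fun x => g x - T t g x).
  move=> [pg _ [m Cg]]; apply/funext => x; rewrite /PK' (PKE t g m te (CkB_pred Cg)).
  by rewrite /Pt (PQE t g te pg) /T /Tt /PK /P; ring.
have Tm (g : R -> R) : mean0 g -> mean0 (T t g) by have [_ H _] := HC t te; exact: H.
rewrite PKr; split; first by apply/mean0P; exact: mPK.
exists (J t).
  split.
  - by move=> g /mean0P mg; apply/mean0P; rewrite (LE g mg); exact: mean0B mg (Tm g mg).
  - by move=> g /mean0P /Jt[/mean0P].
  - move=> g /mean0P mg; rewrite (LE g mg).
    have [_ _ _ Ju] := Jt _ (mean0B mg (Tm g mg)).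
    by rewrite -(Ju g mg)// => x; ring.
  - move=> g /mean0P mg; have [mJ JE _ _] := Jt g mg; rewrite (LE _ mJ).
    by apply/funext => x; rewrite {1}JE; ring.
  (* [J g] and its derivative are each at most [C] times the sup norm of [g'], hence the factor
     [2]. *)
  - exists (2 * C) => g /mean0P mg; have [mJ _ JL _] := Jt g mg.
    have [_ _ [m Cg]] := mg; have dg := CkB_drv Cg.
    have [m0 [E0 m00 _ _]] := C0norm_fin (CkB_bnd Cg).
    have [m1 [E1 m10 _ b1]] := C0norm_fin (CkB_bnd (CkB_derive1 Cg)).
    rewrite [X in (_ <= _ * X)%E]/C1norm E0 E1 -EFinD -EFinM.
    apply: le_trans (CkB_C1norm (mean0_CkB1 mJ (JL _ (drv_Lip dg b1)))) _.
    by rewrite lee_fin mulrA ler_wpM2l ?mulr_ge0// lerDr.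
rewrite -/(v t); apply: (@C1norm_cvg0 R (within setT t^') t C).
- exact: cvg_trans (cvg_within _) (cvg_within _).
(* As [|t| < e1] is strict, all [r] near [t] are admissible and the derivative is two-sided. *)
- have near_t : \forall r \near t, `|r| < e1.
    apply/nbhs_ballP; exists (e1 - `|t|); first by rewrite /= subr_gt0.
    move=> r; rewrite /ball /= distrC ltrBrDr => rt.
    have -> : r = (r - t) + t by ring.
    exact: le_lt_trans (ler_normD _ _) rt.
  have : nbhs t (fun r => r != t -> setT r -> CkB 1 (C * `|r - t|)
      (fun x => (rho r x - rho t x) / (r - t) - v t x)).
    by apply: filterS near_t => r /ltW re rt _; exact: quotient.
  exact.
Qed.
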